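(* Let $Z(t)=\{\xi(t),x(t)\}$ be an almost upper semi-continuous process on a finite Markov chain (as defined in the context, with $a_k<0$ for all $k$), and let $s>0$. Then the distribution of $\xi^+(\theta_s)$ is determined by the relations $$\boldsymbol{\Phi}_+(s,\alpha)=(\mathbf{C}-\imath\alpha\mathbf{I})\left(\mathbf{p}_+(s)\mathbf{P}_s^{-1}\mathbf{C}-\imath\alpha\mathbf{I}\right)^{-1}\mathbf{p}_+(s),\qquad \alpha\in\mathbb{R},$$ $$\mathbf{p}_+(s)=s\left(s\mathbf{I}+\mathbf{E}\,e^{\overline{\xi}(\theta_s)\mathbf{C}}\,\boldsymbol{\Lambda}\overline{\mathbf{F}}_0(0)\right)^{-1}\mathbf{P}_s,$$ $$\overline{\mathbf{P}}_+(s,x)=\mathbf{q}_+(s)\,e^{-\mathbf{P}_s^{-1}\mathbf{C}\,\mathbf{p}_+(s)\,x},\qquad x>0,$$ and for $\overline{\xi}(\theta_s)=\xi(\theta_s)-\xi^+(\theta_s)$ one has $$\boldsymbol{\Phi}^-(s,\alpha)=\mathbf{P}_s\mathbf{p}_+^{-1}(s)\left[\boldsymbol{\Phi}(s,\alpha)\right]_- -\mathbf{q}_+(s)\mathbf{p}_+^{-1}(s)\,\mathbf{C}\left[(\mathbf{C}-\imath\alpha\mathbf{I})^{-1}\boldsymbol{\Phi}(s,\alpha)\right]_-,\qquad \alpha\in\mathbb{R},$$ $$\mathbf{P}^-(s,x)=\mathbf{P}_s\mathbf{p}_+^{-1}(s)\mathbf{P}(s,x)-\mathbf{q}_+(s)\mathbf{p}_+^{-1}(s)\,\mathbf{C}\int_0^\infty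 e^{-\mathbf{C}y}\,\mathbf{P}(s,x-y)\,dy,\qquad x<0.$$
   Context: **The process.** $x(t)$, $t\ge 0$, is an irreducible (ergodic) continuous-time Markov chain on $E'=\{1,\dots,m\}$ with transition matrix $\mathbf{P}(t)=e^{t\mathbf{Q}}$, $\mathbf{Q}=\mathbf{N}(\mathbf{P}-\mathbf{I})$, where $\mathbf{N}=\|\delta_{kr}\nu_k\|$, $\nu_k>0$ is the parameter of the exponential sojourn time of $x(t)$ in state $k$, and $\mathbf{P}=\|p_{kr}\|$ is the transition matrix of the embedded chain $y_n=x(\sigma_n)$, $\sigma_n$ being the jump times of $x$. The process $\xi(t)$, $\xi(0)=0$, evolves as follows: while $x(t)=r$, it has the increments of a process $\xi_r$ with stationary independent increments; at a jump time of $x$ from $k$ to $r\ne k$ it receives in addition an independent jump distributed as $\chi_{kr}$. Put $\mathbf{F}(x)=\|\mathrm{P}\{\chi_{kr}<x,\ y_1=r\mid y_0=k\}\|$. **Almost upper semi-continuity.** Each $\xi_k$ has no Gaussian part and is a drift plus a compound Poisson process: $\xi_k$ has drift $a_k<0$, jump rate $\lambda_k$ and jump distribution function $F_0^k$ (Lévy measure $\Pi_k(dx)=\lambda_k\,dF_0^k(x)$). Write $\mathbf{A}=\|\delta_{kr}a_k\|$, $\boldsymbol{\Lambda}=\|\delta_{kr}\lambda_k\|$, $\boldsymbol{\Pi}(dx)=\|\delta_{kr}\Pi_k(dx)\|$, $\overline{\mathbf{F}}_0(0)=\|\delta_{kr}(1-F_0^k(0))\|$ (the probabilities that a jump of $\xi_k$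 is positive), and $d\mathbf{K}_0(z)=\mathbf{N}\,d\mathbf{F}(z)+\boldsymbol{\Pi}(dz)$. It is assumed that for $z>0$ $$d\mathbf{K}_0(z)=\boldsymbol{\Lambda}\overline{\mathbf{F}}_0(0)\,\mathbf{C}e^{-\mathbf{C}z}\,dz,\qquad \mathbf{C}=\|\delta_{kr}c_k\|,\ c_k>0,$$ i.e. positive jumps of $\xi$ occur only inside states and in state $k$ are exponential with parameter $c_k$ (so $\chi_{kr}\le 0$ a.s.). With $\boldsymbol{\Psi}(\alpha)=\imath\alpha\mathbf{A}+\boldsymbol{\Lambda}\overline{\mathbf{F}}_0(0)\mathbf{C}(\mathbf{C}-\imath\alpha\mathbf{I})^{-1}+\int_{-\infty}^0 e^{\imath\alpha x}d\mathbf{K}_0(x)-\boldsymbol{\Lambda}-\mathbf{N}$ one has $\|\mathrm{E}[e^{\imath\alpha\xi(t)},x(t)=r\mid x(0)=k]\|=e^{t\boldsymbol{\Psi}(\alpha)}$. **Standing assumptions.** $\mathrm{E}[|\xi(t)|,x(t)=r\mid x(0)=k]<\infty$ for all $k,r,t$; and, with $\tau^+(z)=\inf\{t:\xi(t)>z\}$ for $z>0$ and $\tau^-(z)=\inf\{t:\xi(t)<z\}$ for $z<0$, every state $k\in E'$ satisfies $\mathrm{P}\{x(\tau^\pm(z))=k\}>0$ (for an initial distribution of $x(0)$ charging all states). **Notation.** $\theta_s$ is exponential with parameter $s>0$, independent of $Z$. For a functional $\eta$ and an event $B$, bold $\mathbf{E}[\,f(\eta(\theta_s)),B\,]$ and $\mathbf{P}\{B\}$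 denote the $m\times m$ matrices with $(k,r)$ entries $\mathrm{E}[f(\eta(\theta_s)),B,x(\theta_s)=r\mid x(0)=k]$ and $\mathrm{P}\{B,x(\theta_s)=r\mid x(0)=k\}$. $\xi^+(t)=\sup_{0\le u\le t}\xi(u)$, $\overline{\xi}(t)=\xi(t)-\xi^+(t)$. - $\mathbf{P}_s=s(s\mathbf{I}-\mathbf{Q})^{-1}$; - $\boldsymbol{\Phi}(s,\alpha)=\mathbf{E}e^{\imath\alpha\xi(\theta_s)}=s(s\mathbf{I}-\boldsymbol{\Psi}(\alpha))^{-1}$, $\boldsymbol{\Phi}_+(s,\alpha)=\mathbf{E}e^{\imath\alpha\xi^+(\theta_s)}$, $\boldsymbol{\Phi}^-(s,\alpha)=\mathbf{E}e^{\imath\alpha\overline{\xi}(\theta_s)}$; - $\mathbf{P}(s,x)=\mathbf{P}\{\xi(\theta_s)<x\}$, $\overline{\mathbf{P}}_+(s,x)=\mathbf{P}\{\xi^+(\theta_s)>x\}$ for $x>0$, $\mathbf{P}^-(s,x)=\mathbf{P}\{\overline{\xi}(\theta_s)<x\}$ for $x<0$; - $\mathbf{p}_+(s)=\mathbf{P}\{\xi^+(\theta_s)=0\}$, $\mathbf{q}_+(s)=\mathbf{P}_s-\mathbf{p}_+(s)$; - $\mathbf{E}\,e^{\overline{\xi}(\theta_s)\mathbf{C}}=\int_{-\infty}^0 d\mathbf{P}^-(s,y)e^{\mathbf{C}y}$ is the matrix with $(k,r)$ entry $\mathrm{E}[e^{c_r\overline{\xi}(\theta_s)},x(\theta_s)=r\mid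 x(0)=k]$. **Projection.** If $\Phi(\alpha)=\|\int_{-\infty}^{\infty}e^{\imath\alpha x}df_{kr}(x)\|$ with $f_{kr}$ of bounded variation, then $[\Phi(\alpha)]_-=\|\int_{(-\infty,0)}e^{\imath\alpha x}df_{kr}(x)\|$ (the part on the open negative half-line). *)

(* Defs.v *)
From HB Require Import structures.
From mathcomp Require Export all_boot all_order all_algebra.
From mathcomp Require Export all_classical all_reals all_analysis.
From mathcomp Require Export complex.

Set Implicit Arguments.
Unset Strict Implicit.
Unset Printing Implicit Defensive.

Import Order.TTheory GRing.Theory Num.Theory.
Import numFieldNormedType.Exports.

Local Open Scope classical_set_scope.
Local Open Scope ring_scope.

Record map_data (R : realType) (m : nat) := MapData {
  nu : 'I_m -> R;
  (* Transition matrix of the embedded chain. The diagonal is not required to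
     vanish: if [trans k k > 0] the epochs sigma_n below are transition epochs,
     possibly fictitious. This covers m = 1, where [trans] must be 1. *)
  trans : 'M[R]_m;
  drift : 'I_m -> R;
  lam : 'I_m -> R;
  jump_law : 'I_m -> probability R R;
  chi_law : 'I_m -> 'I_m -> probability R R;
  crate : 'I_m -> R
}.

Section data.
Context {R : realType} {m : nat} (D : map_data R m).

Definition Nmx : 'M[R]_m := diag_mx (\row_k nu D k).
Definition Cmx : 'M[R]_m := diag_mx (\row_k crate D k).
Definition Lmx : 'M[R]_m := diag_mx (\row_k lam D k).
Definition Qmx : 'M[R]_m := Nmx *m (trans D - 1%:M).

Definition Fbar0 : 'M[R]_m :=
  diag_mx (\row_k fine (jump_law D k `]0, +oo[%classic)).

Definition irreducible_chain :=
  [/\ forall k, 0 < nu D k,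
      forall k r, 0 <= trans D k r,
      forall k, \sum_r trans D k r = 1
    & forall k r, exists n, 0 < (trans D ^+ n) k r].

(* The matrix measure dK_0 = N dF + Pi, where
   F_{kr}(x) = P{chi_{kr} < x, y_1 = r | y_0 = k} = p_{kr} P{chi_{kr} < x}. *)
Definition K0 (k r : 'I_m) (B : set R) : \bar R :=
  ((nu D k * trans D k r)%:E * chi_law D k r B +
   (if k == r then (lam D k)%:E * jump_law D k B else 0))%E.

Definition almost_upper_semicontinuous :=
  [/\ forall k, drift D k < 0,
      forall k, 0 < lam D k,
      forall k, 0 < crate D k
    & forall k r (B : set R), measurable B -> B `<=` `]0, +oo[ ->
        K0 k r B =
        (\int[lebesgue_measure]_(z in B)
           ((Lmx *m Fbar0 *m Cmx) k r * expR (- crate D r * z))%:E)%E].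

End data.

(* Sources of randomness. In its n-th sojourn (n = 0, 1, ...) the chain is in
   state k = [embedded n]; the sojourn lasts [sojourn n k], the increments of xi
   are those of a fresh copy of xi_k, namely a drift plus a compound Poisson
   process with inter-jump times [gap n k j] and jumps [jump_size n k j]; if the next
   state is r, xi then receives the jump [chi n k r]. *)
Record driver d (T : measurableType d) (R : realType) (m : nat) := Driver {
  embedded : nat -> T -> 'I_m;
  sojourn : nat -> 'I_m -> {mfun T >-> R};
  gap : nat -> 'I_m -> nat -> {mfun T >-> R};
  jump_size : nat -> 'I_m -> nat -> {mfun T >-> R};
  chi : nat -> 'I_m -> 'I_m -> {mfun T >-> R}
}.

Section paths.
Context {R : realType}.

Definition epoch (h : nat -> R) (n : nat) : R := \sum_(i < n) h i.

(* For positive [h] with diverging sum and t >= 0, exactly one n qualifies. *)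
Definition counting (h : nat -> R) (t : R) : nat :=
  xget 0%N [set n | epoch h n <= t < epoch h n.+1].

Definition compound (h J : nat -> R) (t : R) : R :=
  \sum_(j < counting h t) J j.

End paths.

Section process.
Context {R : realType} {m : nat} (D : map_data R m).
Context d (T : measurableType d) (W : driver T R m).

Definition holding (w : T) (n : nat) : R := sojourn W n (embedded W n w) w.

Definition sigma (n : nat) (w : T) : R := epoch (holding w) n.

Definition transitions (t : R) (w : T) : nat := counting (holding w) t.

Definition levy (n : nat) (k : 'I_m) (u : R) (w : T) : R :=
  drift D k * u + compound (fun j => gap W n k j w)
                           (fun j => jump_size W n k j w) u.

Definition chain (t : R) (w : T) : 'I_m := embedded W (transitions t w) w.

Definition xi (t : R) (w : T) : R :=
  let y n := embedded W n w in
  let n := transitions t w in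
  \sum_(i < n) (levy i (y i) (holding w i) w + chi W i (y i) (y i.+1) w)
  + levy n (y n) (t - sigma n w) w.

Definition xi_sup (t : R) (w : T) : R := sup [set xi u w | u in `[0, t]].

Definition xi_bar (t : R) (w : T) : R := xi t w - xi_sup t w.

Definition tau_plus (z : R) (w : T) : \bar R :=
  ereal_inf [set t%:E | t in [set t | 0 <= t /\ z < xi t w]].

Definition tau_minus (z : R) (w : T) : \bar R :=
  ereal_inf [set t%:E | t in [set t | 0 <= t /\ xi t w < z]].

(* The event {x(tau) = k}, which includes tau < +oo. *)
Definition state_at (tau : T -> \bar R) (k : 'I_m) : set T :=
  [set w | tau w \is a fin_num /\ chain (fine (tau w)) w = k].

(* [P k] is the law given x(0) = k; [theta] is the independent exponential
   time. Sojourns are positive and epochs diverge for every w, so that x(t) and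
   xi(t) are defined for all t >= 0. The final formula states that, under [P k],
   the embedded chain starts at k and has transition matrix [trans D], that all
   other sources have the stated laws, and that all are jointly independent. *)
Definition driven (s : R) (P : 'I_m -> probability T R)
    (theta : {mfun T >-> R}) :=
  [/\ forall w, [/\ 0 < theta w,
        forall n k, 0 < sojourn W n k w,
        forall n k j, 0 < gap W n k j w,
        forall t, exists n, t < sigma n w
      & forall n k t, exists j, t < epoch (fun i => gap W n k i w) j],
      forall n k, measurable (embedded W n @^-1` [set k])
    & forall (k : 'I_m) (N : nat) (r : nat -> 'I_m)
        (A : nat -> 'I_m -> set R) (B J : nat -> 'I_m -> nat -> set R)
        (X : nat -> 'I_m -> 'I_m -> set R) (H : set R),
        (forall n q, measurable (A n q)) ->
        (forall n q j, measurable (B n q j)) ->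
        (forall n q j, measurable (J n q j)) ->
        (forall n q l, measurable (X n q l)) ->
        measurable H ->
        P k [set w |
          [/\ forall n, (n <= N)%N -> embedded W n w = r n,
              forall n q, (n < N)%N -> A n q (sojourn W n q w),
              forall n q j, (n < N)%N -> (j < N)%N ->
                B n q j (gap W n q j w) /\ J n q j (jump_size W n q j w),
              forall n q l, (n < N)%N -> X n q l (chi W n q l w)
            & H (theta w)]] =
        (((r 0%N == k)%:R * \prod_(n < N) trans D (r n) (r n.+1))%R%:E *
         (\prod_(n < N) \prod_q exponential_prob (nu D q) (A n q)) *
         (\prod_(n < N) \prod_q \prod_(j < N)
            (exponential_prob (lam D q) (B n q j) * jump_law D q (J n q j))) *
         (\prod_(n < N) \prod_q \prod_l chi_law D q l (X n q l)) *
         exponential_prob s H)%E].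

Definition standing_assumptions (P : 'I_m -> probability T R) :=
  (forall k r t, 0 <= t ->
     (\int[P k]_(w in [set w | chain t w = r]) `|xi t w|%:E < +oo)%E) /\
  exists pi : 'I_m -> R,
    [/\ forall j, 0 < pi j, \sum_j pi j = 1,
        forall k z, 0 < z ->
          (0 < \sum_j (pi j)%:E * P j (state_at (tau_plus z) k))%E
      & forall k z, z < 0 ->
          (0 < \sum_j (pi j)%:E * P j (state_at (tau_minus z) k))%E].

End process.

Section matrices.
Context {R : realType} {m : nat}.

Definition expmx (A : 'M[R]_m) : 'M[R]_m :=
  \matrix_(i, j) limn (series (fun n => (n`!%:R^-1 *: A ^+ n) i j)).

Definition mxC (A : 'M[R]_m) : 'M[R[i]]_m := map_mx (real_complex R) A.

Definition iI (alpha : R) : 'M[R[i]]_m := (Complex 0 alpha)%:M.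

Definition fourier (mu : {finite_measure set R -> \bar R}) (A : set R)
    (alpha : R) : R[i] :=
  Complex (\int[mu]_(y in A) cos (alpha * y)) (\int[mu]_(y in A) sin (alpha * y)).

(* [f] and [g] are the positive and negative parts (in some decomposition) of a
   matrix of functions of bounded variation. *)
Definition fourier_mx (f g : 'I_m -> 'I_m -> {finite_measure set R -> \bar R})
    (A : set R) (alpha : R) : 'M[R[i]]_m :=
  \matrix_(k, r) (fourier (f k r) A alpha - fourier (g k r) A alpha).

(* The projection [Phi(alpha)]_-; by uniqueness of the Fourier-Stieltjes
   transform at most one function qualifies. *)
Definition neg_part (Phi : R -> 'M[R[i]]_m) : R -> 'M[R[i]]_m :=
  xget (fun=> 0) [set Psi | exists f g,
    (forall alpha, Phi alpha = fourier_mx f g setT alpha) /\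
    (forall alpha, Psi alpha = fourier_mx f g `]-oo, 0[ alpha)].

End matrices.

Section functionals.
Context {R : realType} {m : nat} (D : map_data R m).
Context d (T : measurableType d) (W : driver T R m).
Context (P : 'I_m -> probability T R) (theta : T -> R) (s : R).

Definition end_in (r : 'I_m) : set T := [set w | chain W (theta w) w = r].

Definition Pmx (B : set T) : 'M[R]_m :=
  \matrix_(k, r) fine (P k (B `&` end_in r)).

Definition Ecf (eta : T -> R) (alpha : R) : 'M[R[i]]_m :=
  \matrix_(k, r) Complex (\int[P k]_(w in end_in r) cos (alpha * eta w))
                         (\int[P k]_(w in end_in r) sin (alpha * eta w)).

Definition xi_th (w : T) : R := xi D W (theta w) w.
Definition xi_sup_th (w : T) : R := xi_sup D W (theta w) w.
Definition xi_bar_th (w : T) : R := xi_bar D W (theta w) w.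

Definition P_s : 'M[R]_m := s *: invmx (s%:M - Qmx D).

Definition Phi := Ecf xi_th.
Definition Phi_plus := Ecf xi_sup_th.
Definition Phi_minus := Ecf xi_bar_th.

Definition Pdist (y : R) := Pmx [set w | xi_th w < y].
Definition Pbar_plus (y : R) := Pmx [set w | y < xi_sup_th w].
Definition P_minus (y : R) := Pmx [set w | xi_bar_th w < y].

Definition p_plus := Pmx [set w | xi_sup_th w = 0].
Definition q_plus := P_s - p_plus.

Definition E_exp_bar_C : 'M[R]_m :=
  \matrix_(k, r) \int[P k]_(w in end_in r) expR (crate D r * xi_bar_th w).

End functionals.

(* Main.v *)
From HB Require Import structures.
Require Import Defs.
From mathcomp Require Import ring lra zify measurable_realfun.

(** Stop the process at the first event of a path: the killing at [theta], a
    jump inside the state, or a transition of the chain.  The drifts being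
    negative, the supremum before that event is [0], and after it the path is a
    fresh copy independent of the past.  Hence the law [mu] of the pair
    (supremum, value) at [theta] solves a one-step equation whose kernel
    has total mass at most some [beta < 1].

    A positive overshoot over a level is exponential and leaves the state
    unchanged.  Solving the equation killed above [0], which is a contraction,
    turns this into the ladder identity
      E_k [f (sup, xi); sup > 0, x = r]
        = sum_j U_kj int Exp_(c_j)(du) E_j [f (u + sup, u + xi); x = r],
      U_kj = E_k [exp (c_j xi); sup = 0, x = j] w_j / s,
    where [w_j] is the rate of the positive jumps in state [j].

    With f = 1 it gives p_+ = (I - U) P_s, and with f depending on xi - sup
    it gives (I - U) E e^(i alpha bar xi) = E [e^(i alpha xi); sup = 0], hence
    (I - U) (s I + E e^(C bar xi) Lambda F) = s I.  With f = e^(i alpha sup)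
    it gives Phi_+.  If f and phi agree on the negative half-line, then
    E f(bar xi) - sum_j U_kj E_j f(bar xi) is the same combination of
    phi(xi) and of phi(u + xi), [u] exponential: this yields [Phi_minus] and
    [P_minus], the projection being unambiguous by Fourier uniqueness.  Finally
    f = 1_(sup > x) gives a renewal equation that the matrix exponential of the
    theorem solves too, and the row sums of U, which are less than 1, make the
    solution unique. *)

Set Implicit Arguments.
Unset Strict Implicit.
Unset Printing Implicit Defensive.

Import Order.TTheory GRing.Theory Num.Theory.
Import numFieldNormedType.Exports.

Local Open Scope classical_set_scope.
Local Open Scope ring_scope.

(** * Uniqueness of measures and races of exponential clocks *)

(** The driver on [T] has no shift: the configuration seen after the first event is not read from
    the same sources. Paths are therefore mapped into a space of configurations, where shifting
    renames the sources and shortens the clocks still running. As [driven] prescribes laws on finite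
    cylinders only, regeneration is proved on cylinders and extended to all measurable sets. The
    ladder identity needs every starting height y <= 0, because the one-step equation moves the
    height and does not close at 0. From height y a jump crosses 0 with a weight proportional to exp
    (c y), while killing occurs at the constant rate s. Weighting the killing by exp (c y) thus
    gives an equation whose source is the same up to the factor w / s: this is the origin of [U],
    and no ladder process has to be constructed. Invertibility is a by-product: the identities
    exhibit one-sided inverses, which suffices for square matrices. The event xi = sup at the
    killing time has to be shown null, since the projection concerns the open half-line whereas bar
    xi could a priori vanish. *)

Section measure_tools.
Import HBNNSimple.
Local Open Scope ereal_scope.
Context {R : realType}.

Lemma eq_measure_rect d1 d2 (T1 : measurableType d1) (T2 : measurableType d2)
    (m1 m2 : {measure set (T1 * T2) -> \bar R}) :
  m1 setT < +oo ->
  (forall A B, measurable A -> measurable B -> m1 (A `*` B) = m2 (A `*` B)) ->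
  forall X, measurable X -> m1 X = m2 X.
Proof.
move=> m1oo m12 X mX.
pose C : set (set (T1 * T2)) :=
  [set C | exists A, measurable A /\ exists B, measurable B /\ C = A `*` B].
apply: (measure_unique C (fun=> setT)) => //.
- rewrite measurable_prod_measurableType //; congr (<<s _ >>).
  rewrite predeqE; split => [[A mA [B mB <-]]|[A [mA [B [mB ->]]]]].
    by exists A; split => //; exists B.
  by exists A => //; exists B.
- move=> /= _ _ [X1 [mX1 [X2 [mX2 ->]]]] [Y1 [mY1 [Y2 [mY2 ->]]]].
  rewrite -setXI; exists (X1 `&` Y1); split; first exact: measurableI.
  by exists (X2 `&` Y2); split => //; exact: measurableI.
- by move=> _; exists setT; split => //; exists setT; rewrite setXTT.
- by rewrite bigcup_const.
- by move=> _ [A [mA [B [mB ->]]]]; exact: m12.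
Qed.

Lemma eq_measure_ray (m1 m2 : {measure set R -> \bar R}) :
  m1 setT < +oo ->
  (forall x : R, m1 `]x, +oo[%classic = m2 `]x, +oo[%classic) ->
  forall A, measurable A -> m1 A = m2 A.
Proof.
move=> m1oo m12 A mA.
apply: (@measure_unique _ R R [set B | exists x : R, B = `]x, +oo[%classic]
          (fun n => `](- n%:R)%R, +oo[%classic)) => //.
- rewrite [LHS](RGenOInfty.measurableE R); congr (<<s _ >>).
- move=> _ _ [x ->] [y ->]; exists (Num.max x y).
  apply/seteqP; split=> z /=; rewrite !in_itv/= !andbT gt_max.
    by case=> -> ->.
  by case/andP.
- by move=> n; exists (- n%:R)%R.
- rewrite -subTset => x _; exists (Num.truncn `|x|%R).+1 => //=.
  rewrite in_itv/= andbT ltrNl (le_lt_trans _ (truncnS_gt _))//.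
  by rewrite -normrN ler_norm.
- by move=> _ [x ->].
- by move=> n; apply: le_lt_trans m1oo; apply: le_measure; rewrite ?inE.
Qed.

Lemma integral_density d (T : measurableType d)
    (mu nu : {measure set T -> \bar R}) (g : T -> R) :
  measurable_fun setT g -> (forall x, 0 <= g x)%R ->
  (forall A, measurable A -> nu A = \int[mu]_(x in A) (g x)%:E) ->
  forall f, measurable_fun setT f -> (forall x, 0 <= f x) ->
  \int[nu]_x f x = \int[mu]_x (f x * (g x)%:E).
Proof.
move=> mg g0 nuE f mf f0.
have mgE : measurable_fun setT (EFin \o g) by exact/measurable_EFinP.
pose h := nnsfun_approx measurableT mf.
have hf x : (h n x)%:E @[n --> \oo] --> f x.
  by apply: cvg_nnsfun_approx.
have nd_h x a b : (a <= b)%N -> (h a x <= h b x)%R.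
  by move=> ab; exact/lefP/nd_nnsfun_approx.
have mh n : measurable_fun setT (EFin \o h n).
  exact/measurable_EFinP/measurable_funP.
transitivity (limn (fun n => \int[nu]_x (h n x)%:E)).
  rewrite -monotone_convergence//.
  - by apply: eq_integral => x _; apply/esym/cvg_lim => //; exact: hf.
  - by move=> n x _; rewrite lee_fin.
  - by move=> x _ a b ab; rewrite lee_fin nd_h.
transitivity (limn (fun n => \int[mu]_x ((h n x)%:E * (g x)%:E))); last first.
  rewrite -monotone_convergence//.
  - by apply: eq_integral => x _; apply/cvg_lim => //; apply: cvgeZr => //; exact: hf.
  - by move=> n; apply: emeasurable_funM => //; exact: mh.
  - by move=> n x _; rewrite mule_ge0 ?lee_fin.
  - by move=> x _ a b ab; rewrite lee_wpmul2r ?lee_fin ?nd_h.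
congr (limn _); apply/funext => n.
under eq_integral do rewrite fimfunE -fsumEFin//.
rewrite ge0_integral_fsum//; last 2 first.
- move=> y; apply/measurable_EFinP; exact: measurable_funM.
- by move=> y x _; exact: nnfun_muleindic_ge0.
under [RHS]eq_integral => x _.
  rewrite fimfunE -fsumEFin// ge0_mule_fsuml; last first.
    by move=> y; exact: nnfun_muleindic_ge0.
  over.
rewrite ge0_integral_fsum//; last 2 first.
- move=> y; apply: emeasurable_funM => //; apply/measurable_EFinP.
  exact: measurable_funM.
- move=> y x _; apply: mule_ge0; last by rewrite lee_fin.
  by rewrite EFinM; exact: nnfun_muleindic_ge0.
apply: eq_fsbigr => r rhn.
rewrite integralZl_indic_nnsfun// integral_indic// setIT nuE//.
under [RHS]eq_integral do rewrite EFinM -muleA.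
have [r0|r0] := leP 0%R r.
  rewrite ge0_integralZl//; last 2 first.
  - by apply: emeasurable_funM => //; exact/measurable_EFinP.
  - by move=> x _; rewrite mule_ge0 ?lee_fin.
  rewrite integral_mkcond; congr (_ * _); apply: eq_integral => x _.
  by rewrite patchE indicE; case: ifPn => _; rewrite ?mul1e ?mul0e.
(* A negative value is not in the range of a nonnegative simple function. *)
move: rhn; rewrite inE => -[x _ hx].
have : (0 <= h n x)%R by exact: fun_ge0.
by rewrite hx leNgt r0.
Qed.

End measure_tools.

Section image_measure.
Local Open Scope ereal_scope.
Context d1 d2 (T1 : measurableType d1) (T2 : measurableType d2) (R : realType).

(** The pushforward takes the proof of measurability as an argument, so that the structures of
    measure and of finite measure are attached to the term itself. *)
Definition img (m : set T1 -> \bar R) (f : T1 -> T2)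
  of measurable_fun setT f : set T2 -> \bar R := pushforward m f.

Section measure.
Variables (m : {measure set T1 -> \bar R}) (f : T1 -> T2).
Hypothesis mf : measurable_fun setT f.

Let img0 : img m mf set0 = 0. Proof. exact: measure0. Qed.

Let img_ge0 A : 0 <= img m mf A. Proof. exact: measure_ge0. Qed.

Let img_sigma_additive : semi_sigma_additive (img m mf).
Proof. exact: measure_semi_sigma_additive. Qed.

HB.instance Definition _ := isMeasure.Build _ _ _ (img m mf)
  img0 img_ge0 img_sigma_additive.

Lemma ge0_integral_img (h : T2 -> \bar R) :
  measurable_fun setT h -> (forall x, 0 <= h x) ->
  \int[img m mf]_y h y = \int[m]_x h (f x).
Proof. by move=> mh h0; rewrite ge0_integral_pushforward. Qed.

End measure.

Section finite.
Variables (m : {finite_measure set T1 -> \bar R}) (f : T1 -> T2).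
Hypothesis mf : measurable_fun setT f.

Let img_fin : fin_num_fun (img m mf).
Proof.
move=> A mA; rewrite /img /pushforward fin_num_measure//.
by rewrite -[X in measurable X]setTI; exact: mf.
Qed.

HB.instance Definition _ := Measure_isFinite.Build _ _ _ (img m mf) img_fin.

End finite.

End image_measure.

Section product_finite.
Local Open Scope ereal_scope.
Context d1 d2 (T1 : measurableType d1) (T2 : measurableType d2) (R : realType).
Variables (m1 : {finite_measure set T1 -> \bar R})
          (m2 : {finite_measure set T2 -> \bar R}).

(* The product measure of the library is only declared to be finite for a pair
   of subprobabilities, whence this copy. *)
Definition prodm : set (T1 * T2) -> \bar R := m1 \x m2.

Let prodm0 : prodm set0 = 0. Proof. exact: measure0. Qed.

Let prodm_ge0 A : 0 <= prodm A. Proof. exact: measure_ge0. Qed.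

Let prodm_sigma_additive : semi_sigma_additive prodm.
Proof. exact: measure_semi_sigma_additive. Qed.

HB.instance Definition _ := isMeasure.Build _ _ _ prodm
  prodm0 prodm_ge0 prodm_sigma_additive.

Lemma prodmE A B : measurable A -> measurable B ->
  prodm (A `*` B) = m1 A * m2 B.
Proof. exact: product_measure1E. Qed.

Let prodm_fin : fin_num_fun prodm.
Proof.
move=> A mA; rewrite ge0_fin_numE ?measure_ge0//.
apply: (@le_lt_trans _ _ (prodm setT)); first by apply: le_measure; rewrite ?inE.
rewrite -setXTT prodmE//.
by rewrite -ge0_fin_numE ?mule_ge0// fin_numM// fin_num_measure.
Qed.

HB.instance Definition _ := Measure_isFinite.Build _ _ _ prodm prodm_fin.

Lemma prodm_xsection Z : prodm Z = \int[m1]_x m2 (xsection Z x).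
Proof. by []. Qed.

Lemma ge0_integral_prodm (f : T1 * T2 -> \bar R) :
  measurable_fun setT f -> (forall z, 0 <= f z) ->
  \int[prodm]_z f z = \int[m1]_x \int[m2]_y f (x, y).
Proof. by move=> mf f0; rewrite -fubini_tonelli1. Qed.

End product_finite.

Section exponential.
Context {R : realType}.
Variable c : {posnum R}.
Local Notation pdf := (exponential_pdf c%:num).

(** The rate is positive by its type, so that the law is a probability without side condition. *)
Definition expo : set R -> \bar R := exponential_prob c%:num.

Let expo0 : expo set0 = 0%E.
Proof. by rewrite /expo /exponential_prob integral_set0. Qed.

Let expo_ge0 A : (0 <= expo A)%E.
Proof. by apply: integral_ge0 => x _; rewrite lee_fin exponential_pdf_ge0. Qed.

Let expo_sigma_additive : semi_sigma_additive expo.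
Proof.
move=> F mF tF mUF; rewrite /expo /exponential_prob; apply: cvg_toP.
  apply: ereal_nondecreasing_is_cvgn => m n mn.
  apply: lee_sum_nneg_natr => // k _ _; apply: integral_ge0 => /= x Fkx.
  by rewrite lee_fin exponential_pdf_ge0.
rewrite ge0_integral_bigcup//=.
- apply/measurable_funTS/measurableT_comp => //.
  exact: measurable_exponential_pdf.
- by move=> x _; rewrite lee_fin exponential_pdf_ge0.
Qed.

HB.instance Definition _ :=
  isMeasure.Build _ R R expo expo0 expo_ge0 expo_sigma_additive.

Let expoT : expo setT = 1%E.
Proof. by rewrite /expo /exponential_prob integral_exponential_pdf. Qed.

HB.instance Definition _ := @Measure_isProbability.Build _ R R expo expoT.

Lemma expo_integral (f : R -> \bar R) :
  measurable_fun setT f -> (forall x, 0 <= f x)%E ->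
  (\int[expo]_x f x = \int[lebesgue_measure]_x (f x * (pdf x)%:E))%E.
Proof.
move=> mf f0.
(* The exponential law and the Lebesgue measure use two measurable structures on the same set; the
   image by the identity passes from one to the other. *)
pose idR : R -> measurableTypeR R := id.
have midR : measurable_fun setT idR by move=> _ B mB; rewrite setTI.
transitivity (\int[img expo midR]_x f x)%E; first by rewrite ge0_integral_img.
apply: integral_density => //; first exact: measurable_exponential_pdf.
by move=> x; rewrite exponential_pdf_ge0.
Qed.

Lemma expo_ray (x : R) : 0 <= x ->
  expo `]x, +oo[%classic = (expR (- c%:num * x))%:E.
Proof.
move=> x0; rewrite /expo /exponential_prob.
have cE : continuous (fun z : R => expR (- c%:num * z)).
  move=> z; apply: continuous_comp; last exact: continuous_expR.
  by apply: continuousM => //; exact: cst_continuous.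
have cfE : continuous (fun z : R => c%:num * expR (- c%:num * z)).
  by move=> z; apply: cvgM; [exact: cvg_cst|exact: cE].
rewrite integral_itv_obnd_cbnd; last first.
  by apply/measurable_funTS/measurable_EFinP; exact: measurable_exponential_pdf.
under eq_integral => y.
  rewrite inE/= in_itv/= andbT => xy.
  rewrite exponential_pdfE ?(le_trans x0)//; over.
rewrite (@ge0_continuous_FTC2y _ _ (fun y => - expR (- c%:num * y)) _ 0)//.
- by rewrite add0e -EFinN opprK.
- by apply: continuous_subspaceT; exact: cfE.
- rewrite -[X in _ --> X]oppr0; apply: cvgN.
  rewrite (_ : (fun x => expR (- c%:num * x)) =
               (fun z => expR (- z)) \o (fun z => c%:num * z)); last first.
    by apply: eq_fun => y; rewrite mulNr.
  apply: (@cvg_comp _ _ _ _ _ _ (pinfty_nbhs R)); last exact: cvgr_expR.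
  exact: gt0_cvgMry.
- by apply: cvgN; apply/cvg_at_right_filter; exact: cE.
- move=> z; rewrite in_itv/= andbT => xz.
  rewrite derive1_exponential_pdf ?exponential_pdfE ?in_itv/= ?andbT//.
    by rewrite (le_trans x0)// ltW.
  exact: (le_lt_trans x0).
Qed.

Lemma expo_ray0 (x : R) : x <= 0 -> expo `]x, +oo[%classic = 1%E.
Proof.
move=> x0; apply/eqP; rewrite eq_le probability_le1//=.
rewrite -[leLHS](_ : expo `]0, +oo[%classic = 1%E).
  by apply: le_measure; rewrite ?inE//; apply: subset_itvr; rewrite bnd_simp.
by rewrite expo_ray// mulr0 expR0.
Qed.

Lemma expo_pos : expo [set x | 0 < x] = 1%E.
Proof. by rewrite -(expo_ray0 (lexx 0)); congr expo; apply/seteqP; split=> x /=;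
  rewrite in_itv/= andbT. Qed.

End exponential.

Section memoryless.
Context {R : realType}.
Local Open Scope ereal_scope.

Lemma measurable_gt_shift (t : R) (A : set R) : measurable A ->
  measurable [set u | (t < u)%R /\ A (u - t)%R].
Proof.
move=> mA.
have mf : measurable_fun setT (fun u : R => (u - t)%R) by exact: measurable_funB.
have := mf measurableT _ (measurableI _ _ mA (measurable_itv `]0%R, +oo[)).
rewrite setTI (_ : _ @^-1` _ = [set u | (t < u)%R /\ A (u - t)%R])//.
apply/seteqP; split => u /=; rewrite in_itv/= andbT subr_gt0; tauto.
Qed.

(** Both sides are finite measures in [A], so rays suffice. On a ray starting at x >= 0 this is the
    functional equation of the exponential; a ray starting below 0 has full mass, since the shifted
    clock is positive. *)
Lemma expo_memoryless (c : {posnum R}) (t : R) (A : set R) :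
  (0 <= t)%R -> measurable A ->
  expo c [set u | (t < u)%R /\ A (u - t)%R] = (expR (- c%:num * t))%:E * expo c A.
Proof.
move=> t0 mA.
have mf : measurable_fun setT (fun u : R => (u - t)%R) by exact: measurable_funB.
have mt : measurable [set u : R | (t < u)%R].
  have := measurable_gt_shift t measurableT.
  by congr measurable; apply/seteqP; split => u //= [].
pose m1 : {finite_measure set R -> \bar R} := img (mrestr (expo c) mt) mf.
pose m2 : {measure set R -> \bar R} :=
  mscale (NngNum (expR_ge0 (- c%:num * t))) (expo c).
have -> : expo c [set u | (t < u)%R /\ A (u - t)%R] = m1 A.
  by rewrite /m1/= /img /pushforward /mrestr; congr (expo c); apply/seteqP;
    split=> u /= [].
apply: (@eq_measure_ray _ m1 m2) => //.
  by rewrite ltey_eq fin_num_measure.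
move=> x.
have -> : m2 `]x, +oo[%classic =
  (expR (- c%:num * t))%:E * expo c `]x, +oo[%classic by [].
rewrite /m1/= /img /pushforward /mrestr/=.
have [x0|x0] := leP 0%R x.
  rewrite expo_ray// -EFinM -expRD -mulrDr.
  rewrite -(@expo_ray _ _ (t + x)) ?addr_ge0//; congr (expo c).
  apply/seteqP; split => u /=; rewrite !in_itv/= !andbT; first by case=> ? _; lra.
  by move=> ?; split; lra.
rewrite (expo_ray0 _ (ltW x0)) mule1 -expo_ray//; congr (expo c).
apply/seteqP; split => u /=; rewrite !in_itv/= !andbT; first by case.
by move=> ?; split; lra.
Qed.

End memoryless.

Section race.
Context {R : realType}.
Local Open Scope ereal_scope.

Lemma eq_expo_integral (c : {posnum R}) (f g : R -> \bar R) :
  measurable_fun setT f -> measurable_fun setT g ->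
  (forall t, 0 <= f t) -> (forall t, 0 <= g t) ->
  (forall t, (0 <= t)%R -> f t = g t) ->
  \int[expo c]_t f t = \int[expo c]_t g t.
Proof.
move=> mf mg f0 g0 fg; rewrite !expo_integral//; apply: eq_integral => t _.
have [t0|t0] := leP 0%R t; first by rewrite fg.
by rewrite lt0_exponential_pdf// !mule0.
Qed.

Lemma measurable_race (A B H : set R) : measurable A -> measurable B -> measurable H ->
  measurable [set z : R * (R * R) | [/\ (z.1 < z.2.1)%R, (z.1 < z.2.2)%R, B z.1,
      A (z.2.1 - z.1)%R & H (z.2.2 - z.1)%R]].
Proof.
move=> mA mB mH.
set Z := [set z | _].
pose f1 (z : R * (R * R)) := (z.2.1 - z.1)%R.
pose f2 (z : R * (R * R)) := (z.2.2 - z.1)%R.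
have mf1 : measurable_fun setT f1.
  apply: measurable_funB => //; exact: measurableT_comp.
have mf2 : measurable_fun setT f2.
  apply: measurable_funB => //; exact: measurableT_comp.
have -> : Z = (f1 @^-1` (A `&` `]0%R, +oo[%classic)) `&` ((f2 @^-1` (H `&` `]0%R,
  +oo[%classic)) `&` (fst @^-1` B)).
  apply/seteqP; split => -[t [u v]]; rewrite /Z /f1 /f2 /=.
    by case=> tu tv Bt Au Hv; rewrite !in_itv/= !andbT !subr_gt0.
  by rewrite !in_itv/= !andbT !subr_gt0; case=> -[? ?] [] [].
have P1 := mf1 measurableT _ (measurableI _ _ mA (measurable_itv `]0%R, +oo[)).
have P2 := mf2 measurableT _ (measurableI _ _ mH (measurable_itv `]0%R, +oo[)).
have P3 := @measurable_fst _ _ R (R * R)%type measurableT _ mB.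
by move: P1 P2 P3; rewrite !setTI => ? ? ?; do 2 apply: measurableI => //.
Qed.

Variables (a b c : {posnum R}).

(** Multiplying the density of rate a by exp (- e t) gives a / r times the density of rate r = a +
    e. The tilt [e] is the total rate of the rivals in a race, and - c a when the time is spent
    drifting with slope a. *)
Lemma expo_tilt (e : R) (r : {posnum R}) (B : set R) :
  r%:num = (a%:num + e)%R -> measurable B ->
  \int[expo a]_(t in B) (expR (- e * t))%:E = (a%:num / r%:num)%:E * expo r B.
Proof.
move=> rE mB.
have mexp : measurable_fun setT (fun t : R => (expR (- e * t))%:E).
  by apply/measurable_EFinP; apply: measurableT_comp.
rewrite integral_mkcond expo_integral; last 2 first.
- by apply/(measurable_restrictT _ mB); exact/measurable_funTS.
- by move=> t; rewrite patchE; case: ifPn => // _; rewrite lee_fin expR_ge0.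
have ar0 : (0 <= a%:num / r%:num)%R by [].
rewrite /expo /exponential_prob -ge0_integralZl_EFin; last 4 first.
- exact: mB.
- by move=> t _; rewrite lee_fin exponential_pdf_ge0.
- apply/measurable_funTS/measurable_EFinP; exact: measurable_exponential_pdf.
- exact: ar0.
rewrite [RHS]integral_mkcond; apply: eq_integral => t _.
rewrite !patchE; case: ifPn => _; last by rewrite mul0e.
have [t0|t0] := leP 0%R t; last by rewrite !lt0_exponential_pdf// !mule0.
rewrite !exponential_pdfE// -!EFinM; congr (_%:E).
rewrite [in RHS]mulrA divfK ?gt_eqF//.
by rewrite rE opprD mulrDl expRD; ring.
Qed.

(** Given that the first clock rings at t, memorylessness leaves each rival a fresh residual and a
    factor exp (- rate t). The product of these factors tilts the law of t into the exponential law
    of the total rate. *)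
Lemma expo_race3 (r : {posnum R}) (A B H : set R) :
  r%:num = (a%:num + (b%:num + c%:num))%R ->
  measurable A -> measurable B -> measurable H ->
  prodm (expo a) (prodm (expo b) (expo c))
    [set z | [/\ (z.1 < z.2.1)%R, (z.1 < z.2.2)%R, B z.1,
      A (z.2.1 - z.1)%R & H (z.2.2 - z.1)%R]] =
  (a%:num / r%:num)%:E * expo r B * (expo b A * expo c H).
Proof.
move=> rE mA mB mH.
set Z := [set z | _].
have mZ : measurable Z by exact: measurable_race.
pose m2 : {finite_measure set (R * R)%type -> \bar R} := prodm (expo b) (expo c).
have -> : prodm (expo a) (prodm (expo b) (expo c)) Z =
  \int[expo a]_t m2 (xsection Z t) by [].
transitivity (\int[expo a]_t ((expR (- (b%:num + c%:num)%R * t))%:E *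
  (expo b A * expo c H) * (\1_B t)%:E)).
  apply: eq_expo_integral.
  - exact: measurable_fun_xsection.
  - apply: emeasurable_funM; first by apply: emeasurable_funM => //;
    apply/measurable_EFinP; apply: measurableT_comp.
    by apply/measurable_EFinP; exact: measurable_indic.
  - by move=> t; exact: measure_ge0.
  - by move=> t; rewrite !mule_ge0 ?lee_fin ?expR_ge0.
  move=> t t0.
  have -> : xsection Z t = if t \in B then [set u | (t < u)%R /\ A (u - t)%R] `*`
    [set v | (t < v)%R /\ H (v - t)%R] else set0.
    apply/seteqP; split => -[u v]; rewrite /xsection/= inE/=.
      by case=> /= ? ? /mem_set -> ? ?.
    by case: ifPn => // /set_mem Bt [] [] ? ? [] ? ?.
  rewrite indicE; case: ifPn => // tB; last by rewrite measure0 mule0.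
  rewrite mule1 [LHS]prodmE; last 2 first.
  - exact: measurable_gt_shift.
  - exact: measurable_gt_shift.
  apply: (eq_trans (congr2 _ (expo_memoryless b t0 mA) (expo_memoryless c t0 mH))).
  by rewrite opprD mulrDl expRD EFinM muleACA.
under eq_integral do rewrite muleAC.
rewrite ge0_integralZr//; last 2 first.
- apply: emeasurable_funM; first by apply/measurable_EFinP; apply: measurableT_comp.
  by apply/measurable_EFinP; exact: measurable_indic.
- by rewrite mule_ge0.
rewrite -(expo_tilt rE mB); congr (_ * _); rewrite [RHS]integral_mkcond.
by apply: eq_integral => t _; rewrite patchE indicE; case: ifPn; rewrite ?mule1 ?mule0.
Qed.

End race.

(** * The space of configurations *)

(* The clocks and marks that a path reads: sojourn times, gaps between and sizes
   of the jumps inside a state, marks of the transitions, killing time. *)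
Inductive src (m : nat) :=
| Soj of nat & 'I_m | Gap of nat & 'I_m & nat | Jmp of nat & 'I_m & nat
| Chi of nat & 'I_m & 'I_m | Tht.
Arguments Tht {m}.

(* Kept opaque, lest simplification unfolds boolean equality. *)
Fact src_eqMixin m : hasDecEq (src m). Proof. exact: gen_eqMixin. Qed.
HB.instance Definition _ m := src_eqMixin m.

(* The index serves only to make the type pointed. *)
Definition conf (R : realType) (m : nat) of 'I_m : Type :=
  ((nat -> 'I_m) * (src m -> R))%type.

(** * Cylinders and the sigma-algebra that they generate *)

Section cylinders.
Context {R : realType} {m : nat} (o : 'I_m).
Local Notation conf := (conf R o).

HB.instance Definition _ := gen_eqMixin conf.
HB.instance Definition _ := gen_choiceMixin conf.
HB.instance Definition _ := isPointed.Build conf (fun=> o, fun=> 0).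

(** The whole initial segment of the chain is prescribed, never a single state, because the law of
    the chain in [driven] is given in that form. *)
Definition cyl (N : nat) (r : nat -> 'I_m) (F : seq (src m)) (E : src m -> set R) : set
  conf :=
  [set x | (forall n, (n <= N)%N -> x.1 n = r n) /\ forall i, i \in F -> E i (x.2 i)].

Definition cyls : set (set conf) :=
  [set C | exists N r F E, (forall i, measurable (E i)) /\ C = cyl N r F E].

Definition path_space : Type := g_sigma_algebraType cyls.

Lemma cyls_setI : setI_closed cyls.
Proof.
move=> _ _ [N [r [F [E [mE ->]]]]] [N' [r' [F' [E' [mE' ->]]]]].
have [agree|] := pselect (forall n, (n <= N)%N -> (n <= N')%N -> r n = r' n).
  exists (maxn N N'), (fun n => if (n <= N)%N then r n else r' n), (F ++ F').
  exists (fun i => (if i \in F then E i else setT) `&` (if i \in F' then E' i else setT)).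
  split; first by move=> i; apply: measurableI; case: ifP.
  apply/seteqP; split => x.
    move=> [[xr xE] [xr' xE']]; split => [n|i].
      by case: ifPn => [|nN]; [move=> /xr|rewrite leq_max (negbTE nN) => /= /xr'].
    by rewrite mem_cat => _; split; case: ifP => // iF; [exact: xE|exact: xE'].
  move=> [xr xE]; split; split => [n nN|i iF].
  - by rewrite xr ?leq_max ?nN.
  - by have := xE i; rewrite mem_cat iF => /(_ isT)[].
  - rewrite xr ?leq_max ?nN ?orbT//; case: ifPn => // nN'; exact: agree.
  - by have := xE i; rewrite mem_cat iF orbT => /(_ isT)[].
(* Two incompatible initial segments: the empty intersection is itself a cylinder, with an empty
   constraint on the killing time. *)
move=> nagree; exists 0%N, r, [:: Tht], (fun=> set0); split=> //.
apply/seteqP; split => x; last by move=> [_ /(_ Tht)]; rewrite inE eqxx => /(_ isT).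
move=> [[xr _] [xr' _]]; exfalso; apply: nagree => n nN nN'.
by rewrite -xr// xr'.
Qed.

(** The full space is not one cylinder, since the initial state is always prescribed. It is the
    union over the initial states, which [insubd] enumerates by natural numbers, those beyond [m]
    giving [o] again. *)
Lemma cyls_cover : \bigcup_n cyl 0 (fun=> insubd o n) [::] (fun=> setT) = setT.
Proof.
rewrite -subTset => x _; exists (val (x.1 0%N)) => //; split => // n.
by rewrite leqn0 => /eqP ->; apply/val_inj; rewrite val_insubd ltn_ord.
Qed.

Lemma eq_measure_cyl (m1 m2 : {measure set path_space -> \bar R}) :
  (m1 setT < +oo)%E -> (forall C, cyls C -> m1 C = m2 C) ->
  forall A, measurable A -> m1 A = m2 A.
Proof.
move=> m1oo m12 A mA.
apply: (@measure_unique _ R path_space cyls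
  (fun n => cyl 0 (fun=> insubd o n) [::] (fun=> setT))) => //.
- exact: cyls_setI.
- by move=> n; exists 0%N, (fun=> insubd o n), [::], (fun=> setT).
- exact: cyls_cover.
- move=> n; apply: le_lt_trans m1oo; apply: le_measure; rewrite ?inE//.
  apply: sub_sigma_algebra.
  by exists 0%N, (fun=> insubd o n), [::], (fun=> setT).
Qed.

Lemma measurable_src (i : src m) : measurable_fun [set: path_space] (fun x => x.2 i).
Proof.
move=> _ B mB; rewrite setTI.
rewrite (_ : _ @^-1` _ = \bigcup_n cyl 0 (fun=> insubd o n) [:: i] (fun=> B)).
  apply: bigcup_measurable => n _; apply: sub_sigma_algebra.
  by exists 0%N, (fun=> insubd o n), [:: i], (fun=> B).
apply/seteqP; split => x /=.
  move=> Bx; exists (val (x.1 0%N)) => //; split => n.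
    by rewrite leqn0 => /eqP ->; apply/val_inj; rewrite val_insubd ltn_ord.
  by rewrite inE => /eqP ->.
by move=> [n _ [_]]; apply; rewrite inE.
Qed.

(** A state at time [n] is the finite union, over the initial segments ending in it, of the
    cylinders that they define. *)
Lemma measurable_emb n (k : 'I_m) : measurable [set x : path_space | x.1 n = k].
Proof.
rewrite (_ : [set x | _] = \bigcup_(f in [set f : {ffun 'I_n.+1 -> 'I_m} | f ord_max = k])
   cyl n (fun j => f (inord j)) [::] (fun=> setT)).
  apply: fin_bigcup_measurable => [|f _]; first exact: finite_finset.
  by apply: sub_sigma_algebra; exists n, (fun j => f (inord j)), [::], (fun=> setT).
apply/seteqP; split => x /=.
  move=> xk; exists [ffun j => x.1 (val j)]; first by rewrite /= ffunE.
  by split => // j jn; rewrite ffunE /= inordK.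
move=> [f /= <- [xf _]]; rewrite xf//; congr (f _).
by apply/val_inj; rewrite /= inordK.
Qed.

Lemma measurable_to_path d (T : measurableType d) (f : T -> path_space) :
  (forall n k, measurable [set t | (f t).1 n = k]) ->
  (forall i, measurable_fun setT (fun t => (f t).2 i)) ->
  measurable_fun setT f.
Proof.
move=> femb fsrc; apply: (@measurability _ _ _ _ _ f cyls) => //.
move=> _ [_ [N [r [F [E [mE ->]]]]] <-]; rewrite setTI.
rewrite (_ : _ @^-1` _ = (\bigcap_(n in [set n | (n <= N)%N])
  [set t | (f t).1 n = r n]) `&`
    (\bigcap_(i in [set i | i \in F]) (fun t => (f t).2 i) @^-1` E i)).
  apply: measurableI.
    by apply: bigcap_measurableType => n _; exact: femb.
  apply: fin_bigcap_measurable => // i _.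
  by rewrite -[X in measurable X]setTI; exact: fsrc.
by apply/seteqP; split => t [H1 H2].
Qed.

End cylinders.

(** * Independence of the sources and the law of a shifted configuration *)

Section independence.
Local Open Scope ereal_scope.
Context {R : realType}.

(** Rectangles determine a finite joint law. The event [D] and the constant [K] allow iteration:
    coordinates already treated are absorbed in [D]. *)
Lemma indep_pair d d1 d2 (T : measurableType d) (T1 : measurableType d1)
    (T2 : measurableType d2) (P : {finite_measure set T -> \bar R}) (D : set T)
    (f : T -> T1) (g : T -> T2) (mu1 : {finite_measure set T1 -> \bar R})
    (mu2 : {finite_measure set T2 -> \bar R}) (K : R) :
  (0 <= K)%R -> measurable D -> measurable_fun setT f -> measurable_fun setT g ->
  (forall A B, measurable A -> measurable B ->
    P (D `&` [set w | A (f w) /\ B (g w)]) = K%:E * (mu1 A * mu2 B)) ->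
  forall Z, measurable Z ->
    P (D `&` [set w | Z (f w, g w)]) = K%:E * prodm mu1 mu2 Z.
Proof.
move=> K0 mD mf mg PAB Z mZ.
have mfg : measurable_fun setT (fun w => (f w, g w)) by exact: measurable_fun_pair.
pose m1 : {finite_measure set (T1 * T2)%type -> \bar R} := img (mrestr P mD) mfg.
pose m2 : {finite_measure set (T1 * T2)%type -> \bar R} :=
  mscale (NngNum K0) (prodm mu1 mu2).
have -> : P (D `&` [set w | Z (f w, g w)]) = m1 Z.
  by rewrite setIC.
have -> : K%:E * prodm mu1 mu2 Z = m2 Z by [].
apply: eq_measure_rect => //; first by rewrite ltey_eq fin_num_measure.
move=> A B mA mB.
transitivity (K%:E * (mu1 A * mu2 B)); first by rewrite -PAB// setIC.
by rewrite -(prodmE mu1 mu2 mA mB).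
Qed.

Context {m : nat} (o : 'I_m) d (T : measurableType d) (P : probability T R).
Variables (code : T -> conf R o) (k : 'I_m) (p : 'M[R]_m) (L : src m -> probability R R).
Hypothesis p0 : forall i j, (0 <= p i j)%R.
Hypothesis mcode : measurable_fun setT (code : T -> path_space o).

Definition path_prob (k : 'I_m) N (r : nat -> 'I_m) : R :=
  ((r 0 == k)%:R * \prod_(n < N) p (r n) (r n.+1))%R.

Lemma path_prob_ge0 N r : (0 <= path_prob k N r)%R.
Proof. by rewrite mulr_ge0// prodr_ge0. Qed.

Hypothesis law : forall N r F (E : src m -> set R), uniq F ->
  (forall i, measurable (E i)) ->
  P (code @^-1` cyl N r F E) = (path_prob k N r)%:E * \prod_(i <- F) L i (E i).

Lemma measurable_cyl N r F E : (forall i, measurable (E i)) ->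
  measurable (code @^-1` cyl N r F E).
Proof.
move=> mE; rewrite -[X in measurable X]setTI; apply: mcode => //.
by apply: sub_sigma_algebra; exists N, r, F, E.
Qed.

Lemma measurable_coord i : measurable_fun setT (fun w => (code w).2 i).
Proof. exact: (measurableT_comp (measurable_src i) mcode). Qed.

Lemma prod_law_fin F (E : src m -> set R) : (forall i, measurable (E i)) ->
  (\prod_(i <- F) L i (E i)) \is a fin_num.
Proof.
move=> mE; elim/big_ind : _ => // [x y|i _]; first exact: fin_numM.
exact: fin_num_measure.
Qed.

Lemma prod_law_ge0 F (E : src m -> set R) : 0 <= \prod_(i <- F) L i (E i).
Proof. by elim/big_ind : _ => // x y; exact: mule_ge0. Qed.

(** The order of three clocks is not a product event, so the product formula on cylinders has to be
    extended to arbitrary sets of triples. One coordinate is split off at a time. *)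
Lemma law3 N r F (E : src m -> set R) a b c (Z : set (R * (R * R))) :
  uniq [:: a, b, c & F] -> (forall i, measurable (E i)) -> measurable Z ->
  P (code @^-1` cyl N r F E `&`
     [set w | Z ((code w).2 a, ((code w).2 b, (code w).2 c))]) =
  (path_prob k N r)%:E * (\prod_(i <- F) L i (E i)) *
    prodm (L a) (prodm (L b) (L c)) Z.
Proof.
rewrite !cons_uniq !inE !negb_or -!andbA.
move=> /and5P[ab ac aF bc /and3P[bF cF uF0]] mE mZ.
set K := fine ((path_prob k N r)%:E * \prod_(i <- F) L i (E i)).
have KE : (path_prob k N r)%:E * (\prod_(i <- F) L i (E i)) = K%:E.
  by rewrite fineK// fin_numM// prod_law_fin.
have K0 : (0 <= K)%R.
  by rewrite fine_ge0// mule_ge0 ?prod_law_ge0// lee_fin path_prob_ge0.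
rewrite KE; clearbody K.
apply: (@indep_pair _ _ _ T R (R * R)%type P _ (fun w => (code w).2 a)
  (fun w => ((code w).2 b, (code w).2 c)) (L a) (prodm (L b) (L c))) => //.
- exact: measurable_cyl.
- exact: measurable_coord.
- by apply: measurable_fun_pair; exact: measurable_coord.
move=> A X mA mX.
pose E1 i := if i == a then A else E i.
have mE1 i : measurable (E1 i) by rewrite /E1; case: ifP.
have cylA : code @^-1` cyl N r F E `&` [set w | A ((code w).2 a)] =
    code @^-1` cyl N r (a :: F) E1.
  apply/seteqP; split => w /=.
    move=> [[wr wE] Aw]; split => // i; rewrite inE /E1.
    by case: eqVneq => [-> //|_] /=; exact: wE.
  move=> [wr wE]; split; first split => // i iF.
    have := wE i; rewrite inE iF orbT /E1 => /(_ isT).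
    by case: eqVneq iF => // ->; rewrite (negbTE aF).
  by have := wE a; rewrite inE eqxx /E1 eqxx; exact.
have PA : P (code @^-1` cyl N r (a :: F) E1) = K%:E * L a A.
  rewrite law//; last by rewrite cons_uniq aF uF0.
  rewrite big_cons {1}/E1 eqxx muleCA muleC -KE; congr (_ * _ * _).
  rewrite !big_seq; apply: eq_bigr => i iF; rewrite /E1.
  by case: eqVneq iF => // ->; rewrite (negbTE aF).
rewrite (_ : _ `&` _ = (code @^-1` cyl N r (a :: F) E1) `&` [set w | X
  ((code w).2 b, (code w).2 c)]); last first.
  by rewrite -cylA; apply/seteqP; split => w /=; tauto.
set K1 := fine (K%:E * L a A).
have K1E : K%:E * L a A = K1%:E.
  by rewrite [RHS]fineK// fin_numM// fin_num_measure.
rewrite muleA K1E.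
apply: (@indep_pair _ _ _ T R R P _ (fun w => (code w).2 b)
  (fun w => (code w).2 c) (L b) (L c)) => //.
- by rewrite fine_ge0// mule_ge0.
- exact: measurable_cyl.
- exact: measurable_coord.
- exact: measurable_coord.
move=> B C mB mC.
pose E2 i := if i == b then B else if i == c then C else E1 i.
have mE2 i : measurable (E2 i) by rewrite /E2; case: ifP => // _; case: ifP.
have E2E i : i \in a :: F -> E2 i = E1 i.
  rewrite /E2 inE => iF; case: (eqVneq i b) iF => [->|_ iF].
    by rewrite (eq_sym b) (negbTE ab) (negbTE bF).
  case: (eqVneq i c) iF => [->|//].
  by rewrite (eq_sym c) (negbTE ac) (negbTE cF).
rewrite (_ : _ `&` _ = code @^-1` cyl N r [:: b, c & a :: F] E2); last first.
  apply/seteqP; split => w /=.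
    move=> [[wr wE] [Bw Cw]]; split => // i; rewrite 2!in_cons.
    case/or3P => [/eqP ->|/eqP ->|iF].
    - by rewrite /E2 eqxx.
    - by rewrite /E2 eqxx (eq_sym c) (negbTE bc).
    - by rewrite E2E//; exact: wE.
  move=> [wr wE]; split; first split => // i iF.
    by rewrite -E2E//; apply: wE; rewrite 2!in_cons iF !orbT.
  split; first by have := wE b; rewrite inE eqxx /E2 eqxx; exact.
  have := wE c; rewrite !inE eqxx orbT /E2 eqxx => /(_ isT).
  by rewrite (eq_sym c) (negbTE bc).
rewrite [LHS]law//; last first.
  by rewrite !cons_uniq !inE !negb_or bc (eq_sym b a) ab bF (eq_sym c a) ac cF aF uF0.
rewrite 2!big_cons -K1E -PA law//; last by rewrite cons_uniq aF uF0.
rewrite {1 2}/E2 !eqxx (eq_sym c) (negbTE bc).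
rewrite -!muleA; congr (_ * _); rewrite [RHS]muleC -!muleA; congr (_ * (_ * _)).
by rewrite !big_seq; apply: eq_bigr => i iF; rewrite E2E.
Qed.

Section shift.
Variables (w : nat -> nat) (res : seq (src m)) (tau : src m -> src m).
Variables (a b c e : src m).
Hypothesis tau_inj : injective tau.
Hypothesis tau_out : forall i, i \notin res -> tau i \notin [:: a; b; c; e].
Hypothesis tau_law : forall i, L (tau i) = L i.
Hypothesis abce : uniq [:: a; b; c; e].
Hypothesis resE : res = [:: b; c] \/ res = [:: c].
Variables (alpha beta gamma rho : {posnum R}).
Hypothesis La : L a = expo alpha :> probability R R.
Hypothesis Lb : L b = expo beta :> probability R R.
Hypothesis Lc : L c = expo gamma :> probability R R.
Hypothesis rhoE : rho%:num = (alpha%:num + (beta%:num + gamma%:num))%R.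

(** The configuration seen after clock [a] has rung: [w] renumbers the embedded chain, the clocks in
    [res] keep running and lose the elapsed time, and every other source is read under its new name
    [tau i]. *)
Definition shift (x : conf R o) : conf R o :=
  (x.1 \o w, fun i => if i \in res then (x.2 i - x.2 a)%R else x.2 (tau i)).

(** Clock [a] beats its rivals [b] and [c]; [e] is the mark attached to the event. *)
Definition first_clock (B J : set R) (x : conf R o) : Prop :=
  [/\ (x.2 a < x.2 b)%R, (x.2 a < x.2 c)%R, B (x.2 a) & J (x.2 e)].

(** The residual clocks are fresh by [expo_race3]. The renamed sources are fresh because [tau] is
    injective, preserves the laws and avoids the winner, the rivals and the mark. Hence the shifted
    sources are independent of the event and have their original laws. *)
Lemma shift_law_cyl N r F (E : src m -> set R) (B J : set R) :
  uniq F -> (forall i, measurable (E i)) -> measurable B -> measurable J ->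
  P [set t | [/\ forall n, (n <= N)%N -> (code t).1 n = r n,
         first_clock B J (code t) &
         forall i, i \in F -> E i ((shift (code t)).2 i)]] =
  (path_prob k N r)%:E * ((alpha%:num / rho%:num)%:E * expo rho B * L e J) *
   \prod_(i <- F) L i (E i).
Proof.
move=> uF mE mB mJ.
pose A_ i := if i \in F then E i else setT.
have mA_ i : measurable (A_ i) by rewrite /A_; case: ifP.
pose F1 := [seq i <- F | i \notin res].
have uF1 : uniq F1 by rewrite filter_uniq.
pose F0 := e :: map tau F1.
(* The constraint put on a renamed source is the one of its preimage by [tau]. *)
pose E0 j := if j == e then J else E (nth e F1 (index j (map tau F1))).
have mE0 j : measurable (E0 j) by rewrite /E0; case: ifP.
have F1out i : i \in F1 -> [/\ tau i != a, tau i != b, tau i != c & tau i != e].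
  rewrite mem_filter => /andP[/tau_out + _]; rewrite !inE !negb_or.
  by move=> /and4P[].
have E0tau i : i \in F1 -> E0 (tau i) = E i.
  move=> iF; have [_ _ _ /negbTE te] := F1out _ iF.
  by rewrite /E0 te index_map// nth_index.
have E0e : E0 e = J by rewrite /E0 eqxx.
have cres : c \in res by case: resE => ->; rewrite !inE eqxx ?orbT.
(* The rival [b] is either kept running or discarded; a discarded clock carries no constraint. *)
pose Ab := if b \in res then A_ b else setT.
have mAb : measurable Ab by rewrite /Ab; case: ifP.
pose Z : set (R * (R * R)) := [set z | [/\ (z.1 < z.2.1)%R, (z.1 < z.2.2)%R, B z.1,
      Ab (z.2.1 - z.1)%R & A_ c (z.2.2 - z.1)%R]].
move: abce; rewrite !cons_uniq !inE !negb_or => /and4P[/and3P[ab ac ae] /andP[bc be] ce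
  _].
rewrite (_ : [set t | _] = code @^-1` cyl N r F0 E0 `&`
    [set t | Z ((code t).2 a, ((code t).2 b, (code t).2 c))]); last first.
  apply/seteqP; split => t /=.
    move=> [tr [tab tac Ba Je] tE]; split.
      split => // i; rewrite inE => /orP[/eqP ->|]; first by rewrite E0e.
      move=> /mapP[j jF ->]; rewrite E0tau//.
      move: jF; rewrite mem_filter => /andP[/negbTE jres jF].
      by have := tE _ jF; rewrite jres.
    split => //=.
      rewrite /Ab; case: ifPn => // bres; rewrite /A_; case: ifPn => // bF.
      by have := tE _ bF; rewrite bres.
    by rewrite /A_; case: ifPn => // cF; have := tE _ cF; rewrite cres.
  move=> [[tr tE0] [/= tab tac Ba tAb tAc]]; split => //.
    by split => //; have := tE0 e; rewrite E0e inE eqxx; exact.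
  move=> i iF; case: ifPn => ires.
    have : (i == b) && (b \in res) || (i == c).
      move: ires; case: resE => ->; rewrite !inE; last by move=> ->; rewrite orbT.
      by rewrite eqxx/= andbT.
    case/orP => [/andP[/eqP ib bres]|/eqP ic].
      by move: tAb; rewrite /Ab bres /A_ -ib iF.
    by move: tAc; rewrite /A_ -ic iF.
  have iF1 : i \in F1 by rewrite mem_filter ires.
  by rewrite -(E0tau _ iF1); apply: tE0; rewrite inE map_f ?orbT.
have uF0 : uniq F0.
  rewrite /F0 cons_uniq map_inj_uniq// uF1 andbT; apply/mapP => -[i iF ei].
  by have [_ _ _] := F1out _ iF; rewrite ei eqxx.
have outF0 x : x != e -> (forall i, i \in F1 -> tau i != x) -> x \notin F0.
  move=> xe xF; rewrite inE negb_or xe; apply/mapP => -[i /xF ix xi].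
  by move: ix; rewrite xi eqxx.
have mZ : measurable Z by exact: measurable_race.
rewrite (@law3 N r F0 E0)//; last first.
  have [aF bF cF] : [/\ a \notin F0, b \notin F0 & c \notin F0].
    by split; apply: outF0 => // i /F1out[].
  have uabc s : uniq s -> a \notin s -> b \notin s -> c \notin s -> uniq [:: a, b, c & s].
    by rewrite !cons_uniq !inE !negb_or ab ac bc => -> -> -> ->.
  exact: uabc.
have -> : prodm (L a) (prodm (L b) (L c)) Z =
    (alpha%:num / rho%:num)%:E * expo rho B * (L b Ab * L c (A_ c)).
  by rewrite La Lb Lc; exact: expo_race3.
rewrite big_cons E0e big_map.
have -> : \prod_(j <- F1) L (tau j) (E0 (tau j)) = \prod_(j <- F1) L j (E j).
  by rewrite !big_seq; apply: eq_bigr => i iF; rewrite tau_law E0tau.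
have -> : \prod_(i <- F) L i (E i) = L b Ab * L c (A_ c) * \prod_(j <- F1) L j (E j).
  rewrite (bigID (mem res))/=; congr (_ * _); last by rewrite /F1 big_filter.
  rewrite -big_filter (perm_big [seq i <- res | i \in F]); last first.
    apply: uniq_perm; rewrite ?filter_uniq//.
      by case: resE => ->; rewrite ?cons_uniq ?inE ?bc.
    by move=> i; rewrite !mem_filter andbC.
  rewrite big_filter big_mkcond /Ab.
  have Lif i : (if i \in F then L i (E i) else 1%E) = L i (A_ i).
    by rewrite /A_; case: ifP => // _; rewrite probability_setT.
  case: resE => ->; rewrite !big_cons big_nil/= !Lif mule1 !inE ?eqxx//.
  by rewrite (negbTE bc) probability_setT mul1e.
by rewrite -!(muleA (path_prob k N r)%:E) muleACA (muleC (L e J))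
  (muleC (\prod_(j <- F1) _)).
Qed.

End shift.

End independence.

(** * The three kinds of first event *)

Section regeneration.
Local Open Scope ereal_scope.
Context {R : realType} {m : nat} (o : 'I_m).
Variables (nuP lamP : 'I_m -> {posnum R}) (sP : {posnum R}).
Variables (jl : 'I_m -> probability R R) (cl : 'I_m -> 'I_m -> probability R R).
Variable p : 'M[R]_m.
Hypothesis p0 : forall i j, (0 <= p i j)%R.

Definition src_law (i : src m) : probability R R :=
  match i with
  | Soj _ q => expo (nuP q) | Gap _ q _ => expo (lamP q) | Jmp _ q _ => jl q
  | Chi _ q l => cl q l | Tht => expo sP
  end.

Context d (T : measurableType d) (P : 'I_m -> probability T R) (code : T -> conf R o).
Hypothesis mcode : measurable_fun setT (code : T -> path_space o).
Hypothesis law : forall k N r F (E : src m -> set R), uniq F ->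
  (forall i, measurable (E i)) ->
  P k (code @^-1` cyl N r F E) = (path_prob p k N r)%:E * \prod_(i <- F) src_law i (E i).

(** A jump uses up the first gap and the first size of state [k] in sojourn 0. Only the remaining
    gaps and sizes of that sojourn and state are renumbered, whereas a transition renumbers all
    sojourns. *)
Definition jump_tau k (i : src m) : src m :=
  match i with
  | Gap n q j => if (n == 0)%N && (q == k) then Gap n q j.+1 else i
  | Jmp n q j => if (n == 0)%N && (q == k) then Jmp n q j.+1 else i
  | _ => i
  end.

Definition trans_tau (i : src m) : src m :=
  match i with
  | Soj n q => Soj n.+1 q | Gap n q j => Gap n.+1 q j | Jmp n q j => Jmp n.+1 q j
  | Chi n q l => Chi n.+1 q l | Tht => Tht
  end.

Definition jump_shift k : conf R o -> conf R o :=
  shift id [:: Soj 0 k; Tht] (jump_tau k) (Gap 0 k 0).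

Definition trans_shift k : conf R o -> conf R o :=
  shift succn [:: Tht] trans_tau (Soj 0 k).

Definition jump_first k (B J : set R) (x : conf R o) :=
  x.1 0%N = k /\ first_clock (Gap 0 k 0) (Soj 0 k) Tht (Jmp 0 k 0) B J x.

Definition trans_first k q (B J : set R) (x : conf R o) :=
  [/\ x.1 0%N = k, x.1 1%N = q & first_clock (Soj 0 k) (Gap 0 k 0) Tht (Chi 0 k q) B J x].

(** Killing carries no mark; [Tht] with the full set fills the place of one. *)
Definition killed_first k (B : set R) (x : conf R o) :=
  x.1 0%N = k /\ first_clock Tht (Soj 0 k) (Gap 0 k 0) Tht B setT x.

Variable rho : 'I_m -> {posnum R}.
Hypothesis rhoE : forall k, (rho k)%:num = (sP%:num + ((nuP k)%:num + (lamP k)%:num))%R.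

Let msrc i : measurable_fun setT (fun t => (code t).2 i).
Proof. exact: measurable_coord. Qed.

Let memb n k : measurable [set t | (code t).1 n = k].
Proof.
rewrite -[X in measurable X]setTI.
exact: (mcode measurableT (measurable_emb n k)).
Qed.

Lemma measurable_first_clock a b c e (B J : set R) : measurable B -> measurable J ->
  measurable [set t | first_clock a b c e B J (code t)].
Proof.
move=> mB mJ.
rewrite (_ : [set t | _] = ([set t | ((code t).2 a < (code t).2 b)%R] `&`
  [set t | ((code t).2 a < (code t).2 c)%R]) `&`
  (((fun t => (code t).2 a) @^-1` B) `&` ((fun t => (code t).2 e) @^-1` J))).
  apply: measurableI; apply: measurableI.
  - by rewrite -[X in measurable X]setTI; exact: measurable_fun_ltr.
  - by rewrite -[X in measurable X]setTI; exact: measurable_fun_ltr.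
  - by rewrite -[X in measurable X]setTI; exact: msrc.
  - by rewrite -[X in measurable X]setTI; exact: msrc.
apply/seteqP; split => t; first by case.
by move=> [[]] ? ? [].
Qed.

Lemma measurable_shift w res tau a :
  measurable_fun setT (fun t => shift w res tau a (code t) : path_space o).
Proof.
apply: measurable_to_path => [n k|i]; first exact: memb.
case ires : (i \in res).
  rewrite (_ : (fun t => _) = (fun t => ((code t).2 i - (code t).2 a)%R)).
    by apply: measurable_funB; exact: msrc.
  by apply/funext => t; rewrite /= ires.
rewrite (_ : (fun t => _) = (fun t => (code t).2 (tau i))); first exact: msrc.
by apply/funext => t; rewrite /= ires.
Qed.

Lemma law_killed_first k (B : set R) : measurable B ->
  P k [set t | killed_first k B (code t)] =
  (sP%:num / (rho k)%:num)%:E * expo (rho k) B.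
Proof.
move=> mB.
have u3 : uniq [:: Tht; Soj 0 k; Gap 0 k 0].
  by rewrite !cons_uniq !inE !negb_or; apply/and3P; split=> //; do ?[apply/andP;
    split]; apply/eqP.
have mZ := measurable_race measurableT mB measurableT.
have := law3 p0 mcode (law k) 0 (fun=> k) u3 (fun=> measurableT) mZ.
have race := expo_race3 (rhoE k) measurableT mB measurableT.
rewrite big_nil mule1 => H.
transitivity (((path_prob p k 0 (fun=> k))%:E *
  prodm (src_law Tht) (prodm (src_law (Soj 0 k)) (src_law (Gap 0 k 0)))
    [set z | [/\ (z.1 < z.2.1)%R, (z.1 < z.2.2)%R, B z.1,
      setT (z.2.1 - z.1)%R & setT (z.2.2 - z.1)%R]])).
  rewrite -H; congr (P k _); apply/seteqP; split => t /=.
    move=> [tk [ts tg Bt _]]; split => //; split => // n.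
    by rewrite leqn0 => /eqP ->.
  by move=> [[tk _] [ts tg Bt _ _]]; split; [rewrite tk|split].
rewrite /path_prob big_ord0 eqxx mulr1 mul1e.
by apply: (eq_trans race); rewrite !probability_setT !mule1.
Qed.

(** Both sides are finite measures in [A], so cylinders suffice and [shift_law_cyl] applies. Both
    the sojourn and the killing clock keep running, and the state is still [k], whence a restart
    under [P k]. *)
Lemma law_jump_first k (B J : set R) (A : set (path_space o)) :
  measurable B -> measurable J -> measurable A ->
  P k [set t | jump_first k B J (code t) /\ A (jump_shift k (code t))] =
  ((lamP k)%:num / (rho k)%:num)%:E * expo (rho k) B * jl k J * P k (code @^-1` A).
Proof.
move=> mB mJ mA.
have mD : measurable [set t | jump_first k B J (code t)].
  rewrite (_ : [set t | _] = [set t | (code t).1 0%N = k] `&`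
    [set t | first_clock (Gap 0 k 0) (Soj 0 k) Tht (Jmp 0 k 0) B J (code t)]) //.
  by apply: measurableI; [exact: memb|exact: measurable_first_clock].
have msh : measurable_fun setT (fun t => jump_shift k (code t) : path_space o).
  exact: measurable_shift.
set K := ((lamP k)%:num / (rho k)%:num)%:E * expo (rho k) B * jl k J.
have KE : K = (fine K)%:E.
  by rewrite [RHS]fineK// /K !fin_numM// fin_num_measure.
have K0 : (0 <= fine K)%R by rewrite fine_ge0// /K !mule_ge0.
pose m1 : {finite_measure set (path_space o) -> \bar R} := img (mrestr (P k) mD) msh.
pose m2 : {finite_measure set (path_space o) -> \bar R} :=
  mscale (NngNum K0) (img (P k) mcode).
transitivity (m1 A).
  by congr (P k _); apply/seteqP; split => t /= [].
rewrite KE -[RHS]/(m2 A).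
apply: eq_measure_cyl => //; first by rewrite ltey_eq fin_num_measure.
move=> _ [N [r [F [E [mE ->]]]]].
have cyl_undup : cyl N r F E = cyl N r (undup F) E :> set (path_space o).
  by apply/seteqP; split => x [H1 H2]; split => // i; [rewrite mem_undup|rewrite
    -mem_undup]; exact: H2.
rewrite cyl_undup.
transitivity (K * P k (code @^-1` cyl N r (undup F) E)); last by rewrite KE.
rewrite (law k)//; last exact: undup_uniq.
have [rk|rk] := eqVneq (r 0%N) k; last first.
  rewrite /path_prob (negbTE rk) mul0r mul0e mule0.
  rewrite -[RHS](measure0 (P k)); congr (P k _); rewrite -subset0 => t /= [[tr _] [tk _]].
  by have /= := tr 0%N isT => e; move: rk; rewrite -e tk eqxx.
rewrite muleA (muleC K).
have tau_inj : injective (jump_tau k).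
  move=> [n q|n q j|n q j|n q l|] [n' q'|n' q' j'|n' q' j'|n' q' l'|] //=;
    try by do ?case: ifP.
    by case: ifPn => h; case: ifPn => h' [] *; subst => //;
      [rewrite h in h'|rewrite h' in h].
  by case: ifPn => h; case: ifPn => h' [] *; subst => //;
    [rewrite h in h'|rewrite h' in h].
have tau_out i : i \notin [:: Soj 0 k; Tht] ->
    jump_tau k i \notin [:: Gap 0 k 0; Soj 0 k; Tht; Jmp 0 k 0].
  rewrite !inE !negb_or => /andP[/eqP i1 /eqP i2].
  case: i i1 i2 => [n q|n q j|n q j|n q l|] //= i1 i2; rewrite ?i1; do ?case: ifPn => h;
    do ?[apply/andP; split]; apply/eqP => // -[] *; subst; by move: h; rewrite ?eqxx.
have tau_law i : src_law (jump_tau k i) = src_law i.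
  by case: i => //= n q j; case: ifP.
have u4 : uniq [:: Gap 0 k 0; Soj 0 k; Tht; Jmp 0 k 0].
  by rewrite !cons_uniq !inE !negb_or -!andbA; do ?[apply/andP; split]; try by apply/eqP.
have rhoE' : (rho k)%:num = ((lamP k)%:num + ((nuP k)%:num + sP%:num))%R.
  by rewrite rhoE; ring.
have := shift_law_cyl p0 mcode (law k) id tau_inj tau_out tau_law u4 (or_introl erefl)
  erefl erefl erefl rhoE' N r (undup_uniq F) mE mB mJ.
move=> <-; congr (P k _); apply/seteqP; split => t /=.
  by move=> [[tr tE] [tk tc]].
by move=> [tr tc tE]; split => //; split => //; rewrite tr.
Qed.

(** Same argument as for a jump, but only the killing clock survives: the pending gap of the state
    that is left gets discarded. The restart is under [P q]. *)
Lemma law_trans_first k q (B J : set R) (A : set (path_space o)) :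
  measurable B -> measurable J -> measurable A ->
  P k [set t | trans_first k q B J (code t) /\ A (trans_shift k (code t))] =
  ((nuP k)%:num / (rho k)%:num * p k q)%:E * expo (rho k) B * cl k q J * P q
    (code @^-1` A).
Proof.
move=> mB mJ mA.
have mD : measurable [set t | trans_first k q B J (code t)].
  rewrite (_ : [set t | _] = ([set t | (code t).1 0%N = k] `&`
    [set t | (code t).1 1%N = q]) `&`
    [set t | first_clock (Soj 0 k) (Gap 0 k 0) Tht (Chi 0 k q) B J (code t)]) //.
    apply: measurableI; last exact: measurable_first_clock.
    by apply: measurableI; exact: memb.
  by apply/seteqP; split => t /=; [case|case=> -[]].
have msh : measurable_fun setT (fun t => trans_shift k (code t) : path_space o).
  exact: measurable_shift.
set K := ((nuP k)%:num / (rho k)%:num * p k q)%:E * expo (rho k) B * cl k q J.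
have KE : K = (fine K)%:E.
  by rewrite [RHS]fineK// /K !fin_numM// fin_num_measure.
have K0 : (0 <= fine K)%R by rewrite fine_ge0// /K !mule_ge0// lee_fin mulr_ge0.
pose m1 : {finite_measure set (path_space o) -> \bar R} := img (mrestr (P k) mD) msh.
pose m2 : {finite_measure set (path_space o) -> \bar R} :=
  mscale (NngNum K0) (img (P q) mcode).
transitivity (m1 A).
  by congr (P k _); apply/seteqP; split => t /= [].
rewrite KE -[RHS]/(m2 A).
apply: eq_measure_cyl => //; first by rewrite ltey_eq fin_num_measure.
move=> _ [N [r [F [E [mE ->]]]]].
have cyl_undup : cyl N r F E = cyl N r (undup F) E :> set (path_space o).
  by apply/seteqP; split => x [H1 H2]; split => // i; [rewrite mem_undup|rewrite
    -mem_undup]; exact: H2.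
rewrite cyl_undup.
transitivity (K * P q (code @^-1` cyl N r (undup F) E)); last by rewrite KE.
rewrite (law q)//; last exact: undup_uniq.
have [rq|rq] := eqVneq (r 0%N) q; last first.
  rewrite /path_prob (negbTE rq) mul0r mul0e mule0.
  rewrite -[RHS](measure0 (P k)); congr (P k _); rewrite -subset0 => t /=
    [[tr _] [_ tq _]].
  by have /= := tr 0%N isT => e; move: rq; rewrite -e tq eqxx.
have tau_inj : injective trans_tau.
  by move=> [n ?|n ? ?|n ? ?|n ? ?|] [n' ?|n' ? ?|n' ? ?|n' ? ?|] //= [] *; subst.
have tau_out i : i \notin [:: Tht] ->
    trans_tau i \notin [:: Soj 0 k; Gap 0 k 0; Tht; Chi 0 k q].
  rewrite !inE !negb_or => /eqP i1.
  by case: i i1 => [n ?|n ? ?|n ? ?|n ? ?|] //= i1; rewrite ?i1;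
    do ?[apply/andP; split]; apply/eqP.
have tau_law i : src_law (trans_tau i) = src_law i by case: i.
have u4 : uniq [:: Soj 0 k; Gap 0 k 0; Tht; Chi 0 k q].
  by rewrite !cons_uniq !inE !negb_or -!andbA; do ?[apply/andP; split]; try by apply/eqP.
have rhoE' : (rho k)%:num = ((nuP k)%:num + ((lamP k)%:num + sP%:num))%R.
  by rewrite rhoE; ring.
(* A path of length [N] after the transition is a path of length [N.+1] before it, with [k] in
   front; the extra step gives the factor [p k q]. *)
pose r' n := if n is n'.+1 then r n' else k.
have := shift_law_cyl p0 mcode (law k) succn tau_inj tau_out tau_law u4 (or_intror erefl)
  erefl erefl erefl rhoE' N.+1 r' (undup_uniq F) mE mB mJ.
have -> : path_prob p k N.+1 r' = (p k q * path_prob p q N r)%R.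
  by rewrite /path_prob eqxx rq eqxx !mul1r big_ord_recl/= rq.
move=> H; transitivity ((p k q * path_prob p q N r)%:E *
  (((nuP k)%:num / (rho k)%:num)%:E * expo (rho k) B * cl k q J) *
  \prod_(i <- undup F) src_law i (E i)).
  rewrite -H; congr (P k _); apply/seteqP; split => t /=.
    move=> [[tr tE] [tk tq tc]]; split => // -[|n] nN //.
    exact: tr.
  move=> [tr tc tE]; split => //.
    by split => // n nN; have := tr n.+1 nN.
  by split => //; [rewrite tr|rewrite tr//= rq].
rewrite /K (EFinM (p k q)) (EFinM (_ / _)) [RHS]muleA; congr (_ * _).
rewrite (muleC (p k q)%:E) -muleA muleC; congr (_ * _).
by rewrite !muleA (muleC (p k q)%:E).
Qed.

End regeneration.

(** * The law of the configuration of a driver *)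

Lemma measure_split_fibers (R : realType) d (T : measurableType d) n
    (mu : {measure set T -> \bar R}) (X : T -> 'I_n) (A : set T) :
  (forall q, measurable [set w | X w = q]) -> measurable A ->
  (mu A = \sum_q mu (A `&` [set w | X w = q]))%E.
Proof.
move=> mX mA.
rewrite -(@measure_bigsetU_ord _ _ _ mu n xpredT (fun q => A `&` [set w | X w = q]));
  last 2 first.
- by move=> q; apply: measurableI => //; exact: mX.
- by move=> i j _ _ [w [[_ <-] [_ <-]]].
congr (mu _); rewrite -bigcup_seq; apply/seteqP; split => w.
  by move=> Aw; exists (X w) => //=; rewrite mem_index_enum.
by move=> [q _ []].
Qed.

Section code.
Local Open Scope ereal_scope.
Context {R : realType} {m : nat} (D : map_data R m).
Context d (T : measurableType d) (W : driver T R m) (o : 'I_m).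
Variables (s : R) (P : 'I_m -> probability T R) (theta : {mfun T >-> R}).

Definition code (w : T) : conf R o :=
  (fun n => embedded W n w,
   fun i => match i with
   | Soj n q => sojourn W n q w
   | Gap n q j => gap W n q j w
   | Jmp n q j => jump_size W n q j w
   | Chi n q l => chi W n q l w
   | Tht => theta w
   end).

Hypothesis chainD : irreducible_chain D.
Hypothesis drivenD : driven D W s P theta.
Variables (nuP lamP : 'I_m -> {posnum R}) (sP : {posnum R}).
Hypothesis nuPE : forall k, (nuP k)%:num = nu D k.
Hypothesis lamPE : forall k, (lamP k)%:num = lam D k.
Hypothesis sPE : sP%:num = s.

Lemma measurable_code : measurable_fun setT (code : T -> path_space o).
Proof.
have [_ memb _] := drivenD.
by apply: measurable_to_path => [n k|[n q|n q j|n q j|n q l|]] //=; exact: memb.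
Qed.

Let L := src_law nuP lamP sP (jump_law D) (chi_law D).

Definition level (i : src m) : nat :=
  match i with
  | Soj n _ => n | Gap n _ j => maxn n j | Jmp n _ j => maxn n j
  | Chi n _ _ => n | Tht => 0
  end.

(** Exactly the sources that the formula of [driven] constrains when its bound is [M], ordered so
    that their product splits into the nested products of that formula. *)
Definition box (M : nat) : seq (src m) :=
  [seq Soj n q | n <- index_iota 0 M, q <- index_enum 'I_m] ++
  [seq Gap nq.1 nq.2 j | nq <- [seq (n, q) | n <- index_iota 0 M, q <- index_enum
    'I_m], j <- index_iota 0 M] ++
  [seq Jmp nq.1 nq.2 j | nq <- [seq (n, q) | n <- index_iota 0 M, q <- index_enum
    'I_m], j <- index_iota 0 M] ++
  [seq Chi nq.1 nq.2 l | nq <- [seq (n, q) | n <- index_iota 0 M, q <- index_enum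
    'I_m], l <- index_enum 'I_m] ++
  [:: Tht].

Lemma box_uniq M : uniq (box M).
Proof.
have uI : uniq (index_enum 'I_m) by exact: index_enum_uniq.
have uM : uniq (index_iota 0 M) by exact: iota_uniq.
have unq : uniq [seq (n, q) | n <- index_iota 0 M, q <- index_enum 'I_m].
  by apply: allpairs_uniq => // -[? ?] [? ?] _ _ [-> ->].
rewrite /box !cat_uniq; do ![apply/and3P; split].
- by apply: allpairs_uniq => // -[? ?] [? ?] _ _ [-> ->].
- apply/hasPn => i; rewrite !mem_cat => /or4P[| | |] /=; last first.
  + by rewrite inE => /eqP ->; apply/negP => /allpairsP[[? ?] /= [_ _]].
  + by move=> /allpairsP[[? ?] /= [_ _ ->]]; apply/negP => /allpairsP[[? ?] /= [_ _]].
  + by move=> /allpairsP[[? ?] /= [_ _ ->]]; apply/negP => /allpairsP[[? ?] /= [_ _]].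
  + by move=> /allpairsP[[? ?] /= [_ _ ->]]; apply/negP => /allpairsP[[? ?] /= [_ _]].
- by apply: allpairs_uniq => // -[[? ?] ?] [[? ?] ?] _ _ /= [-> -> ->].
- apply/hasPn => i; rewrite !mem_cat => /or3P[| |] /=; last first.
  + by rewrite inE => /eqP ->; apply/negP => /allpairsP[[? ?] /= [_ _]].
  + by move=> /allpairsP[[? ?] /= [_ _ ->]]; apply/negP => /allpairsP[[? ?] /= [_ _]].
  + by move=> /allpairsP[[? ?] /= [_ _ ->]]; apply/negP => /allpairsP[[? ?] /= [_ _]].
- by apply: allpairs_uniq => // -[[? ?] ?] [[? ?] ?] _ _ /= [-> -> ->].
- apply/hasPn => i; rewrite !mem_cat => /orP[|] /=; last first.
  + by rewrite inE => /eqP ->; apply/negP => /allpairsP[[? ?] /= [_ _]].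
  + by move=> /allpairsP[[? ?] /= [_ _ ->]]; apply/negP => /allpairsP[[? ?] /= [_ _]].
- by apply: allpairs_uniq => // -[[? ?] ?] [[? ?] ?] _ _ /= [-> -> ->].
- by apply/hasPn => i; rewrite inE => /eqP ->; apply/negP => /allpairsP[[? ?] /= [_ _]].
- by [].
Qed.

Lemma mem_box M i : (level i < M)%N -> i \in box M.
Proof.
have memnq n q : (n < M)%N ->
    (n, q) \in [seq (n, q) | n <- index_iota 0 M, q <- index_enum 'I_m].
  by move=> nM; apply/allpairsP; exists (n, q); rewrite /= mem_index_iota mem_index_enum.
rewrite /box !mem_cat; case: i => [n q|n q j|n q j|n q l|] /=.
- move=> nM; apply/orP; left; apply/allpairsP; exists (n, q).
  by rewrite /= mem_index_iota mem_index_enum.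
- rewrite gtn_max => /andP[nM jM]; apply/orP; right; apply/orP; left.
  by apply/allpairsP; exists ((n, q), j); rewrite /= mem_index_iota memnq.
- rewrite gtn_max => /andP[nM jM]; do 2 (apply/orP; right); apply/orP; left.
  by apply/allpairsP; exists ((n, q), j); rewrite /= mem_index_iota memnq.
- move=> nM; do 3 (apply/orP; right); apply/orP; left.
  by apply/allpairsP; exists ((n, q), l); rewrite /= mem_index_enum memnq.
- by rewrite inE eqxx !orbT.
Qed.

Lemma prod_box M (g : src m -> \bar R) :
  \prod_(i <- box M) g i =
  \prod_(n < M) \prod_q g (Soj n q) *
  (\prod_(n < M) \prod_q \prod_(j < M) (g (Gap n q j) * g (Jmp n q j))) *
  (\prod_(n < M) \prod_q \prod_l g (Chi n q l)) * g Tht.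
Proof.
rewrite /box !big_cat/= big_seq1 !muleA; congr (_ * _).
have nqE (h : nat -> 'I_m -> \bar R) :
   \prod_(nq <- [seq (n, q) | n <- index_iota 0 M, q <- index_enum 'I_m]) h nq.1 nq.2
   = \prod_(n < M) \prod_q h n q.
  by rewrite big_allpairs big_mkord.
have split2 (f h : nat -> 'I_m -> nat -> \bar R) :
  \prod_(n < M) \prod_q \prod_(j < M) (f n q j * h n q j) =
  \prod_(n < M) \prod_q \prod_(j < M) f n q j * \prod_(n < M) \prod_q \prod_(j < M) h n
    q j.
  rewrite -big_split/=; apply: eq_bigr => n _; rewrite -big_split/=.
  by apply: eq_bigr => q _; rewrite -big_split.
rewrite (split2 (fun n q j => g (Gap n q j)) (fun n q j => g (Jmp n q j))) muleA;
  congr (_ * _ * _ * _).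
- by rewrite big_allpairs_dep big_mkord.
- rewrite big_allpairs_dep (nqE (fun n q => \prod_(j <- index_iota 0 M) g (Gap n q j))).
  by do 2 apply: eq_bigr => ? _; rewrite big_mkord.
- rewrite big_allpairs_dep (nqE (fun n q => \prod_(j <- index_iota 0 M) g (Jmp n q j))).
  by do 2 apply: eq_bigr => ? _; rewrite big_mkord.
- by rewrite big_allpairs_dep (nqE (fun n q => \prod_l g (Chi n q l))).
Qed.

(** The formula of [driven] uses one bound for the length of the path and for the sources. Sources
    are padded with [setT] up to a common bound [M], and the missing steps of the chain are summed
    out, the rows of [trans D] having sum 1. *)
Lemma code_law k N r F (E : src m -> set R) : uniq F ->
  (forall i, measurable (E i)) ->
  P k (code @^-1` cyl N r F E) =
  (path_prob (trans D) k N r)%:E * \prod_(i <- F) L i (E i).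
Proof.
move=> uF mE.
have [_ memb lawD] := drivenD.
pose M := maxn N (\max_(i <- F) (level i).+1).
have FM i : i \in F -> (level i < M)%N.
  by move=> iF; rewrite leq_max; apply/orP; right; apply: leq_bigmax_seq.
pose E' i := if i \in F then E i else setT.
have mE' i : measurable (E' i) by rewrite /E'; case: ifP.
have prodF : \prod_(i <- F) L i (E i) = \prod_(i <- box M) L i (E' i).
  rewrite [RHS](perm_big (F ++ [seq i <- box M | i \notin F])); last first.
    apply: uniq_perm; first exact: box_uniq.
      rewrite cat_uniq uF filter_uniq ?box_uniq// andbT.
      by apply/hasPn => i; rewrite mem_filter => /andP[].
    move=> i; rewrite mem_cat mem_filter; case: (boolP (i \in F)) => //= iF.
    by rewrite mem_box// FM.
  rewrite big_cat/= [X in _ = _ * X]big1_seq ?mule1; last first.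
    move=> i /andP[_]; rewrite mem_filter => /andP[iF _].
    by rewrite /E' (negbTE iF) probability_setT.
  by rewrite !big_seq; apply: eq_bigr => i iF; rewrite /E' iF.
have LE i : L i (E' i) = match i with
    | Soj n q => exponential_prob (nu D q) (E' i)
    | Gap n q j => exponential_prob (lam D q) (E' i)
    | Jmp n q j => jump_law D q (E' i)
    | Chi n q l => chi_law D q l (E' i)
    | Tht => exponential_prob s (E' i)
    end.
  case: i => [n q|n q j|n q j|n q l|].
  - by rewrite -(nuPE q).
  - by rewrite -(lamPE q).
  - by [].
  - by [].
  - by rewrite -sPE.
(* Induction on the number [t] of missing steps, from full length [M] downwards. *)
have step t N' r' : (N' + t)%N = M ->
   P k (code @^-1` cyl N' r' F E) = (path_prob (trans D) k N' r')%:E * \prod_(i <- F) L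
     i (E i).
  elim: t N' r' => [|t ih] N' r' N't.
    rewrite addn0 in N't; rewrite {}N't.
    have := lawD k M r' (fun n q => E' (Soj n q)) (fun n q j => E' (Gap n q j))
      (fun n q j => E' (Jmp n q j)) (fun n q l => E' (Chi n q l)) (E' Tht)
      (fun _ _ => mE' _) (fun _ _ _ => mE' _) (fun _ _ _ => mE' _) (fun _ _ _ => mE' _)
        (mE' _).
    rewrite prodF prod_box.
    have -> : L Tht (E' Tht) = exponential_prob s (E' Tht) by exact: LE.
    have -> : \prod_(n < M) \prod_q L (Soj n q) (E' (Soj n q)) =
        \prod_(n < M) \prod_q exponential_prob (nu D q) (E' (Soj n q)).
      do 2 apply: eq_bigr => ? _; exact: LE.
    have -> : \prod_(n < M) \prod_q \prod_(j < M)
         (L (Gap n q j) (E' (Gap n q j)) * L (Jmp n q j) (E' (Jmp n q j))) =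
        \prod_(n < M) \prod_q \prod_(j < M)
         (exponential_prob (lam D q) (E' (Gap n q j)) * jump_law D q (E' (Jmp n q j))).
      by do 3 (apply: eq_bigr => ? _); rewrite (LE (Gap _ _ _)) (LE (Jmp _ _ _)).
    rewrite -/(path_prob (trans D) k M r') !muleA => <-.
    congr (P k _); apply/seteqP; split => w /=.
      have E'E i : (i \in F -> E i ((code w).2 i)) -> E' i ((code w).2 i).
        by rewrite /E'; case: ifP => // _; exact.
      move=> [wr wE]; split => //.
      - by move=> n q _; exact: E'E (wE (Soj n q)).
      - by move=> n q j _ _; split; [exact: E'E (wE (Gap n q j))|exact: E'E
        (wE (Jmp n q j))].
      - by move=> n q l _; exact: E'E (wE (Chi n q l)).
      - exact: E'E (wE Tht).
    move=> [wr ws wgj wc wt]; split => // i iF; have := FM _ iF.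
    case: i iF => [n q|n q j|n q j|n q l|] iF /=.
    - by move=> nM; have := ws n q nM; rewrite /E' iF.
    - by rewrite gtn_max => /andP[nM jM]; have [] := wgj n q j nM jM; rewrite /E' iF.
    - by rewrite gtn_max => /andP[nM jM]; have [_] := wgj n q j nM jM; rewrite /E' iF.
    - by move=> nM; have := wc n q l nM; rewrite /E' iF.
    - by move=> _; have := wt; rewrite /E' iF.
  have memb' q : measurable [set w | embedded W N'.+1 w = q].
    exact: memb.
  rewrite (measure_split_fibers _ memb'); last exact: (measurable_cyl measurable_code).
  pose rq q n := if n == N'.+1 then q else r' n.
  transitivity (\sum_q (path_prob (trans D) k N' r' * trans D (r' N') q)%:E *
    \prod_(i <- F) L i (E i)).
    apply: eq_bigr => q _.
    have -> : (path_prob (trans D) k N' r' * trans D (r' N') q)%R = path_prob (trans D)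
      k N'.+1 (rq q).
      rewrite /path_prob big_ord_recr/= -mulrA /rq eqxx (ltn_eqF (ltnSn _));
        congr (_ * (_ * _))%R.
      apply: eq_bigr => n _; rewrite (ltn_eqF (ltn_trans (ltn_ord n) (ltnSn _))).
      by rewrite eqSS (ltn_eqF (ltn_ord n)).
    rewrite -ih; last by rewrite addSn -addnS.
    congr (P k _); apply/seteqP; split => w /=.
      move=> [[wr wE] wq]; split => // n; rewrite leq_eqVlt /rq => /orP[/eqP ->|].
        by rewrite eqxx.
      by rewrite ltnS => nN; rewrite (ltn_eqF (leq_ltn_trans nN (ltnSn _))); exact: wr.
    move=> [wr wE]; split; last by have := wr N'.+1 (leqnn _); rewrite /rq eqxx.
    split => // n nN; have := wr n (leqW nN); rewrite /rq.
    by rewrite (ltn_eqF (leq_ltn_trans nN (ltnSn _))).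
  have [_ p0 p1 _] := chainD.
  rewrite -ge0_sume_distrl; last by move=> q _; rewrite lee_fin mulr_ge0// path_prob_ge0.
  by rewrite sumEFin -mulr_sumr p1 mulr1.
have [t Nt] : exists t, (N + t)%N = M by exists (M - N)%N; rewrite subnKC// leq_maxl.
exact: step Nt.
Qed.

End code.

(** * Regeneration of paths at the first event *)

Section epochs.
Context {R : realType}.
Implicit Types (h : nat -> R) (t g : R).

Lemma epoch0 h : epoch h 0 = 0. Proof. by rewrite /epoch big_ord0. Qed.

Lemma epochS h n : epoch h n.+1 = epoch h n + h n.
Proof. by rewrite /epoch big_ord_recr. Qed.

Lemma epochSl h n : epoch h n.+1 = h 0%N + epoch (h \o succn) n.
Proof. by rewrite /epoch big_ord_recl. Qed.

Lemma epoch_le h i j : (forall n, 0 < h n) -> (i <= j)%N -> epoch h i <= epoch h j.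
Proof.
move=> h0; elim: j => [|j ih]; first by rewrite leqn0 => /eqP ->.
rewrite leq_eqVlt => /orP[/eqP -> //|]; rewrite ltnS => /ih ij.
by rewrite epochS (le_trans ij)// lerDl ltW.
Qed.

Lemma epoch_ge0 h n : (forall n, 0 < h n) -> 0 <= epoch h n.
Proof. by move=> h0; rewrite -(epoch0 h) epoch_le. Qed.

Lemma counting_eq h t n : (forall n, 0 < h n) ->
  epoch h n <= t < epoch h n.+1 -> counting h t = n.
Proof.
move=> h0 nt; rewrite /counting; case: xgetP => [n' _ /= n't|/(_ n)/=];
  last by rewrite nt.
move: nt n't => /andP[n1 n2] /andP[n1' n2'].
apply/eqP; rewrite eqn_leq; apply/andP; split; rewrite leqNgt; apply/negP => lt.
  by have := lt_le_trans n2 (le_trans (epoch_le h0 lt) n1'); rewrite ltxx.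
by have := lt_le_trans n2' (le_trans (epoch_le h0 lt) n1); rewrite ltxx.
Qed.

Definition proper_clock h := (forall n, 0 < h n) /\ (forall t, exists n, t < epoch h n).

Lemma countingP h t : proper_clock h -> 0 <= t ->
  epoch h (counting h t) <= t < epoch h (counting h t).+1.
Proof.
move=> [h0 hoo] t0; have [n tn] := hoo t.
case: (ex_minnP (ex_intro (fun n => t < epoch h n) n tn)) => -[|j] tj jmin.
  by move: tj; rewrite epoch0 ltNge t0.
have jt : epoch h j <= t.
  by rewrite leNgt; apply/negP => /jmin; rewrite ltnn.
by rewrite (@counting_eq h t j)// jt.
Qed.

Lemma counting_small h t : proper_clock h -> 0 <= t < h 0%N -> counting h t = 0%N.
Proof.
by move=> [h0 _] t0; apply: counting_eq => //; rewrite epoch0 epochS epoch0 add0r.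
Qed.

Lemma proper_clockS h : proper_clock h -> proper_clock (h \o succn).
Proof.
move=> [h0 hoo]; split=> [n|t]; first exact: h0.
have [n tn] := hoo (h 0%N + t); exists n.
have : h 0%N + t < epoch h n.+1.
  by rewrite (lt_le_trans tn)// epoch_le.
by rewrite epochSl ltrD2l.
Qed.

Lemma countingS h t : proper_clock h -> 0 <= t ->
  counting h (h 0%N + t) = (counting (h \o succn) t).+1.
Proof.
move=> hp t0; have [h0 _] := hp.
have /andP[le lt] := countingP (proper_clockS hp) t0.
by apply: counting_eq => //; rewrite !(epochSl h) lerD2l ltrD2l le lt.
Qed.

Definition residual g h n : R := if n is 0 then h 0%N - g else h n.

Lemma epoch_residual g h n : epoch h n.+1 = g + epoch (residual g h) n.+1.
Proof. by rewrite !epochSl /= addrA subrKC. Qed.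

Lemma proper_residual g h : 0 <= g < h 0%N -> proper_clock h ->
  proper_clock (residual g h).
Proof.
move=> /andP[g0 gh] [h0 hoo]; have r0 n : 0 < residual g h n.
  by case: n => [|n] /=; [rewrite subr_gt0|exact: h0].
split => // t; have [n tn] := hoo (g + t); exists n.+1.
by rewrite -(ltrD2l g) -epoch_residual (lt_le_trans tn)// epoch_le.
Qed.

Lemma counting_residual g h t : 0 <= g < h 0%N -> proper_clock h -> 0 <= t ->
  counting h (g + t) = counting (residual g h) t.
Proof.
move=> gh hp t0; have [h0 _] := hp.
have rp := proper_residual gh hp; have /andP[le lt] := countingP rp t0.
apply: counting_eq => //; rewrite (epoch_residual g h) ltrD2l lt andbT.
case: (counting _ _) le => [_|n]; last by rewrite (epoch_residual g h) lerD2l.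
by rewrite epoch0 addr_ge0//; case/andP: gh.
Qed.

Lemma counting_le h t u : proper_clock h -> 0 <= t <= u ->
  (counting h t <= counting h u)%N.
Proof.
move=> hp /andP[t0 tu]; have [h0 _] := hp.
have /andP[t1 _] := countingP hp t0.
have /andP[_ u2] := countingP hp (le_trans t0 tu).
rewrite leqNgt; apply/negP => lt.
by have := lt_le_trans u2 (le_trans (epoch_le h0 lt) (le_trans t1 tu)); rewrite ltxx.
Qed.

Lemma counting_right h t : proper_clock h -> 0 <= t ->
  exists2 e, 0 < e & forall u, t <= u < t + e -> counting h u = counting h t.
Proof.
move=> hp t0; have [h0 _] := hp; have /andP[t1 t2] := countingP hp t0.
exists (epoch h (counting h t).+1 - t); first by rewrite subr_gt0.
move=> u; rewrite subrKC => /andP[tu ut].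
by apply: counting_eq => //; rewrite (le_trans t1 tu) ut.
Qed.

Lemma compound_small h J t : proper_clock h -> 0 <= t < h 0%N -> compound h J t = 0.
Proof. by move=> hp t0; rewrite /compound counting_small// big_ord0. Qed.

Lemma compoundS h J t : proper_clock h -> 0 <= t ->
  compound h J (h 0%N + t) = J 0%N + compound (h \o succn) (J \o succn) t.
Proof. by move=> hp t0; rewrite /compound countingS// big_ord_recl. Qed.

Lemma compound_le h J t u : proper_clock h -> 0 <= t <= u ->
  compound h J t <= \sum_(j < counting h u) `|J j|.
Proof.
move=> hp tu; apply: le_trans (_ : \sum_(j < counting h t) `|J j| <= _).
  by apply: ler_sum => i _; exact: ler_norm.
have /(counting_le hp) := tu; move: (counting h t) (counting h u) => i j ij.
rewrite -(subnKC ij) big_split_ord/= lerDl; exact: sumr_ge0.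
Qed.

End epochs.

(** * Path functionals on the configuration space and their measurability *)

Section canonical_driver.
Context {R : realType} {m : nat} (o : 'I_m) (D : map_data R m).
Local Notation S := (path_space (R := R) o).
Implicit Types x : S.

Definition coord (i : src m) (x : S) : R := x.2 i.

HB.instance Definition _ i := isMeasurableFun.Build _ _ _ _ (coord i) (measurable_src i).

(** The coordinates form a driver, so that [xi] and [chain] can be evaluated at a shifted
    configuration. At the configuration of an outcome they agree by definition with those of the
    original driver. *)
Definition canonical_driver : driver S R m :=
  Driver (fun n x => x.1 n) (fun n q => coord (Soj n q)) (fun n q j => coord (Gap n q j))
    (fun n q j => coord (Jmp n q j)) (fun n q l => coord (Chi n q l)).

Local Notation V := canonical_driver.
Local Notation X := (xi D V).

Definition good x :=
  [/\ 0 < x.2 Tht, forall n q, 0 < x.2 (Soj n q),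
      forall n q, proper_clock (fun j => x.2 (Gap n q j)) &
      proper_clock (holding V x)].

Lemma levy_small x n q u : good x -> 0 <= u < x.2 (Gap n q 0) ->
  levy D V n q u x = drift D q * u.
Proof. by move=> [_ _ gp _] ux; rewrite /levy compound_small ?addr0//; exact: gp. Qed.

Lemma xi_before x t : good x -> 0 <= t < x.2 (Soj 0 (x.1 0%N)) ->
  X t x = levy D V 0 (x.1 0%N) t x /\ chain V t x = x.1 0%N.
Proof.
move=> [_ _ _ hp] ht; have t0 : transitions V t x = 0%N by rewrite /transitions
  counting_small.
by rewrite /xi /chain t0 big_ord0 add0r /sigma epoch0 subr0.
Qed.

Section transition.
Variables (k : 'I_m) (x : S).
Hypotheses (gx : good x) (xk : x.1 0%N = k).
Let y : S := trans_shift k x.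
Let h := x.2 (Soj 0 k).

Lemma trans_shiftE i : i != Tht -> y.2 i = x.2 (trans_tau i).
Proof. by move=> /negbTE it; rewrite /y /trans_shift /shift/= inE it. Qed.

Lemma trans_shift_Tht : y.2 Tht = x.2 Tht - h.
Proof. by rewrite /y /trans_shift /shift/= inE eqxx. Qed.

Let Eh : holding V y = holding V x \o succn.
Proof. by apply/funext => n; exact: trans_shiftE (introN eqP _). Qed.

Let Eg n q : (fun j => y.2 (Gap n q j)) = (fun j => x.2 (Gap n.+1 q j)).
Proof. by apply/funext => j; rewrite trans_shiftE//; apply/eqP. Qed.

Lemma good_trans : h < x.2 Tht -> good y.
Proof.
case: gx => _ xs xg xh hT; split.
- by rewrite trans_shift_Tht subr_gt0.
- by move=> n q; rewrite trans_shiftE; [exact: xs|apply/eqP].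
- by move=> n q; rewrite Eg.
- by rewrite Eh; exact: proper_clockS.
Qed.

Lemma levy_trans n q u : levy D V n q u y = levy D V n.+1 q u x.
Proof.
rewrite /levy /=; congr (_ + _); rewrite -[LHS]/(compound (fun j => y.2 (Gap n q j))
  (fun j => y.2 (Jmp n q j)) u).
by rewrite Eg; congr compound; apply/funext => j; rewrite trans_shiftE//; apply/eqP.
Qed.

Let hold0 : holding V x 0 = h. Proof. by rewrite /holding/= xk. Qed.

Let xh : proper_clock (holding V x). Proof. by case: gx. Qed.

Lemma transitions_trans t : 0 <= t ->
  transitions V (h + t) x = (transitions V t y).+1.
Proof. by move=> t0; rewrite /transitions -hold0 countingS// Eh. Qed.

Lemma chain_trans t : 0 <= t -> chain V (h + t) x = chain V t y.
Proof. by move=> t0; rewrite /chain transitions_trans. Qed.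

Lemma xi_trans t : 0 <= t -> h < x.2 (Gap 0 k 0) ->
  X (h + t) x = drift D k * h + x.2 (Chi 0 k (x.1 1%N)) + X t y.
Proof.
move=> t0 hg; have h0 : 0 < h by case: gx => _ + _ _; exact.
rewrite /xi transitions_trans// big_ord_recl -[LHS]addrA; congr (_ + (_ + _)).
- by rewrite hold0 /= xk levy_small// (ltW h0).
- apply: eq_bigr => i _; rewrite levy_trans Eh; congr (_ + _).
  by rewrite [RHS]trans_shiftE//; apply/eqP.
- rewrite levy_trans /sigma epochSl hold0 Eh.
  by rewrite (_ : h + t - _ = t - epoch (holding V x \o succn) (transitions V t y))//;
    ring.
Qed.

End transition.

Section jump.
Variables (k : 'I_m) (x : S).
Hypotheses (gx : good x) (xk : x.1 0%N = k).
Let y : S := jump_shift k x.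
Let h := x.2 (Soj 0 k).
Let g := x.2 (Gap 0 k 0).
Hypothesis gh : g < h.

Let g0 : 0 < g. Proof. by case: gx => _ _ gp _; case: (gp 0%N k) => + _; exact. Qed.

Lemma jump_shiftE i : i != Tht -> i != Soj 0 k -> y.2 i = x.2 (jump_tau k i).
Proof.
by move=> /negbTE it /negbTE is_; rewrite /y /jump_shift /shift/= !inE it is_.
Qed.

Lemma jump_shift_Tht : y.2 Tht = x.2 Tht - g.
Proof. by rewrite /y /jump_shift /shift/= !inE eqxx orbT. Qed.

Lemma jump_shift_Soj : y.2 (Soj 0 k) = h - g.
Proof. by rewrite /y /jump_shift /shift/= !inE eqxx. Qed.

Let hold0 : holding V x 0 = h. Proof. by rewrite /holding/= xk. Qed.

Let Eh : holding V y = residual g (holding V x).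
Proof.
apply/funext => -[|n]; last by rewrite [LHS]jump_shiftE//; apply/eqP.
by rewrite /= hold0 /holding/= -jump_shift_Soj xk.
Qed.

Let Eg n q : (n, q) != (0%N, k) -> (fun j => y.2 (Gap n q j)) =
  (fun j => x.2 (Gap n q j)).
Proof.
rewrite xpair_eqE => /negbTE nq; apply/funext => j.
by rewrite jump_shiftE/= ?nq//; apply/eqP.
Qed.

Let Eg0 : (fun j => y.2 (Gap 0 k j)) = (fun j => x.2 (Gap 0 k j)) \o succn.
Proof. by apply/funext => j; rewrite jump_shiftE/= ?eqxx//; apply/eqP. Qed.

Let Ej n q : (n, q) != (0%N, k) -> (fun j => y.2 (Jmp n q j)) =
  (fun j => x.2 (Jmp n q j)).
Proof.
rewrite xpair_eqE => /negbTE nq; apply/funext => j.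
by rewrite jump_shiftE/= ?nq//; apply/eqP.
Qed.

Let Ej0 : (fun j => y.2 (Jmp 0 k j)) = (fun j => x.2 (Jmp 0 k j)) \o succn.
Proof. by apply/funext => j; rewrite jump_shiftE/= ?eqxx//; apply/eqP. Qed.

Let xh : proper_clock (holding V x). Proof. by case: gx. Qed.

Let ghold : 0 <= g < holding V x 0. Proof. by rewrite hold0 ltW. Qed.

Lemma good_jump : g < x.2 Tht -> good y.
Proof.
case: gx => _ xs xg _ gT; split.
- by rewrite jump_shift_Tht subr_gt0.
- move=> n q; have [->|nq] := eqVneq (Soj n q) (Soj 0 k).
    by rewrite jump_shift_Soj subr_gt0.
  by rewrite jump_shiftE//; [exact: xs|apply/eqP].
- move=> n q; have [[-> ->]|nq] := eqVneq (n, q) (0%N, k).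
    by rewrite Eg0; exact: proper_clockS.
  by rewrite Eg.
- by rewrite Eh; exact: proper_residual.
Qed.

Lemma levy_jump n q u : (n, q) != (0%N, k) -> levy D V n q u y = levy D V n q u x.
Proof.
move=> nq; rewrite /levy /=; congr (_ + _).
rewrite -[LHS]/(compound (fun j => y.2 (Gap n q j)) (fun j => y.2 (Jmp n q j)) u).
by rewrite Eg// Ej.
Qed.

Lemma levy_jump0 u : 0 <= u ->
  levy D V 0 k (g + u) x = drift D k * g + x.2 (Jmp 0 k 0) + levy D V 0 k u y.
Proof.
move=> u0; have gp : proper_clock (fun j => x.2 (Gap 0 k j)) by case: gx.
rewrite /levy mulrDr -!addrA; congr (_ + _); rewrite addrCA; congr (_ + _).
rewrite [LHS](compoundS (fun j => x.2 (Jmp 0 k j)) gp u0); congr (_ + _).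
rewrite -[RHS]/(compound (fun j => y.2 (Gap 0 k j)) (fun j => y.2 (Jmp 0 k j)) u).
by rewrite Eg0 Ej0.
Qed.

Lemma transitions_jump t : 0 <= t -> transitions V (g + t) x = transitions V t y.
Proof. by move=> t0; rewrite /transitions counting_residual// Eh. Qed.

Lemma chain_jump t : 0 <= t -> chain V (g + t) x = chain V t y.
Proof. by move=> t0; rewrite /chain transitions_jump. Qed.

Lemma xi_jump t : 0 <= t -> X (g + t) x = drift D k * g + x.2 (Jmp 0 k 0) + X t y.
Proof.
move=> t0; rewrite /xi transitions_jump//.
have yh : proper_clock (holding V y) by rewrite Eh; exact: proper_residual.
have := countingP yh t0; rewrite -/(transitions V t y).
(* The jump lies either in the sojourn still running at the final time, or in the first completed
   sojourn. *)
case: (transitions V t y) => [|n] /andP[nt _].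
  by rewrite !big_ord0 !add0r /sigma !epoch0 !subr0 /= xk levy_jump0.
rewrite !big_ord_recl [RHS]addrA (addrA (_ + x.2 _)); congr (_ + _ + _).
- rewrite (_ : holding V x _ = g + holding V y 0%N); last by rewrite Eh/= subrKC.
  rewrite /= xk levy_jump0; last by case: yh => /(_ 0%N)/ltW.
  rewrite -addrA; congr (_ + (_ + _)).
  by rewrite [RHS]jump_shiftE//; apply/eqP.
- apply: eq_bigr => i _; rewrite levy_jump; last by rewrite xpair_eqE.
  rewrite Eh; congr (_ + _).
  by rewrite [RHS]jump_shiftE//; apply/eqP.
- rewrite levy_jump; last by rewrite xpair_eqE.
  rewrite /sigma (epoch_residual g (holding V x)) Eh.
  by rewrite (_ : g + t - _ = t - epoch (residual g (holding V x)) n.+1)//; ring.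
Qed.

End jump.

Hypothesis drift_lt0 : forall k, drift D k < 0.

(** [sup] is a supremum only on bounded sets. The drifts being negative, the path up to [t] is
    bounded by the sum of the absolute values of finitely many jumps. *)
Lemma xi_ubound x t : good x -> 0 <= t -> has_ubound [set X u x | u in `[0, t]].
Proof.
move=> gx t0; have [_ xs xg xh] := gx.
pose B i := \sum_(j < counting (fun j => x.2 (Gap i (x.1 i) j)) t) `|x.2
  (Jmp i (x.1 i) j)|.
pose B' i := B i + `|x.2 (Chi i (x.1 i) (x.1 i.+1))|.
have B0 i : 0 <= B i by exact: sumr_ge0.
have B'0 i : 0 <= B' i by rewrite addr_ge0.
have levyB i u : 0 <= u <= t -> levy D V i (x.1 i) u x <= B i.
  move=> ut; rewrite /levy -[leRHS]add0r lerD//.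
    by rewrite nmulr_rle0//; case/andP: ut.
  exact: (compound_le (fun j => x.2 (Jmp i (x.1 i) j)) (xg i (x.1 i)) ut).
exists (\sum_(i < (transitions V t x).+1) B' i) => _ [u + <-].
rewrite /= in_itv/= => /andP[u0 ut].
have nt : (transitions V u x <= transitions V t x)%N by rewrite counting_le// u0.
have /andP[nu _] := countingP xh u0; rewrite -/(transitions V u x) in nu.
apply: (@le_trans _ _ (\sum_(i < (transitions V u x).+1) B' i)).
  rewrite big_ord_recr/= /xi lerD//.
    apply: ler_sum => i _; rewrite lerD//; last exact: ler_norm.
    apply: levyB; apply/andP; split; first exact: ltW (xs _ _).
    have : epoch (holding V x) i.+1 <= t.
      by rewrite (le_trans _ ut)// (le_trans _ nu)// epoch_le//; case: xh.
    by apply: le_trans; rewrite epochS lerDr epoch_ge0//; case: xh.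
  rewrite /B' (le_trans _ (_ : B (transitions V u x) <= _)) ?lerDl//.
  apply: levyB; rewrite subr_ge0 nu/= (le_trans _ ut)// gerBl.
  by rewrite epoch_ge0//; case: xh.
rewrite -(subnKC nt) -addSn big_split_ord/= lerDl.
by apply: sumr_ge0 => i _; exact: B'0.
Qed.

Lemma xi0 x : good x -> X 0 x = 0.
Proof.
move=> gx; have [_ xs xg _] := gx.
have h0 : (0 : R) <= 0 < x.2 (Soj 0 (x.1 0%N)) by rewrite lexx/= xs.
have [-> _] := xi_before gx h0.
by rewrite levy_small// ?mulr0// lexx/=; case: (xg 0%N (x.1 0%N)).
Qed.

Lemma xi_le_sup x t u : good x -> 0 <= u <= t -> X u x <= xi_sup D V t x.
Proof.
move=> gx /andP[u0 ut]; apply: ub_le_sup; first exact: xi_ubound (le_trans u0 ut).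
by exists u => //=; rewrite in_itv/= u0.
Qed.

Lemma xi_sup_le x t z : 0 <= t -> (forall u, 0 <= u <= t -> X u x <= z) ->
  xi_sup D V t x <= z.
Proof.
move=> t0 xz; apply: sup_le_ub; first by exists (X 0 x), 0 => //=; rewrite in_itv/= lexx.
by move=> _ [u + <-]; rewrite /= in_itv/=; exact: xz.
Qed.

Lemma xi_sup_ge0 x t : good x -> 0 <= t -> 0 <= xi_sup D V t x.
Proof. by move=> gx t0; rewrite -{1}(xi0 gx) xi_le_sup// lexx. Qed.

(* Regeneration at a time [g] before which the path is below its initial value. *)
Lemma xi_sup_regen x y g z t : good x -> good y -> 0 <= g -> 0 <= t ->
  (forall u, 0 <= u < g -> X u x <= 0) ->
  (forall u, 0 <= u -> X (g + u) x = z + X u y) ->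
  xi_sup D V (g + t) x = Num.max 0 (z + xi_sup D V t y).
Proof.
move=> gx gy g0 t0 before after; apply/eqP; rewrite eq_le; apply/andP; split.
  apply: xi_sup_le => [|u /andP[u0 ut]]; first exact: addr_ge0.
  have [ug|gu] := ltP u g; first by rewrite le_max before// u0.
  rewrite le_max -[u](subrKC g) after ?subr_ge0// lerD2l xi_le_sup ?orbT//.
  by rewrite subr_ge0 gu/= lerBlDl.
rewrite ge_max xi_sup_ge0 ?addr_ge0//= -lerBrDl.
apply: xi_sup_le => // u /andP[u0 ut]; rewrite lerBrDl -after// xi_le_sup//.
by rewrite addr_ge0// lerD2l.
Qed.

Lemma xi_small x u : good x -> 0 <= u < x.2 (Soj 0 (x.1 0%N)) ->
  u < x.2 (Gap 0 (x.1 0%N) 0) ->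
  X u x = drift D (x.1 0%N) * u /\ chain V u x = x.1 0%N.
Proof.
move=> gx us ug; have [-> ->] := xi_before gx us; split => //.
by rewrite levy_small// ug andbT; case/andP: us.
Qed.

(** To the right of any time the path is affine, with the drift of the current state as slope. This
    is the regularity that reduces a supremum over an interval to countably many times. *)
Lemma xi_right x t : good x -> 0 <= t -> exists2 e, 0 < e &
  forall u, t <= u < t + e -> X u x = X t x + drift D (chain V t x) * (u - t).
Proof.
move=> gx t0; have [_ _ xg xh] := gx.
have [e1 e10 H1] := counting_right xh t0.
set n := transitions V t x.
have /andP[nt _] := countingP xh t0; rewrite -/(transitions V t x) -/n in nt.
have tn0 : 0 <= t - sigma V n x by rewrite subr_ge0.
have [e2 e20 H2] := counting_right (xg n (x.1 n)) tn0.
exists (Num.min e1 e2); first by rewrite lt_min e10.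
move=> u /andP[tu ut].
have un : transitions V u x = n.
  by apply: H1; rewrite tu (lt_le_trans ut)// lerD2l ge_min lexx.
rewrite /xi /chain -/n un -addrA; congr (_ + _).
rewrite /levy /compound.
have -> : counting (fun j => gap V n (embedded V n x) j x) (u - sigma V n x) =
          counting (fun j => gap V n (embedded V n x) j x) (t - sigma V n x).
  apply: H2; rewrite lerD2r tu/= addrAC ltrD2r (lt_le_trans ut)//.
  by rewrite lerD2l ge_min lexx orbT.
by rewrite /=; ring.
Qed.

(** Evaluation at a random index: on each level set of [N] a single function is read, and there are
    countably many of them. *)
Lemma measurable_fun_select d (T : measurableType d) (G : set T) (N : T -> nat)
    (f : nat -> T -> R) : (forall n, measurable (G `&` [set w | N w = n])) ->
  (forall n, measurable_fun (G `&` [set w | N w = n]) (f n)) ->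
  measurable_fun G (fun w => f (N w) w).
Proof.
move=> mN mf mG B mB.
rewrite (_ : _ `&` _ = \bigcup_n ((G `&` [set w | N w = n]) `&` f n @^-1` B)).
  by apply: bigcup_measurable => n _; exact: mf.
apply/seteqP; split => w; first by move=> [Gx Bx]; exists (N w).
by move=> [n _ [[Gx /= <-] Bx]].
Qed.

Lemma measurable_fun_select_ord d (T : measurableType d) (G : set T) (N : T -> 'I_m)
    (f : 'I_m -> T -> R) : (forall q, measurable (G `&` [set w | N w = q])) ->
  measurable G -> (forall q, measurable_fun G (f q)) ->
  measurable_fun G (fun w => f (N w) w).
Proof.
move=> mN mG mf.
have := @measurable_fun_select _ _ G (fun w => val (N w)) (fun n => f (insubd o n)).
rewrite (_ : (fun w => f (insubd o (val (N w))) w) = fun w => f (N w) w); last first.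
  by apply/funext => w; congr (f _ w); apply/val_inj; rewrite val_insubd ltn_ord.
apply => [n|n]; last by apply: (measurable_funS mG) => //; exact: subIsetl.
have [nm|nm] := ltnP n m.
  rewrite (_ : [set w | _] = [set w | N w = Ordinal nm]); first exact: mN.
  by apply/seteqP; split => w /= [H]; [apply/val_inj|rewrite H].
rewrite (_ : [set w | _] = set0) ?setI0//; apply/seteqP; split => w //= xn.
by move: nm; rewrite -xn leqNgt ltn_ord.
Qed.

Let mx (i : src m) : measurable_fun [set: S] (fun x => x.2 i) := measurable_src i.

Lemma measurable_holding n : measurable_fun [set: S] (fun x => holding V x n).
Proof.
apply: (@measurable_fun_select_ord _ _ setT (fun x : S => x.1 n)
  (fun q x => x.2 (Soj n q))).
- by move=> q; rewrite setTI; exact: measurable_emb.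
- exact: measurableT.
- by move=> q; exact: mx.
Qed.

Lemma measurable_epoch (h : S -> nat -> R) n : (forall i, measurable_fun setT
  (fun x => h x i)) ->
  measurable_fun setT (fun x => epoch (h x) n).
Proof. by move=> mh; exact: measurable_sum. Qed.

Lemma measurable_proper (h : S -> nat -> R) : (forall i, measurable_fun setT
  (fun x => h x i)) ->
  measurable [set x | proper_clock (h x)].
Proof.
move=> mh.
rewrite (_ : [set x | _] = (\bigcap_n [set x | 0 < h x n]) `&`
   \bigcap_N \bigcup_n [set x | N%:R < epoch (h x) n]).
  apply: measurableI; apply: bigcapT_measurable => n.
    by rewrite -[X in measurable X]setTI; apply: measurable_fun_ltr.
  apply: bigcupT_measurable => i; rewrite -[X in measurable X]setTI.
  by apply: measurable_fun_ltr => //; exact: measurable_epoch.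
apply/seteqP; split => x.
  move=> [h0 hoo]; split => [n _|N _]; first exact: h0.
  by have [n Nn] := hoo N%:R; exists n.
move=> [h0 hoo]; split => [n|t]; first exact: h0.
have [n _ /= Nn] := hoo (Num.truncn `|t|).+1 I; exists n.
by rewrite (le_lt_trans _ Nn)// ltW// (le_lt_trans _ (truncnS_gt _))// ler_norm.
Qed.

Lemma measurable_good : measurable [set x : S | good x].
Proof.
rewrite (_ : [set x : S | _] = ([set x : S | 0 < x.2 Tht] `&`
   \bigcap_n \bigcap_(q in [set: 'I_m]) [set x : S | 0 < x.2 (Soj n q)]) `&`
   ((\bigcap_n \bigcap_(q in [set: 'I_m]) [set x : S | proper_clock
     (fun j => x.2 (Gap n q j))]) `&`
   [set x : S | proper_clock (holding V x)])).
  apply: measurableI; apply: measurableI.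
  - by rewrite -[X in measurable X]setTI; apply: measurable_fun_ltr.
  - apply: bigcapT_measurable => n; apply: fin_bigcap_measurable => [|q _];
    first exact: finite_finset.
    by rewrite -[X in measurable X]setTI; apply: measurable_fun_ltr.
  - apply: bigcapT_measurable => n; apply: fin_bigcap_measurable => [|q _];
    first exact: finite_finset.
    exact: measurable_proper.
  - by apply: measurable_proper => n; exact: measurable_holding.
apply/seteqP; split => x.
  move=> [x1 x2 x3 x4]; split; split => //.
    by move=> n _ q _; exact: x2.
  by move=> n _ q _; exact: x3.
by move=> [[x1 x2] [x3 x4]]; split => // n q; [exact: x2|exact: x3].
Qed.

Local Notation G := [set x : S | good x].

Section at_time.
Variables (H : set S) (tau : S -> R).
Hypotheses (mH : measurable H) (HG : H `<=` G) (mtau : measurable_fun H tau).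
Hypothesis tau0 : forall x, H x -> 0 <= tau x.

Lemma measurable_counting (h : S -> nat -> R) n :
  (forall i, measurable_fun setT (fun x => h x i)) ->
  (forall x, good x -> proper_clock (h x)) ->
  measurable (H `&` [set x | counting (h x) (tau x) = n]).
Proof.
move=> mh hp.
have -> : H `&` [set x | counting (h x) (tau x) = n] =
    (H `&` [set x | epoch (h x) n <= tau x]) `&` (H `&` [set x | tau x < epoch (h x)
      n.+1]).
  apply/seteqP; split => x.
    move=> [Hx /= xn]; have := countingP (hp x (HG Hx)) (tau0 Hx).
    by rewrite xn => /andP[].
  move=> [[Hx n1] [_ n2]]; split => //=.
  by apply: counting_eq; [case: (hp x (HG Hx))|apply/andP].
apply: measurableI.
- by apply: measurable_fun_ler => //; apply: measurable_funTS; exact: measurable_epoch.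
- by apply: measurable_fun_ltr => //; apply: measurable_funTS; exact: measurable_epoch.
Qed.

Lemma measurable_transitions n : measurable (H `&` [set x | transitions V (tau x) x = n]).
Proof.
apply: measurable_counting => // [i|x []//]; exact: measurable_holding.
Qed.

Lemma measurable_chain q : measurable (H `&` [set x | chain V (tau x) x = q]).
Proof.
rewrite (_ : _ `&` _ = \bigcup_n ((H `&` [set x | transitions V (tau x) x = n]) `&`
    [set x : S | x.1 n = q])).
  apply: bigcup_measurable => n _; apply: measurableI; first exact:
    measurable_transitions.
  exact: measurable_emb.
apply/seteqP; split => x.
  by move=> [Hx /= xq]; exists (transitions V (tau x) x).
by move=> [n _ [[Hx /= <-] xq]].
Qed.

Lemma measurable_levy n : measurable_fun H (fun x => levy D V n (x.1 n) (tau x) x).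
Proof.
apply: (@measurable_fun_select_ord _ _ H (fun x => x.1 n)
  (fun q x => levy D V n q (tau x) x)) => // q.
  by apply: measurableI => //; exact: measurable_emb.
rewrite /levy; apply: measurable_funD; first exact: measurable_funM.
rewrite /compound.
apply: (@measurable_fun_select _ _ H (fun x => counting (fun j => x.2 (Gap n q j))
  (tau x))
  (fun N x => \sum_(j < N) x.2 (Jmp n q j))).
  by move=> N; apply: measurable_counting => // x [].
by move=> N; apply: measurable_sum => i; apply: measurable_funTS.
Qed.

End at_time.

Lemma measurable_xi (tau : S -> R) : measurable_fun G tau ->
  (forall x, good x -> 0 <= tau x) -> measurable_fun G (fun x => X (tau x) x).
Proof.
move=> mtau tau0; have mG := measurable_good.
have mT := measurable_transitions mG (fun _ => id) mtau tau0.
apply: (@measurable_fun_select _ _ G (fun x => transitions V (tau x) x)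
  (fun n x => \sum_(i < n) (levy D V i (x.1 i) (holding V x i) x + x.2
    (Chi i (x.1 i) (x.1 i.+1)))
     + levy D V n (x.1 n) (tau x - sigma V n x) x)) => // n.
have HG : G `&` [set x | transitions V (tau x) x = n] `<=` G by exact: subIsetl.
apply: measurable_funD.
  apply: (measurable_funS mG HG); apply: measurable_sum => i.
  apply: measurable_funD.
    apply: measurable_levy => //; first by apply: measurable_funTS;
      exact: measurable_holding.
    by move=> x [_ xs _ _]; exact: ltW (xs _ _).
  apply: (@measurable_fun_select_ord _ _ G (fun x => x.1 i) (fun q x => x.2
    (Chi i q (x.1 i.+1)))) => // q.
    by apply: measurableI => //; exact: measurable_emb.
  apply: (@measurable_fun_select_ord _ _ G (fun x => x.1 i.+1)
    (fun l x => x.2 (Chi i q l))) => // l.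
    by apply: measurableI => //; exact: measurable_emb.
  exact: measurable_funTS.
apply: measurable_levy => //.
  apply: measurable_funB; first exact: (measurable_funS mG HG).
  by apply: measurable_funTS; apply: measurable_epoch => i; exact: measurable_holding.
move=> x [gx /= xn]; have [_ _ _ xh] := gx.
by have := countingP xh (tau0 x gx); rewrite -/(transitions V _ _) xn subr_ge0 => /andP[].
Qed.

(** A height exceeded at some time is exceeded just after it, hence at a grid point. The grid
    consists of fractions of [t], so that the same countable family serves when [t] is the random
    killing time; the minimum with 1 keeps the time in [0, t]. *)
Lemma sup_gt_countable x t z : good x -> 0 <= t -> z < xi_sup D V t x ->
  exists i j : nat, z < X (Num.min 1 (i%:R / j.+1%:R) * t) x.
Proof.
move=> gx t0 zsup.
have [_ [u /= + <-] zu] : exists2 y, [set X u x | u in `[0, t]] y & z < y.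
  apply: sup_gt zsup; exists (X 0 x), 0 => //=; rewrite in_itv/= lexx//.
rewrite in_itv/= => /andP[u0 ut].
move: ut; rewrite le_eqVlt => /orP[/eqP ut|ut].
  by exists 1%N, 0%N; rewrite divr1 minxx mul1r -ut.
have t_gt0 : 0 < t by exact: le_lt_trans ut.
have [e e0 Xe] := xi_right gx u0.
set a := drift D (chain V u x) in Xe.
have a0 : 0 < - a by rewrite oppr_gt0; exact: drift_lt0.
(* Short enough to stay on the affine piece, before [t], and to lose less height than the excess
   over [z]. *)
set e' := Num.min (Num.min e (t - u)) ((X u x - z) / - a).
have e'0 : 0 < e' by rewrite !lt_min e0 subr_gt0 ut/= divr_gt0 ?subr_gt0.
(* The mesh t / (j + 1) is smaller than [e'], and [i] indexes the first grid point strictly after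
   [u]. *)
pose j := Num.truncn (t / e'); pose i := (Num.truncn (u * j.+1%:R / t)).+1.
have j1 : (0 : R) < j.+1%:R by rewrite ltr0n.
have tj : t / j.+1%:R < e'.
  by rewrite ltr_pdivrMr// mulrC -ltr_pdivrMr//; exact: truncnS_gt.
have uj0 : 0 <= u * j.+1%:R / t by rewrite !mulr_ge0// ?invr_ge0 ltW.
pose v := i%:R / j.+1%:R * t.
have uv : u < v.
  have : u * j.+1%:R / t < i%:R by exact: truncnS_gt.
  by rewrite ltr_pdivrMr// -ltr_pdivlMr// mulrAC.
have vu : v < u + e'.
  have iu : i%:R <= u * j.+1%:R / t + 1.
    by rewrite /i -natr1 lerD2r truncn_le.
  apply: (@le_lt_trans _ _ (u + t / j.+1%:R)); last by rewrite ltrD2l.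
  have -> : u + t / j.+1%:R = (u * j.+1%:R / t + 1) / j.+1%:R * t.
    by field; rewrite !gt_eqF.
  by rewrite /v ler_pM2r// ler_pM2r// invr_gt0.
exists i, j; have -> : Num.min 1 (i%:R / j.+1%:R) = i%:R / j.+1%:R :> R.
  apply/min_idPr; rewrite -(ler_pM2r t_gt0) mul1r -/v ltW// (lt_le_trans vu)//.
  by rewrite -lerBrDl !ge_min lexx orbT.
rewrite -/v Xe; last first.
  by rewrite (ltW uv)/= (lt_le_trans vu)// lerD2l !ge_min lexx.
have : (v - u) * - a < X u x - z.
  rewrite -ltr_pdivlMr//; apply: (@lt_le_trans _ _ e'); first by rewrite ltrBlDl.
  by rewrite ge_min lexx orbT.
lra.
Qed.

Lemma measurable_xi_sup : measurable_fun G (fun x => xi_sup D V (x.2 Tht) x).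
Proof.
have mG := measurable_good.
move=> _; apply: (measurability _ (RGenOInfty.measurableE R)) => // _ [_ [z ->] <-].
pose tau (i j : nat) x : R := Num.min 1 (i%:R / j.+1%:R) * x.2 Tht.
have c01 i j : 0 <= (Num.min 1 (i%:R / j.+1%:R) : R) <= 1.
  by rewrite ge_min lexx le_min ler01 divr_ge0.
rewrite (_ : _ `&` _ = \bigcup_i \bigcup_j (G `&` [set x | z < X (tau i j x) x])).
  apply: bigcupT_measurable => i; apply: bigcupT_measurable => j.
  apply: measurable_fun_ltr => //; apply: measurable_xi.
    by apply: measurable_funM => //; exact: measurable_funTS.
  by move=> x [xT _ _ _]; rewrite mulr_ge0 ?(ltW xT)//; case/andP: (c01 i j).
apply/seteqP; split => x /=; rewrite in_itv/= andbT.
  move=> [gx zx]; have [xT _ _ _] := gx.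
  by have [i [j zij]] := sup_gt_countable gx (ltW xT) zx; exists i => //; exists j.
move=> [i _ [j _ [gx zij]]]; split => //; apply: (lt_le_trans zij).
have [xT _ _ _] := gx; have /andP[c0 c1] := c01 i j.
by apply: xi_le_sup => //; rewrite mulr_ge0 ?(ltW xT)//= ler_piMl// ltW.
Qed.

End canonical_driver.

(** * The one-step equation *)

Section one_step_functional.
Context {R : realType} {m : nat} (o : 'I_m) (D : map_data R m).
Hypothesis drift_lt0 : forall k, drift D k < 0.
Local Notation S := (path_space (R := R) o).
Local Notation V := (canonical_driver (R := R) o).
Implicit Types x : S.
Local Notation jump_first := (jump_first (o := o)).
Local Notation trans_first := (trans_first (o := o)).
Local Notation killed_first := (killed_first (o := o)).
Local Notation jump_shift := (jump_shift (o := o)).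
Local Notation trans_shift := (trans_shift (o := o)).

Definition end_xi x : R := xi D V (x.2 Tht) x.
Definition end_sup x : R := xi_sup D V (x.2 Tht) x.
Definition end_state x : 'I_m := chain V (x.2 Tht) x.

Lemma regen_jump k x : good x -> jump_first k setT setT x ->
  let y := jump_shift k x in
  let u := drift D k * x.2 (Gap 0 k 0) + x.2 (Jmp 0 k 0) in
  [/\ good y, end_state x = end_state y, end_xi x = u + end_xi y
    & end_sup x = Num.max 0 (u + end_sup y)].
Proof.
move=> gx [xk [gh gT _ _]] y u; have gy : good y by exact: good_jump.
have [_ _ xg _] := gx; have g0 : 0 < x.2 (Gap 0 k 0) by case: (xg 0%N k).
have [yT _ _ _] := gy.
have -> : end_state x = chain V (x.2 (Gap 0 k 0) + y.2 Tht) x.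
  by rewrite /end_state jump_shift_Tht subrKC.
have -> : end_xi x = xi D V (x.2 (Gap 0 k 0) + y.2 Tht) x.
  by rewrite /end_xi jump_shift_Tht subrKC.
have -> : end_sup x = xi_sup D V (x.2 (Gap 0 k 0) + y.2 Tht) x.
  by rewrite /end_sup jump_shift_Tht subrKC.
split => //.
- by rewrite chain_jump// ltW.
- by rewrite xi_jump// ltW.
- apply: xi_sup_regen => //; try exact: ltW.
    move=> v /andP[v0 vg]; have [] := @xi_small _ _ _ D x v gx; rewrite ?xk ?v0//=.
      exact: lt_trans gh.
    by move=> -> _; rewrite nmulr_rle0.
  by move=> v v0; rewrite xi_jump.
Qed.

Lemma regen_trans k q x : good x -> trans_first k q setT setT x ->
  let y := trans_shift k x in
  let u := drift D k * x.2 (Soj 0 k) + x.2 (Chi 0 k q) in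
  [/\ good y, end_state x = end_state y, end_xi x = u + end_xi y
    & end_sup x = Num.max 0 (u + end_sup y)].
Proof.
move=> gx [xk xq [hg hT _ _]] y u; have gy : good y by exact: good_trans.
have [_ xs _ _] := gx; have h0 := xs 0%N k.
have [yT _ _ _] := gy.
have -> : end_state x = chain V (x.2 (Soj 0 k) + y.2 Tht) x.
  by rewrite /end_state trans_shift_Tht subrKC.
have -> : end_xi x = xi D V (x.2 (Soj 0 k) + y.2 Tht) x.
  by rewrite /end_xi trans_shift_Tht subrKC.
have -> : end_sup x = xi_sup D V (x.2 (Soj 0 k) + y.2 Tht) x.
  by rewrite /end_sup trans_shift_Tht subrKC.
split => //.
- by rewrite (chain_trans gx xk)// ltW.
- by rewrite (xi_trans D gx xk)// ?(ltW yT)// xq.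
- apply: xi_sup_regen => //; try exact: ltW.
    move=> v /andP[v0 vh]; have [] := @xi_small _ _ _ D x v gx; rewrite ?xk ?v0//=.
      exact: lt_trans hg.
    by move=> -> _; rewrite nmulr_rle0.
  by move=> v v0; rewrite (xi_trans D gx xk)// xq.
Qed.

Lemma regen_killed k x : good x -> killed_first k setT x ->
  [/\ end_state x = k, end_xi x = drift D k * x.2 Tht & end_sup x = 0].
Proof.
move=> gx [xk [Ts Tg _ _]]; have [T0 _ _ _] := gx.
have small v : 0 <= v <= x.2 Tht -> xi D V v x = drift D k * v /\ chain V v x = k.
  move=> /andP[v0 vT]; have := @xi_small _ _ _ D x v gx; rewrite xk v0/=.
  by apply; [exact: le_lt_trans Ts|exact: le_lt_trans Tg].
have TT : 0 <= x.2 Tht <= x.2 Tht by rewrite lexx ltW.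
have [eX eC] := small _ TT; split => //.
apply/eqP; rewrite eq_le; apply/andP; split; last by apply: xi_sup_ge0 => //; exact: ltW.
apply: xi_sup_le => [|u uT]; first exact: ltW.
by have [-> _] := small _ uT; case/andP: uT => u0 _; rewrite nmulr_rle0.
Qed.

Lemma measurable_end_state r : measurable ([set x : S | good x] `&`
  [set x | end_state x = r]).
Proof.
apply: measurable_chain => //; first exact: measurable_good.
  by apply: measurable_funTS; exact: measurable_src.
by move=> x [xT _ _ _]; exact: ltW.
Qed.

(** Set to 0 off the good configurations, to be measurable on the whole space. *)
Definition sup_xi x : R * R :=
  ((end_sup \_ [set x | good x]) x, (end_xi \_ [set x | good x]) x).

Lemma sup_xiE x : good x -> sup_xi x = (end_sup x, end_xi x).
Proof. by move=> gx; rewrite /sup_xi !patchE mem_set. Qed.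

Lemma measurable_sup_xi : measurable_fun setT sup_xi.
Proof.
have mG := @measurable_good R m o.
apply: measurable_fun_pair; apply/(measurable_restrictT _ mG).
  exact: measurable_xi_sup.
apply: measurable_xi => //; last by move=> x [xT _ _ _]; exact: ltW.
by apply: measurable_funTS; exact: measurable_src.
Qed.

End one_step_functional.

Section measure_restr.
Local Open Scope ereal_scope.
Context d (T : measurableType d) (R : realType).

Lemma ge0_integral_mrestr (mu : {measure set T -> \bar R}) (A : set T)
    (mA : measurable A) (f : T -> \bar R) :
  measurable_fun setT f -> (forall x, 0 <= f x) ->
  \int[mrestr mu mA]_x f x = \int[mu]_(x in A) f x.
Proof.
move=> mf f0.
rewrite (@integral_density _ _ _ mu (mrestr mu mA) \1_A)//.
- rewrite [RHS]integral_mkcond; apply: eq_integral => x _.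
  by rewrite patchE indicE; case: ifPn; rewrite ?mule1 ?mule0.
- by move=> B mB; rewrite integral_indic// setIC.
Qed.

End measure_restr.

Section partition.
Local Open Scope ereal_scope.
Context d (T : measurableType d) (R : realType) (n : nat) (P : probability T R).
Variables (A B : set T) (C : 'I_n -> set T).
Hypotheses (mA : measurable A) (mB : measurable B) (mC : forall q, measurable (C q)).
Hypotheses (AB : A `&` B = set0) (AC : forall q, A `&` C q = set0)
  (BC : forall q, B `&` C q = set0) (tC : trivIset setT C).
Hypothesis P1 : P A + (P B + \sum_q P (C q)) = 1.

(** Ties between clocks are not excluded path by path: the events have total probability 1, so what
    they miss is negligible. *)
Lemma ge0_integral_partition D (f : T -> \bar R) : measurable D ->
  measurable_fun setT f -> (forall x, 0 <= f x) ->
  \int[P]_(w in D) f w = \int[P]_(w in A `&` D) f w +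
    (\int[P]_(w in B `&` D) f w + \sum_q \int[P]_(w in C q `&` D) f w).
Proof.
move=> mD mf f0.
set CU := \big[setU/set0]_q C q; pose U := A `|` (B `|` CU).
have mCU : measurable CU by exact: bigsetU_measurable.
have mU : measurable U by do 2 apply: measurableU => //.
have CUE : CU = \bigcup_q C q.
  apply/seteqP; split => w; rewrite /CU -bigcup_seq; first by case=> q _ ?; exists q.
  by case=> q _ ?; exists q => //=; rewrite mem_index_enum.
have BCU : B `&` CU = set0.
  by rewrite CUE; apply/seteqP; split => w // -[Bw [q _ Cw]]; rewrite -(BC q).
have ABCU : A `&` (B `|` CU) = set0.
  rewrite setIUr AB set0U CUE; apply/seteqP; split => w // -[Aw [q _ Cw]].
  by rewrite -(AC q).
have PU : P U = 1.
  rewrite -P1 measureU//; last exact: measurableU.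
  rewrite measureU//; congr (_ + (_ + _)); exact: measure_bigsetU_ord.
have PUC : P (~` U) = 0 by rewrite probability_setC// PU subee.
rewrite (ge0_negligible_integral _ mD _ _ PUC)//; last 2 first.
- exact: measurableC.
- exact: measurable_funTS.
rewrite setDE setCK setIC !setIUl ge0_integral_setU//; last 4 first.
- exact: measurableI.
- by apply: measurableU; exact: measurableI.
- exact: measurable_funTS.
- by rewrite disj_set2E -setIUl setIACA ABCU set0I.
rewrite ge0_integral_setU//; last 4 first.
- exact: measurableI.
- exact: measurableI.
- exact: measurable_funTS.
- by rewrite disj_set2E setIACA BCU set0I.
congr (_ + (_ + _)); rewrite /CU big_distrl/= ge0_integral_bigsetU//.
- by move=> q; exact: measurableI.
- exact: index_enum_uniq.
- by move=> i j _ _ [w [[Ciw _] [Cjw _]]]; apply: tC => //; exists w.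
- exact: measurable_funTS.
Qed.

End partition.

Section one_step.
Local Open Scope ereal_scope.
Context {R : realType} {m : nat} (D : map_data R m).
Context d (T : measurableType d) (W : driver T R m) (o : 'I_m).
Variables (s : R) (P : 'I_m -> probability T R) (theta : {mfun T >-> R}).
Hypothesis chainD : irreducible_chain D.
Hypothesis drift_lt0 : forall k, (drift D k < 0)%R.
Hypothesis drivenD : driven D W s P theta.
Variables (nuP lamP : 'I_m -> {posnum R}) (sP : {posnum R}).
Hypothesis nuPE : forall k, (nuP k)%:num = nu D k.
Hypothesis lamPE : forall k, (lamP k)%:num = lam D k.
Hypothesis sPE : sP%:num = s.
Variable rho : 'I_m -> {posnum R}.
Hypothesis rhoE : forall k, (rho k)%:num = (sP%:num + ((nuP k)%:num + (lamP k)%:num))%R.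

Local Notation S := (path_space (R := R) o).
Local Notation code := (code W o theta : T -> S).

Let p0 : forall i j, (0 <= trans D i j)%R. Proof. by case: chainD. Qed.

Let mcode : measurable_fun setT code := measurable_code (o := o) drivenD.

Let law := code_law o chainD drivenD nuPE lamPE sPE.

Lemma good_code w : good (code w).
Proof.
have [gw _ _] := drivenD; have [w1 w2 w3 w4 w5] := gw w; split => //.
by move=> n q; split => [j|t]; [exact: w3|exact: w5].
split => [n|t]; [exact: w2|exact: w4].
Qed.

Lemma end_in_code r : end_in W theta r = [set w | end_state (code w) = r].
Proof. by []. Qed.

Lemma xi_th_code w : xi_th D W theta w = end_xi D (code w). Proof. by []. Qed.

Lemma xi_sup_th_code w : xi_sup_th D W theta w = end_sup D (code w). Proof. by []. Qed.

Lemma measurable_end_in r : measurable (end_in W theta r).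
Proof.
have := mcode measurableT (measurable_end_state (o := o) r).
by rewrite setTI; congr measurable; apply/seteqP; split => w; [case|split => //;
  exact: good_code].
Qed.

Definition law_map (w : T) : R * R := sup_xi D (code w).

Lemma law_mapE w : law_map w = (xi_sup_th D W theta w, xi_th D W theta w).
Proof. by rewrite /law_map sup_xiE//; exact: good_code. Qed.

Lemma measurable_law_map : measurable_fun setT law_map.
Proof. exact: (measurableT_comp (measurable_sup_xi (o := o) drift_lt0) mcode). Qed.

Definition mu k r : {finite_measure set (R * R)%type -> \bar R} :=
  img (mrestr (P k) (measurable_end_in r)) measurable_law_map.

Lemma muE k r A : measurable A ->
  mu k r A = P k (law_map @^-1` A `&` end_in W theta r).
Proof. by []. Qed.

Lemma mu_integral k r (f : R * R -> \bar R) : measurable_fun setT f ->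
  (forall x, 0 <= f x) ->
  \int[mu k r]_x f x =
  \int[P k]_(w in end_in W theta r) f (xi_sup_th D W theta w, xi_th D W theta w).
Proof.
move=> mf f0; rewrite ge0_integral_img// ge0_integral_mrestr//.
  by apply: eq_integral => w _; rewrite law_mapE.
exact: (measurableT_comp mf measurable_law_map).
Qed.

Lemma measurable_disp (a : R) : measurable_fun setT (fun z : R * R => (a * z.1 + z.2)%R).
Proof. by apply: measurable_funD => //; apply: measurable_funM. Qed.

(** The displacement up to and including the first event. Whichever clock wins, the time of the
    event is exponential with the total rate [rho k]. *)
Definition kapJ k : {finite_measure set R -> \bar R} :=
  img (prodm (expo (rho k)) (jump_law D k)) (measurable_disp (drift D k)).

Definition kapT k q : {finite_measure set R -> \bar R} :=
  img (prodm (expo (rho k)) (chi_law D k q)) (measurable_disp (drift D k)).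

(** Turns the pair (supremum, value) of the regenerated path into that of the whole path, [u] being
    the displacement at the first event; before it the supremum is 0, the starting height. *)
Definition reflect_add (u : R) (x : R * R) : R * R := (Num.max 0%R (u + x.1), u + x.2)%R.

Lemma measurable_reflect_add :
  measurable_fun setT (fun z : R * (R * R) => reflect_add z.1 z.2).
Proof.
have m1 : measurable_fun setT (fun z : R * (R * R) => (z.1 + z.2.1)%R).
  by apply: measurable_funD => //; exact: measurableT_comp.
have m2 : measurable_fun setT (fun z : R * (R * R) => (z.1 + z.2.2)%R).
  by apply: measurable_funD => //; exact: measurableT_comp.
by apply: measurable_fun_pair => //; apply: measurable_maxr.
Qed.

Section regeneration_event.
Variables (k q r : 'I_m) (B : set T) (sh : T -> S) (t1 t2 : T -> R).
Variables (c : R) (J : probability R R).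
Hypotheses (mB : measurable B) (msh : measurable_fun setT sh).
Hypotheses (mt1 : measurable_fun setT t1) (mt2 : measurable_fun setT t2).
Hypothesis c0 : (0 <= c)%R.
Let u w := (drift D k * t1 w + t2 w)%R.
Hypothesis regenB : forall w, B w -> [/\ good (sh w),
  end_state (code w) = end_state (sh w), end_xi D (code w) = (u w + end_xi D (sh w))%R &
  end_sup D (code w) = Num.max 0%R (u w + end_sup D (sh w))%R].
Hypothesis lawB : forall (C C' : set R) (A : set S),
  measurable C -> measurable C' -> measurable A ->
  P k [set w | [/\ B w, C (t1 w), C' (t2 w) & A (sh w)]] =
  c%:E * expo (rho k) C * J C' * P q (code @^-1` A).

Let kap : {finite_measure set R -> \bar R} :=
  img (prodm (expo (rho k)) J) (measurable_disp (drift D k)).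

Let mu_ : measurable_fun setT u.
Proof. by apply: measurable_funD => //; apply: measurable_funM. Qed.

Let msx : measurable_fun setT (sup_xi D \o sh).
Proof. exact: (measurableT_comp (measurable_sup_xi (o := o) drift_lt0) msh). Qed.

Let final (A : set (R * R)) : set S :=
  ([set x : S | good x] `&` [set x | end_state x = r]) `&` sup_xi D @^-1` A.

Let mfinal A : measurable A -> measurable (final A).
Proof.
move=> mA; apply: measurableI; first exact: measurable_end_state.
by rewrite -[X in measurable X]setTI; exact: measurable_sup_xi.
Qed.

Let final_code A : code @^-1` final A = law_map @^-1` A `&` end_in W theta r.
Proof.
apply/seteqP; split => w /=; first by case=> -[].
by move=> [Aw rw]; split => //; split => //; exact: good_code.
Qed.

Let shB (A : set S) := B `&` sh @^-1` A.

Let mshB A : measurable A -> measurable (shB A).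
Proof.
by move=> mA; apply: measurableI => //; rewrite -[X in measurable X]setTI; exact: msh.
Qed.

(** Independence is obtained in two passes. The time and the mark are first handled jointly, since a
    condition on the displacement is not a rectangle in them; the displacement is then paired with
    the outcome of the shifted path. *)
Lemma regen_law (Z : set (R * (R * R))) : measurable Z ->
  P k (shB (final setT) `&` [set w | Z (u w, sup_xi D (sh w))]) =
  c%:E * prodm kap (mu q r) Z.
Proof.
move=> mZ; apply: indep_pair => // [|A A' mA mA'].
  exact: (mshB (mfinal measurableT)).
have step Y : measurable Y -> P k (shB (final A') `&` [set w | Y (t1 w, t2 w)]) =
    (c * fine (mu q r A'))%:E * prodm (expo (rho k)) J Y.
  move=> mY; apply: indep_pair => // [||C C' mC mC'].
  - by rewrite mulr_ge0// fine_ge0.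
  - exact: (mshB (mfinal mA')).
  transitivity (P k [set w | [/\ B w, C (t1 w), C' (t2 w) & final A' (sh w)]]).
    by congr (P k _); apply/seteqP; split => w; [move=> [[? ?] [? ?]]|move=> [? ? ? ?]].
  rewrite lawB//; last exact: mfinal.
  rewrite final_code -muE// EFinM fineK ?fin_num_measure//.
  by rewrite -!muleA; congr (_ * _); rewrite muleA muleC.
transitivity (P k (shB (final A') `&` [set w | ((fun z : R * R => drift D k * z.1 +
  z.2)%R @^-1` A) (t1 w, t2 w)])).
  congr (P k _); apply/seteqP; split => w.
    by move=> [[Bw [[gw rw] _]] [Aw A'w]].
  by move=> [[Bw [[gw rw] A'w]] Aw].
rewrite step; last first.
  by rewrite -[X in measurable X]setTI; exact: measurable_disp.
by rewrite EFinM fineK ?fin_num_measure// -muleA; congr (_ * _); rewrite muleC.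
Qed.

Lemma regen_integral (f : R * R -> \bar R) : measurable_fun setT f ->
  (forall x, 0 <= f x) ->
  \int[P k]_(w in B `&` end_in W theta r) f (xi_sup_th D W theta w, xi_th D W theta w) =
  c%:E * \int[kap]_u \int[mu q r]_x f (reflect_add u x).
Proof.
move=> mf f0; pose g z := f (reflect_add z.1 z.2).
have mg : measurable_fun setT g by exact: (measurableT_comp mf measurable_reflect_add).
have mBr : measurable (shB (final setT)) := mshB (mfinal measurableT).
have mh : measurable_fun setT (fun w => (u w, sup_xi D (sh w))).
  exact: measurable_fun_pair.
have -> : B `&` end_in W theta r = shB (final setT).
  apply/seteqP; split => w.
    move=> [Bw rw]; split => //; have [gw er _ _] := regenB Bw.
    by do 2 (split => //); rewrite /= -er.
  move=> [Bw [[gw rw] _]]; split => //; have [_ er _ _] := regenB Bw.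
  by rewrite end_in_code /= er.
transitivity (\int[P k]_(w in shB (final setT)) g (u w, sup_xi D (sh w))).
  apply: eq_integral => w; rewrite inE => -[Bw _]; have [gw _ ex es] := regenB Bw.
  by rewrite /g sup_xiE// xi_sup_th_code xi_th_code ex es.
rewrite -(ge0_integral_mrestr (P k) mBr); last 2 first.
- exact: (measurableT_comp mg mh).
- by move=> w; exact: f0.
rewrite -(ge0_integral_img _ mh mg)//; last by move=> z; exact: f0.
rewrite (eq_measure_integral (mscale (NngNum c0) (prodm kap (mu q r)))); last first.
  by move=> A mA _; rewrite -[RHS]regen_law// setIC.
rewrite ge0_integral_mscale//; last by move=> z _; exact: f0.
by rewrite ge0_integral_prodm// => z; exact: f0.
Qed.

End regeneration_event.

Local Notation jump_first := (jump_first (o := o)).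
Local Notation trans_first := (trans_first (o := o)).
Local Notation killed_first := (killed_first (o := o)).
Local Notation jump_shift := (jump_shift (o := o)).
Local Notation trans_shift := (trans_shift (o := o)).

Let EK k := [set w | killed_first k setT (code w)].
Let EJ k := [set w | jump_first k setT setT (code w)].
Let ET k q := [set w | trans_first k q setT setT (code w)].

Let memb n k : measurable [set w | (code w).1 n = k].
Proof.
rewrite -[X in measurable X]setTI.
exact: (mcode measurableT (measurable_emb n k)).
Qed.

Let mEK k : measurable (EK k).
Proof.
by apply: measurableI; [exact: memb|exact: (measurable_first_clock mcode)].
Qed.

Let mEJ k : measurable (EJ k).
Proof.
by apply: measurableI; [exact: memb|exact: (measurable_first_clock mcode)].
Qed.

Let mET k q : measurable (ET k q).
Proof.
rewrite (_ : ET k q = ([set w | (code w).1 0%N = k] `&` [set w | (code w).1 1%N = q]) `&`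
  [set w | first_clock (o := o) (Soj 0 k) (Gap 0 k 0) Tht (Chi 0 k q) setT setT
    (code w)]).
  apply: measurableI; last exact: (measurable_first_clock mcode).
  by apply: measurableI; exact: memb.
by apply/seteqP; split => w /=; [case|case=> -[]].
Qed.

Theorem one_step k r (f : R * R -> \bar R) : measurable_fun setT f ->
  (forall x, 0 <= f x) ->
  \int[mu k r]_x f x =
    (sP%:num / (rho k)%:num * (k == r)%:R)%:E * \int[expo (rho k)]_t f
      (0%R, (drift D k * t)%R) +
    (((lamP k)%:num / (rho k)%:num)%:E *
       \int[kapJ k]_u \int[mu k r]_x f (reflect_add u x) +
     \sum_q ((nuP k)%:num / (rho k)%:num * trans D k q)%:E *
       \int[kapT k q]_u \int[mu q r]_x f (reflect_add u x)).
Proof.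
move=> mf f0; rewrite mu_integral//.
pose F w := f (law_map w).
have mF : measurable_fun setT F by exact: (measurableT_comp mf measurable_law_map).
have FE (A : set T) : \int[P k]_(w in A) f (xi_sup_th D W theta w, xi_th D W theta w) =
    \int[P k]_(w in A) F w.
  by apply: eq_integral => w _; rewrite /F law_mapE.
have AB : EK k `&` EJ k = set0.
  apply/seteqP; split => w // -[[_ [_ h _ _]] [_ [_ h' _ _]]].
  by move: (lt_trans h h'); rewrite ltxx.
have AC q : EK k `&` ET k q = set0.
  apply/seteqP; split => w // -[[_ [h _ _ _]] [_ _ [_ h' _ _]]].
  by move: (lt_trans h h'); rewrite ltxx.
have BC q : EJ k `&` ET k q = set0.
  apply/seteqP; split => w // -[[_ [h _ _ _]] [_ _ [h' _ _ _]]].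
  by move: (lt_trans h h'); rewrite ltxx.
have tC : trivIset setT (ET k).
  by move=> q q' _ _ [w [[_ <- _] [_ <- _]]].
have P1 : P k (EK k) + (P k (EJ k) + \sum_q P k (ET k q)) = 1.
  have -> : P k (EK k) = (sP%:num / (rho k)%:num)%:E.
    have := law_killed_first p0 mcode law rhoE k measurableT.
    by rewrite probability_setT mule1.
  have -> : P k (EJ k) = ((lamP k)%:num / (rho k)%:num)%:E.
    have := law_jump_first p0 mcode law rhoE k measurableT measurableT measurableT.
    rewrite preimage_setT !probability_setT !mule1 => <-.
    by congr (P k _); apply/seteqP; split => w; [|case].
  have ETE q : P k (ET k q) = ((nuP k)%:num / (rho k)%:num * trans D k q)%:E.
    have := law_trans_first p0 mcode law rhoE k q measurableT measurableT measurableT.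
    rewrite preimage_setT !probability_setT !mule1 => <-.
    by congr (P k _); apply/seteqP; split => w; [|case].
  under eq_bigr do rewrite ETE.
  rewrite sumEFin -mulr_sumr -!EFinD; have [_ _ -> _] := chainD.
  by rewrite mulr1 rhoE; congr (_%:E); field; rewrite gt_eqF.
rewrite FE (ge0_integral_partition (mEK k) (mEJ k) (mET k) AB AC BC tC P1
  (measurable_end_in r) mF)//; last by move=> w; exact: f0.
congr (_ + (_ + _)).
- have [<-|kr] := eqVneq k r; last first.
    rewrite mulr0 mul0e (_ : _ `&` _ = set0) ?integral_set0//.
    apply/seteqP; split => w // -[Kw].
    have [e _ _] := regen_killed drift_lt0 (good_code w) Kw.
    by rewrite end_in_code /= e => e'; move: kr; rewrite e' eqxx.
  rewrite mulr1 (_ : _ `&` _ = EK k); last first.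
    apply/seteqP; split => w; first by case.
    by move=> Kw; split => //; have [] := regen_killed drift_lt0 (good_code w) Kw.
  pose g t := f (0, drift D k * t)%R.
  have mg : measurable_fun setT g.
    by apply: (measurableT_comp mf); apply: measurable_fun_pair.
  have mth : measurable_fun setT (fun w => (code w).2 Tht) by exact: measurable_funP.
  transitivity (\int[P k]_(w in EK k) g ((code w).2 Tht)).
    apply: eq_integral => w; rewrite inE => Kw.
    have [_ ex es] := regen_killed drift_lt0 (good_code w) Kw.
    by rewrite /F law_mapE xi_sup_th_code xi_th_code ex es.
  rewrite -(ge0_integral_mrestr (P k) (mEK k)); last 2 first.
  - exact: (measurableT_comp mg mth).
  - by move=> w; exact: f0.
  rewrite -(ge0_integral_img _ mth mg)//; last by move=> z; exact: f0.
  have c0 : (0 <= sP%:num / (rho k)%:num)%R by [].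
  rewrite (eq_measure_integral (mscale (NngNum c0) (expo (rho k)))); last first.
    move=> A mA _.
    transitivity ((sP%:num / (rho k)%:num)%:E * expo (rho k) A); last by [].
    rewrite -(law_killed_first p0 mcode law rhoE k mA); congr (P k _).
    apply/seteqP; split => w; first by move=> [Aw [wk [? ? _ _]]].
    by move=> [wk [? ? Aw _]].
  by rewrite ge0_integral_mscale//; move=> z _; exact: f0.
- rewrite -FE; apply: (@regen_integral k k r (EJ k) (fun w => jump_shift k (code w))
    (fun w => (code w).2 (Gap 0 k 0)) (fun w => (code w).2 (Jmp 0 k 0)) _
      (jump_law D k)) => //.
  + exact: (measurable_shift mcode).
  + by move=> w Jw; exact: (regen_jump drift_lt0 (good_code w) Jw).
  + move=> C C' A mC mC' mA.
    rewrite -(law_jump_first p0 mcode law rhoE k mC mC' mA); congr (P k _).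
    apply/seteqP; split => w; first by move=> [[wk [? ? _ _]] Cw C'w Aw].
    by move=> [[wk [? ? Cw C'w]] Aw].
- apply: eq_bigr => q _.
  rewrite -FE; apply: (@regen_integral k q r (ET k q) (fun w => trans_shift k (code w))
    (fun w => (code w).2 (Soj 0 k)) (fun w => (code w).2 (Chi 0 k q)) _
      (chi_law D k q)) => //.
  + exact: (measurable_shift mcode).
  + by rewrite mulr_ge0.
  + by move=> w Jw; exact: (regen_trans drift_lt0 (good_code w) Jw).
  + move=> C C' A mC mC' mA.
    rewrite -(law_trans_first p0 mcode law rhoE k q mC mC' mA); congr (P k _).
    apply/seteqP; split => w; first by move=> [[wk wq [? ? _ _]] Cw C'w Aw].
    by move=> [[wk wq [? ? Cw C'w]] Aw].
Qed.

End one_step.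

(** * The ladder identity *)

Section sum_of_measures.
Context d (T : measurableType d) (R : realType).
Local Open Scope ereal_scope.
Variables (a b : {nonneg R}) (m1 m2 : {finite_measure set T -> \bar R}).

Definition mix : set T -> \bar R := measure_add (mscale a m1) (mscale b m2).

Let mix0 : mix set0 = 0. Proof. exact: measure0. Qed.

Let mix_ge0 A : 0 <= mix A. Proof. exact: measure_ge0. Qed.

Let mix_sigma_additive : semi_sigma_additive mix.
Proof. exact: measure_semi_sigma_additive. Qed.

HB.instance Definition _ := isMeasure.Build _ _ _ mix
  mix0 mix_ge0 mix_sigma_additive.

Lemma mixE A : mix A = a%:num%:E * m1 A + b%:num%:E * m2 A.
Proof. exact: measure_addE. Qed.

Let mix_fin : fin_num_fun mix.
Proof. by move=> A mA; rewrite mixE fin_numD !fin_numM// fin_num_measure. Qed.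

HB.instance Definition _ := Measure_isFinite.Build _ _ _ mix mix_fin.

Lemma ge0_integral_mix (f : T -> \bar R) :
  measurable_fun setT f -> (forall z, 0 <= f z) ->
  \int[mix]_z f z = a%:num%:E * \int[m1]_z f z + b%:num%:E * \int[m2]_z f z.
Proof.
by move=> mf f0; rewrite ge0_integral_measure_add// !ge0_integral_mscale.
Qed.

End sum_of_measures.

Section helpers.
Context d (T : measurableType d) (R : realType).
Local Open Scope ereal_scope.

Lemma measurable_ifb (b : T -> bool) (F : T -> \bar R) :
  measurable_fun setT b -> measurable_fun setT F ->
  measurable_fun setT (fun x => if b x then F x else 0).
Proof. by move=> mb mF; apply: measurable_fun_ifT. Qed.

Lemma ifb_ge0 (b : bool) (x : \bar R) : (b -> 0 <= x) -> 0 <= if b then x else 0.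
Proof. by case: b => // ->. Qed.

Lemma integral_ifb (m1 : {measure set T -> \bar R}) (b : bool) (F : T -> \bar R) :
  \int[m1]_x (if b then F x else 0) = if b then \int[m1]_x F x else 0.
Proof. by case: b => //; rewrite integral0. Qed.

Lemma measurable_integral d2 (T2 : measurableType d2)
    (m2 : {finite_measure set T2 -> \bar R}) (f : T * T2 -> \bar R) :
  measurable_fun setT f -> (forall z, 0 <= f z) ->
  measurable_fun setT (fun x => \int[m2]_y f (x, y)).
Proof. by move=> mf f0; exact: measurable_fun_fubini_tonelli_F. Qed.

End helpers.

Lemma finite_bound {R : realType} {m : nat} (X : 'I_m -> \bar R) :
  (forall k, X k \is a fin_num) -> (forall k, 0 <= X k)%E ->
  exists2 B, 0 <= B & forall k, (X k <= B%:E)%E.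
Proof.
move=> Xfin X0; exists (\sum_k fine (X k)); first by apply: sumr_ge0 => k _;
  exact: fine_ge0.
move=> k; rewrite -[leLHS]fineK// lee_fin (bigD1 k)//= lerDl.
by apply: sumr_ge0 => j _; exact: fine_ge0.
Qed.

Lemma eq_expo_integral_pos {R : realType} (c : {posnum R}) (f g : R -> \bar R) :
  measurable_fun setT f -> measurable_fun setT g ->
  (forall t, 0 <= f t)%E -> (forall t, 0 <= g t)%E ->
  (forall t, 0 < t -> f t = g t) ->
  (\int[expo c]_t f t = \int[expo c]_t g t)%E.
Proof.
move=> mf mg f0 g0 fg; rewrite (expo_integral c mf f0) (expo_integral c mg g0).
apply: ae_eq_integral => //.
- by apply: emeasurable_funM => //; apply/measurable_EFinP;
  exact: measurable_exponential_pdf.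
- by apply: emeasurable_funM => //; apply/measurable_EFinP;
  exact: measurable_exponential_pdf.
exists [set 0]; split => //; first exact: lebesgue_measure_set1.
move=> t /= /not_implyP[_]; apply: contra_notP => /eqP t0.
have [tlt|tge] := ltP t 0; first by rewrite lt0_exponential_pdf// !mule0.
by rewrite fg// lt_neqAle eq_sym t0.
Qed.

(** * The kernel killed above height 0 *)

Section contraction.
Context {R : realType} {m : nat} (kap : 'I_m -> 'I_m -> {finite_measure set R -> \bar R}).
Variable (beta : R).
Local Open Scope ereal_scope.
Hypotheses (beta0 : (0 <= beta)%R) (beta1 : (beta < 1)%R).
Hypothesis massK : forall k, \sum_q kap k q setT <= beta%:E.

Lemma geometric_small (B e : R) : (0 < e)%R -> exists n, (beta ^+ n * B <= e)%R.
Proof.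
move=> e0; have B0 : (0 < `|B| + 1)%R by rewrite ltr_wpDl.
have /cvgrPdist_lt/(_ (e / (`|B| + 1))%R) : ((beta ^+ n)%R @[n --> \oo] --> (0 : R)%R).
  by apply: cvg_expr; rewrite ger0_norm.
rewrite divr_gt0// => /(_ isT)[n _ /(_ n (leqnn n))/=].
rewrite sub0r normrN ger0_norm ?exprn_ge0// ltr_pdivlMr// => lt; exists n.
rewrite (le_trans _ (ltW lt))// ler_wpM2l ?exprn_ge0//.
by rewrite (le_trans (ler_norm B))// lerDl.
Qed.

(** Here [y] is the current height, and mass that an event carries above 0 is lost. *)
Definition killed_step k (Phi : 'I_m -> R -> \bar R) (y : R) : \bar R :=
  \sum_q \int[kap k q]_u (if (y + u <= 0)%R then Phi q (y + u)%R else 0).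

Lemma measurable_shifted (F : R -> \bar R) (y : R) : measurable_fun setT F ->
  measurable_fun setT (fun u : R => if (y + u <= 0)%R then F (y + u)%R else 0).
Proof.
move=> mF; have my : measurable_fun setT (fun u : R => y + u)%R by exact: measurable_funD.
apply: measurable_ifb; last exact: measurableT_comp mF my.
exact: measurable_fun_ler.
Qed.

(** The gap is kept as an additive error instead of a difference, because the values are extended
    reals. *)
Lemma killed_step_le k (Phi Psi : 'I_m -> R -> \bar R) (y e : R) :
  (forall q, measurable_fun setT (Phi q)) -> (forall q, measurable_fun setT (Psi q)) ->
  (forall q (z : R), 0 <= Phi q z) -> (forall q (z : R), 0 <= Psi q z) -> (0 <= e)%R ->
  (forall q (z : R), (z <= 0)%R -> Phi q z <= Psi q z + e%:E) ->
  killed_step k Phi y <= killed_step k Psi y + (beta * e)%:E.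
Proof.
move=> mPhi mPsi Phi0 Psi0 e0 le.
apply: (@le_trans _ _ (\sum_q (\int[kap k q]_u (if (y + u <= 0)%R then Psi q (y + u)%R
  else 0)
   + e%:E * kap k q setT))); last first.
  rewrite big_split/= leeD2l// -ge0_sume_distrr; last by move=> *; exact: measure_ge0.
  by rewrite mulrC EFinM lee_wpmul2l.
apply: lee_sum => q _; rewrite -integral_cst//.
have mPsi' := measurable_shifted y (mPsi q).
rewrite -ge0_integralD//=; last by move=> u _; exact: ifb_ge0.
apply: ge0_le_integral => //=; first by move=> u _; exact: ifb_ge0.
- exact: measurable_shifted.
- exact: emeasurable_funD.
- move=> u _; case: ifPn => [/le//|_]; by rewrite add0e lee_fin.
Qed.

(** Iterating the equations from the crude bound [Phi <= Psi + B] gives an error beta^n B. Only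
    heights at most 0 are compared, the killed kernel reading no others; equality follows by
    exchanging the roles. *)
Lemma killed_step_unique (w Phi Psi : 'I_m -> R -> \bar R) (B : R) :
  (forall q, measurable_fun setT (Phi q)) -> (forall q, measurable_fun setT (Psi q)) ->
  (forall q (z : R), 0 <= Phi q z) -> (forall q (z : R), 0 <= Psi q z) -> (0 <= B)%R ->
  (forall q (z : R), (z <= 0)%R -> Phi q z <= B%:E) ->
  (forall k (y : R), (y <= 0)%R -> Phi k y = killed_step k Phi y + w k y) ->
  (forall k (y : R), (y <= 0)%R -> Psi k y = killed_step k Psi y + w k y) ->
  forall k (y : R), (y <= 0)%R -> Phi k y <= Psi k y.
Proof.
move=> mPhi mPsi Phi0 Psi0 B0 PhiB PhiE PsiE.
have H n : forall k (y : R), (y <= 0)%R -> Phi k y <= Psi k y + (beta ^+ n * B)%:E.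
  elim: n => [|n IH] k y y0.
    by rewrite expr0 mul1r (le_trans (PhiB _ _ y0))// leeDr.
  rewrite PhiE// PsiE// exprS -mulrA -addeAC leeD2r//.
  by apply: killed_step_le => //; rewrite mulr_ge0// exprn_ge0.
move=> k y y0; apply/lee_addgt0Pr => e e0.
have [n lt] := geometric_small B e0.
by apply: (le_trans (H n k y y0)); rewrite leeD2l// lee_fin.
Qed.

End contraction.

Section ladder.
Context {R : realType} {m : nat}.
Variable M : 'I_m -> 'I_m -> {finite_measure set (R * R)%type -> \bar R}.
Variable K : 'I_m -> 'I_m -> {finite_measure set R -> \bar R}.
Variables (s : {posnum R}) (rho c : 'I_m -> {posnum R}) (a w : 'I_m -> R).
Local Open Scope ereal_scope.
Hypothesis a_lt0 : forall k, (a k < 0)%R.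
Hypothesis w_ge0 : forall k, (0 <= w k)%R.
Hypothesis stepM : forall k r (f : R * R -> \bar R), measurable_fun setT f ->
  (forall x, 0 <= f x) ->
  \int[M k r]_x f x =
  (s%:num / (rho k)%:num * (k == r)%:R)%:E * \int[expo (rho k)]_t f (0, a k * t)%R +
  \sum_q \int[K k q]_u \int[M q r]_x f (reflect_add u x).
Hypothesis massK : forall k, \sum_q K k q setT = (1 - s%:num / (rho k)%:num)%:E.
Hypothesis overshootK : forall k q (y : R) B, (y <= 0)%R -> measurable B ->
  K k q [set u | (0 < y + u)%R /\ B (y + u)%R] =
  ((k == q)%:R * (w k * expR ((c k)%:num * y) / ((rho k)%:num - (c k)%:num * a k)))%:E *
  expo (c k) B.
Hypothesis M_sup_ge0 : forall k r, M k r [set x | (x.1 < 0)%R] = 0.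
Hypothesis M_le_sup : forall k r, M k r [set x | (x.1 < x.2)%R] = 0.

(** Positive because the drift is negative. It is the rate of the exponential law into which the
    factor exp (c a t), due to drifting for a time t, tilts that of the first event. *)
Lemma rate_gt0 k : (0 < (rho k)%:num - (c k)%:num * a k)%R.
Proof. by rewrite subr_gt0 (lt_trans (_ : _ < 0)%R)// pmulr_rlt0. Qed.

Lemma eq_integralM k r (f g : R * R -> \bar R) :
  measurable_fun setT f -> measurable_fun setT g ->
  (forall x, 0 <= f x) -> (forall x, 0 <= g x) ->
  (forall x : R * R, (0 <= x.1)%R -> (x.2 <= x.1)%R -> f x = g x) ->
  \int[M k r]_x f x = \int[M k r]_x g x.
Proof.
move=> mf mg f0 g0 fg; apply: ge0_ae_eq_integral => //.
have m1 : measurable [set x : R * R | (x.1 < 0)%R].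
  rewrite -[X in measurable X]setTI; apply: (measurable_fun_ltr (f := fst)) => //.
have m2 : measurable [set x : R * R | (x.1 < x.2)%R].
  by rewrite -[X in measurable X]setTI; apply: (measurable_fun_ltr (f := fst) (g := snd)).
exists ([set x | (x.1 < 0)%R] `|` [set x | (x.1 < x.2)%R]); split.
- exact: measurableU.
- apply: eq_trans (M_sup_ge0 k r); apply: (measureU0 m1 m2); exact: M_le_sup.
- move=> x /= /not_implyP[_ nfg]; apply: contrapT => /not_orP[/negP n1 /negP n2].
  by apply: nfg; apply: fg; rewrite leNgt.
Qed.

Lemma measurable_translate : measurable_fun setT
  (fun z : R * (R * R) => (z.1 + z.2.1, z.1 + z.2.2)%R).
Proof.
apply: measurable_fun_pair => /=; apply: measurable_funD => //; exact: measurableT_comp.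
Qed.

Lemma integral_overshoot k q (F : R -> \bar R) (y : R) : (y <= 0)%R ->
  measurable_fun setT F -> (forall u, 0 <= F u) ->
  \int[K k q]_u (if (0 < y + u)%R then F (y + u)%R else 0) =
  ((k == q)%:R * (w k * expR ((c k)%:num * y) / ((rho k)%:num - (c k)%:num * a k)))%:E *
  \int[expo (c k)]_v F v.
Proof.
move=> y0 mF F0.
have my : measurable_fun setT (fun u : R => y + u)%R by exact: measurable_funD.
have mA : measurable [set u | (0 < y + u)%R].
  by rewrite -[X in measurable X]setTI; apply: (measurable_fun_ltr (f := cst 0%R)).
transitivity (\int[K k q]_(u in [set u | (0 < y + u)%R]) F (y + u)%R).
  rewrite [RHS]integral_mkcond; apply: eq_integral => u _.
  by rewrite patchE; have [y_u|y_u] := boolP (0 < y + u)%R;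
    [rewrite mem_set|rewrite memNset//; apply/negP].
rewrite -(ge0_integral_mrestr (K k q) mA (f := fun u => F (y + u)%R))//;
  last exact: measurableT_comp mF my.
rewrite -(ge0_integral_img (mrestr (K k q) mA) my)//.
have C0 : (0 <= (k == q)%:R * (w k * expR ((c k)%:num * y) /
  ((rho k)%:num - (c k)%:num * a k)))%R.
  by rewrite mulr_ge0// divr_ge0 ?(ltW (rate_gt0 k))// mulr_ge0// expR_ge0.
rewrite -[RHS](@ge0_integral_mscale _ _ _ _ setT _ (NngNum C0))//.
apply: eq_measure_integral => B mB _.
transitivity (K k q [set u | (0 < y + u)%R /\ B (y + u)%R]).
  by rewrite /= /img /pushforward /mrestr; congr (K k q _); apply/seteqP;
    split => u /= [].
by rewrite overshootK.
Qed.

Lemma contraction_rate : exists2 beta : R, (0 <= beta < 1)%R &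
  forall k, \sum_q K k q setT <= beta%:E.
Proof.
(* [S] exceeds all the rates, so that 1 - s / S bounds every mass; the maximum with 0 keeps the
   bound nonnegative in all cases. *)
pose S := (1 + \sum_i (rho i)%:num)%R.
have S0 : (0 < S)%R by rewrite ltr_pwDl// sumr_ge0.
exists (Num.max 0 (1 - s%:num / S))%R.
  by rewrite le_max lexx/= gt_max ltr01/= gtrBl divr_gt0.
move=> k; rewrite massK lee_fin le_max; apply/orP; right.
rewrite lerD2l lerN2 ler_pM2l// lef_pV2 ?posrE//.
by rewrite /S (bigD1 k)//= addrCA lerDl addr_ge0// sumr_ge0.
Qed.

(** Started from height [y]; at [y = 0] this is the expectation that enters [U]. *)
Definition atom0 k j (y : R) : \bar R :=
  \int[M k j]_x (if (y + x.1 <= 0)%R then (expR ((c j)%:num * (y + x.2)))%:E else 0).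

Lemma measurable_atom0_fun j : measurable_fun setT (fun z : R * (R * R) =>
  if (z.1 + z.2.1 <= 0)%R then (expR ((c j)%:num * (z.1 + z.2.2)))%:E else 0).
Proof.
have m1 : measurable_fun setT (fun z : R * (R * R) => z.1 + z.2.1)%R.
  by apply: measurable_funD => //; exact: measurableT_comp.
have m2 : measurable_fun setT (fun z : R * (R * R) => z.1 + z.2.2)%R.
  by apply: measurable_funD => //; exact: measurableT_comp.
apply: measurable_ifb; first exact: measurable_fun_ler.
by apply/measurable_EFinP; apply: measurableT_comp => //; apply: measurable_funM.
Qed.

Lemma atom0_fun_ge0 j (y : R) (x : R * R) :
  0 <= if (y + x.1 <= 0)%R then (expR ((c j)%:num * (y + x.2)))%:E else 0.
Proof. by apply: ifb_ge0 => _; rewrite lee_fin expR_ge0. Qed.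

Lemma measurable_atom0 k j : measurable_fun setT (atom0 k j).
Proof.
apply: (measurable_integral (M k j) (measurable_atom0_fun j)) => z; exact: atom0_fun_ge0.
Qed.

Lemma measurable_atom0_section j (y : R) : measurable_fun setT (fun x : R * R =>
  if (y + x.1 <= 0)%R then (expR ((c j)%:num * (y + x.2)))%:E else 0).
Proof. exact: measurableT_comp (measurable_atom0_fun j) (measurable_pair1 y). Qed.

Lemma atom0_ge0 k j y : 0 <= atom0 k j y.
Proof. by apply: integral_ge0 => x _; exact: atom0_fun_ge0. Qed.

Lemma atom0_gt0 k j (y : R) : (0 < y)%R -> atom0 k j y = 0.
Proof.
move=> y0; rewrite -(integral0 (M k j) setT); apply: eq_integralM => //.
- exact: measurable_atom0_section.
- by move=> x; exact: atom0_fun_ge0.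
- by move=> x x1 _; rewrite leNgt ltr_pwDl.
Qed.

Lemma atom0_le k j (y : R) : atom0 k j y <= M k j setT.
Proof.
rewrite -[leRHS]mul1e -integral_cst//.
have mle : measurable_fun setT (fun x : R * R => x.2 <= x.1)%R by exact:
  measurable_fun_ler.
have := @measurable_ifb _ _ R _ _ mle (measurable_atom0_section j y) => mif.
apply: (@le_trans _ _ (\int[M k j]_x (if (x.2 <= x.1)%R then
    (if (y + x.1 <= 0)%R then (expR ((c j)%:num * (y + x.2)))%:E else 0) else 0))).
  rewrite le_eqVlt; apply/orP; left; apply/eqP; apply: eq_integralM => //.
  - exact: measurable_atom0_section.
  - by move=> x; exact: atom0_fun_ge0.
  - by move=> x; apply: ifb_ge0 => _; exact: atom0_fun_ge0.
  - by move=> x _ ->.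
apply: ge0_le_integral => //.
- by move=> x _; apply: ifb_ge0 => _; exact: atom0_fun_ge0.
- move=> x _; case: ifPn => // x21; case: ifPn => // yx.
  rewrite lee_fin -expR0 ler_expR pmulr_rle0//; lra.
Qed.

(** Killing before any event contributes (s / rho) exp (c y) times the mean of exp (c a t) for t of
    rate rho, which [expo_tilt] computes. An event carrying the path above 0 contributes nothing. *)
Lemma atom0_step k j (y : R) : (y <= 0)%R ->
  atom0 k j y = killed_step K k (fun q => atom0 q j) y +
  ((k == j)%:R * (s%:num * expR ((c k)%:num * y) / ((rho k)%:num - (c k)%:num * a k)))%:E.
Proof.
move=> y0; rewrite {1}/atom0 stepM; last 2 first.
- exact: measurable_atom0_section.
- by move=> x; exact: atom0_fun_ge0.
rewrite addeC; congr (_ + _).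
  apply: eq_bigr => q _; apply: eq_integral => u _; rewrite /reflect_add/=.
  transitivity (atom0 q j (y + u)).
    apply: eq_integral => x _; rewrite addrA; congr (if _ then _ else _).
    by rewrite -lerBrDl ge_max sub0r oppr_ge0 y0/=; apply/idP/idP; lra.
  by case: ifPn => //; rewrite -ltNge; exact: atom0_gt0.
have [<-|kj] := eqVneq k j; last by rewrite mulr0 mul0e mul0r.
under eq_integral do rewrite /= addr0 y0 mulrDr expRD EFinM.
rewrite ge0_integralZl ?lee_fin ?expR_ge0//; last by apply/measurable_EFinP;
  apply: measurableT_comp => //; apply: measurable_funM.
have rE : (PosNum (rate_gt0 k))%:num%R = ((rho k)%:num + - ((c k)%:num * a k))%R by [].
have -> : \int[expo (rho k)]_x (expR ((c k)%:num * (a k * x)))%:E =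
    ((rho k)%:num / (PosNum (rate_gt0 k))%:num)%:E.
  rewrite -[RHS]mule1 -(@probability_setT _ _ _ (expo (PosNum (rate_gt0 k)))).
  rewrite -[RHS](expo_tilt rE (@measurableT _ R)).
  by apply: eq_integral => t _; rewrite opprK mulrA.
rewrite mulr1 mul1r -!EFinM; congr (_%:E).
have := rate_gt0 k; rewrite rE; set X := (_ - _)%R => X0.
by field; rewrite !gt_eqF.
Qed.

Section excursion.
Variables (r : 'I_m) (f : R * R -> \bar R).
Hypotheses (mf : measurable_fun setT f) (f0 : forall x, 0 <= f x)
  (f1 : forall x, f x <= 1).

(** Started from height [z], and restricted to the paths whose supremum is above 0. *)
Definition above q (z : R) : \bar R :=
  \int[M q r]_x (if (0 < z + x.1)%R then f (z + x.1, z + x.2)%R else 0).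

Lemma measurable_above_fun : measurable_fun setT (fun z : R * (R * R) =>
  if (0 < z.1 + z.2.1)%R then f (z.1 + z.2.1, z.1 + z.2.2)%R else 0).
Proof.
have m1 : measurable_fun setT (fun z : R * (R * R) => z.1 + z.2.1)%R.
  by apply: measurable_funD => //; exact: measurableT_comp.
apply: measurable_ifb; first exact: measurable_fun_ltr.
exact: measurableT_comp mf measurable_translate.
Qed.

Lemma above_fun_ge0 (y : R) (x : R * R) :
  0 <= if (0 < y + x.1)%R then f (y + x.1, y + x.2)%R else 0.
Proof. exact: ifb_ge0. Qed.

Lemma measurable_above_section (y : R) : measurable_fun setT (fun x : R * R =>
  if (0 < y + x.1)%R then f (y + x.1, y + x.2)%R else 0).
Proof. exact: measurableT_comp measurable_above_fun (measurable_pair1 y). Qed.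

Lemma measurable_above q : measurable_fun setT (above q).
Proof.
by apply: (measurable_integral (M q r) measurable_above_fun) => z; exact: above_fun_ge0.
Qed.

Lemma above_ge0 q y : 0 <= above q y.
Proof. by apply: integral_ge0 => x _; exact: above_fun_ge0. Qed.

Lemma above_le q y : above q y <= M q r setT.
Proof.
rewrite -[leRHS]mul1e -integral_cst//; apply: ge0_le_integral => //.
- by move=> x _; exact: above_fun_ge0.
- exact: measurable_above_section.
- by move=> x _; case: ifP.
Qed.

Definition entrance k : \bar R := \int[expo (c k)]_v above k v.

Lemma entrance_ge0 k : 0 <= entrance k.
Proof. by apply: integral_ge0 => v _; exact: above_ge0. Qed.

Lemma entrance_le k : entrance k <= M k r setT.
Proof.
rewrite -[leRHS]mule1 -(@probability_setT _ _ _ (expo (c k))) -integral_cst//.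
apply: ge0_le_integral => //.
- by move=> x _; exact: above_ge0.
- exact: measurable_above.
- by move=> x _; exact: above_le.
Qed.

(** From a start [u > 0] the supremum is above 0 in any case, so the restriction disappears. *)
Lemma entranceE k : entrance k =
  \int[expo (c k)]_u \int[M k r]_x f (u + x.1, u + x.2)%R.
Proof.
have mF : measurable_fun setT (fun u : R => \int[M k r]_x f (u + x.1, u + x.2)%R).
  apply: (measurable_integral (M k r) (measurableT_comp mf measurable_translate)) => z;
    exact: f0.
apply: eq_expo_integral_pos => //.
- exact: measurable_above.
- exact: above_ge0.
- by move=> u; exact: integral_ge0.
move=> u u0; apply: eq_integralM => //.
- exact: measurable_above_section.
- by apply: measurableT_comp mf _; exact: measurableT_comp measurable_translate
  (measurable_pair1 u).
- by move=> x; exact: above_fun_ge0.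
- by move=> x x1 _; rewrite ltr_wpDr.
Qed.

(** Killing before any event leaves the supremum at [y <= 0] and contributes nothing. An event
    landing above 0 does so in the same state and at an exponential height whose law does not depend
    on [y]; it contributes a multiple of [entrance k]. *)
Lemma above_step k (y : R) : (y <= 0)%R ->
  above k y = killed_step K k above y +
  (w k * expR ((c k)%:num * y) / ((rho k)%:num - (c k)%:num * a k))%:E * entrance k.
Proof.
move=> y0; rewrite {1}/above stepM; last 2 first.
- exact: measurable_above_section.
- by move=> x; exact: above_fun_ge0.
under eq_integral do rewrite /= addr0 ltNge y0.
rewrite integral0 mule0 add0e.
have -> : (w k * expR ((c k)%:num * y) / ((rho k)%:num - (c k)%:num * a k))%:E *
  entrance k =
   \sum_q \int[K k q]_u (if (0 < y + u)%R then above q (y + u)%R else 0).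
  rewrite (bigD1 k)//= big1 ?adde0.
    rewrite (integral_overshoot _ _ y0) ?eqxx ?mul1r//; first exact: measurable_above.
    exact: above_ge0.
  move=> q qk; rewrite (integral_overshoot _ _ y0)//; last 2 first.
  - exact: measurable_above.
  - exact: above_ge0.
  by rewrite eq_sym (negbTE qk) mul0r mul0e.
rewrite -big_split; apply: eq_bigr => q _ /=.
have my : measurable_fun setT (fun u : R => y + u)%R by exact: measurable_funD.
rewrite -ge0_integralD//; last 4 first.
- by move=> u _; apply: ifb_ge0 => _; exact: above_ge0.
- by apply: measurable_shifted; exact: measurable_above.
- by move=> u _; apply: ifb_ge0 => _; exact: above_ge0.
- apply: measurable_ifb; first exact: measurable_fun_ltr.
  exact: measurableT_comp (measurable_above q) my.
apply: eq_integral => u _; rewrite /reflect_add/=.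
transitivity (above q (y + u)).
  apply: eq_integral => x _; rewrite !addrA.
  have -> : (0 < y + Num.max 0 (u + x.1))%R = (0 < y + u + x.1)%R.
    by rewrite maxEle; case: ifPn => ux; apply/idP/idP; lra.
  case: ifPn => // yux; congr (f (_, _)); rewrite maxEle; case: ifPn => ux; lra.
by case: (leP (y + u)%R 0%R) => _; rewrite ?adde0 ?add0e.
Qed.

End excursion.

(* Starting from a level y <= 0, both sides solve the same equation for the
   kernel killed above 0, which is a strict contraction. *)
Theorem ladder k r (f : R * R -> \bar R) : measurable_fun setT f ->
  (forall x, 0 <= f x) -> (forall x, f x <= 1) ->
  \int[M k r]_x (if (0 < x.1)%R then f x else 0) =
  \sum_j (w j / s%:num)%:E * atom0 k j 0 *
    \int[expo (c j)]_u \int[M j r]_x f (u + x.1, u + x.2)%R.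
Proof.
move=> mf f0 f1.
(* In state j the source of [above] is w / s times the entrance value times the source of [atom0],
   whence these coefficients. *)
pose co j := (w j / s%:num)%:E * entrance r f j.
have co0 j : 0 <= co j by rewrite mule_ge0// ?lee_fin ?divr_ge0//; exact: entrance_ge0.
pose Psi q (z : R) := \sum_j co j * atom0 q j z.
suff E : above r f k 0 = Psi k 0%R.
  transitivity (above r f k 0).
    by apply: eq_integral => x _; rewrite !add0r; case: x.
  rewrite E; apply: eq_bigr => j _; rewrite /co entranceE// -!muleA; congr (_ * _).
  by rewrite muleC.
have mPsi q : measurable_fun setT (Psi q).
  apply: emeasurable_sum => j; apply: emeasurable_funM => //; exact: measurable_atom0.
have Psi0 q z : 0 <= Psi q z.
  by apply: sume_ge0 => j _; rewrite mule_ge0// atom0_ge0.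
have PsiE q (y : R) : (y <= 0)%R -> Psi q y = killed_step K q Psi y +
  (w q * expR ((c q)%:num * y) / ((rho q)%:num - (c q)%:num * a q))%:E * entrance r f q.
  move=> y0; rewrite /Psi.
  pose kill j := ((q == j)%:R * (s%:num * expR ((c q)%:num * y) /
    ((rho q)%:num - (c q)%:num * a q)))%R.
  have kill0 j : (0 <= kill j)%R.
    by rewrite mulr_ge0// divr_ge0 ?(ltW (rate_gt0 q))// mulr_ge0// expR_ge0.
  transitivity (\sum_j (co j * killed_step K q (fun i => atom0 i j) y + co j *
    (kill j)%:E)).
    apply: eq_bigr => j _; rewrite atom0_step// ge0_muleDr ?lee_fin//; last exact: kill0.
    by apply: sume_ge0 => i _; apply: integral_ge0 => u _; apply: ifb_ge0 => _;
      exact: atom0_ge0.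
  rewrite big_split/=; congr (_ + _).
    rewrite /killed_step; under eq_bigr => j _.
      rewrite ge0_sume_distrr; last first.
        by move=> i _; apply: integral_ge0 => u _; apply: ifb_ge0 => _; exact: atom0_ge0.
      over.
    rewrite exchange_big/=; apply: eq_bigr => i _.
    under eq_bigr => j _.
      rewrite -ge0_integralZl//; last 2 first.
      - by apply: measurable_shifted; exact: measurable_atom0.
      - by move=> u _; apply: ifb_ge0 => _; exact: atom0_ge0.
      over.
    rewrite -ge0_integral_sum//; last 2 first.
    - by move=> j; apply: emeasurable_funM => //; apply: measurable_shifted;
      exact: measurable_atom0.
    - by move=> j u _; rewrite mule_ge0//; apply: ifb_ge0 => _; exact: atom0_ge0.
    by apply: eq_integral => u _; case: ifPn => // _; rewrite big1// => j _;
      rewrite mule0.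
  rewrite (bigD1 q)//= big1 ?adde0; last first.
    by move=> j jq; rewrite /kill eq_sym (negbTE jq) mul0r mule0.
  rewrite /kill eqxx mul1r /co -muleA (muleC (entrance _ _ _)) muleA -EFinM;
    congr (_%:E * _).
  have := rate_gt0 q; set X := (_ - _)%R => X0.
  by field; rewrite (gt_eqF X0) gt_eqF.
have [B1 B10 aboveB] : exists2 B, (0 <= B)%R & forall q, M q r setT <= B%:E.
  by apply: finite_bound => q; [exact: fin_num_measure|exact: measure_ge0].
have cofin j : co j \is a fin_num.
  rewrite fin_numM// ge0_fin_numE ?entrance_ge0// (le_lt_trans
    (entrance_le _ mf f0 f1 _))//.
  by rewrite -ge0_fin_numE// fin_num_measure.
have [B2 B20 PsiB] : exists2 B, (0 <= B)%R & forall q, \sum_j co j * M q j setT <= B%:E.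
  apply: finite_bound => q; last by apply: sume_ge0 => j _; exact: mule_ge0.
  by apply/sum_fin_numP => j _ _; rewrite fin_numM// fin_num_measure.
have [beta /andP[beta0 beta1] massB] := contraction_rate.
have aboveB' q z : (z <= 0)%R -> above r f q z <= B1%:E.
  by move=> _; apply: le_trans (aboveB q); exact: above_le.
have PsiB' q z : (z <= 0)%R -> Psi q z <= B2%:E.
  move=> _; apply: le_trans (PsiB q); apply: lee_sum => j _.
  by rewrite lee_wpmul2l// atom0_le.
have mabove q : measurable_fun setT (above r f q) by exact: measurable_above.
have above0 q z : 0 <= above r f q z by exact: above_ge0.
have aboveE q (y : R) := @above_step r f mf f0 q y.
apply/eqP; rewrite eq_le; apply/andP; split.
  exact: (killed_step_unique beta0 beta1 massB mabove mPsi above0 Psi0 B10 aboveB'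
    aboveE PsiE).
exact: (killed_step_unique beta0 beta1 massB mPsi mabove Psi0 above0 B20 PsiB' PsiE
  aboveE).
Qed.

Lemma measurable_fst_le0 : measurable_fun setT (fun x : R * R => x.1 <= 0)%R.
Proof. exact: measurable_fun_ler. Qed.

(** This is the probability of being killed before any event. It will keep the row sums of [U] away
    from 1. *)
Lemma atom_ge k : (s%:num / (rho k)%:num)%:E <= M k k [set x | (x.1 <= 0)%R].
Proof.
have mA : measurable [set x : R * R | (x.1 <= 0)%R].
  by rewrite -[X in measurable X]setTI; apply: (measurable_fun_ler (f := fst)).
rewrite -(setIT [set x | _]) -integral_indic// stepM//; last by apply/measurable_EFinP;
  exact: measurable_indic.
have i1 t : (\1_[set x : R * R | x.1 <= 0] (0, a k * t) = 1 :> R)%R.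
  by rewrite indicE mem_set//=.
under eq_integral do rewrite i1.
rewrite (_ : \int[expo (rho k)]_t _ = 1); last first.
  by rewrite integral_cst// mul1e; exact: probability_setT.
rewrite mule1 eqxx mulr1 leeDl//.
by apply: sume_ge0 => q _; apply: integral_ge0 => u _; apply: integral_ge0 => x _;
  rewrite lee_fin.
Qed.

(* As the drift is negative, contact requires an event, so that its probability
   is contracted by [K]. *)
Lemma null_contact k r : M k r [set x | x.2 = x.1] = 0.
Proof.
pose f (x : R * R) : \bar R := if (x.2 == x.1)%R then 1 else 0.
have f0 x : 0 <= f x by exact: ifb_ge0.
have mf : measurable_fun setT f.
  by apply: measurable_ifb => //; exact: measurable_fun_eqr.
pose z q := \int[M q r]_x f x.
have mZ : measurable [set x : R * R | x.2 = x.1].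
  have := @measurable_fun_eqr _ _ R setT snd fst measurable_snd measurable_fst
    measurableT [set true] I.
  by rewrite setTI; congr measurable; apply/seteqP; split => x /= /eqP.
have zE q : z q = M q r [set x | x.2 = x.1].
  rewrite -(setIT [set x | _]) -integral_indic//; apply: eq_integral => x _.
  rewrite /f indicE; case: eqP => xx; first by rewrite mem_set.
  by rewrite memNset.
have z0 q : 0 <= z q by apply: integral_ge0.
have step q : z q <= \sum_i K q i setT * z i.
  rewrite /z stepM// (_ : \int[expo _]_t _ = 0) ?mule0 ?add0e.
    apply: lee_sum => i _; rewrite muleC -integral_cst//; apply: ge0_le_integral => //.
    - by move=> u _; exact: integral_ge0.
    - apply: (measurable_integral (M i r) (measurableT_comp mf measurable_reflect_add)).
      by move=> ?; exact: f0.
    move=> u _.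
    have mfu : measurable_fun setT (fun x => f (reflect_add u x)).
      exact: measurableT_comp (measurableT_comp mf measurable_reflect_add)
        (measurable_pair1 u).
    have mle : measurable_fun setT (fun x : R * R => x.2 <= x.1)%R by exact:
      measurable_fun_ler.
    rewrite (@eq_integralM i r _ (fun x => if (x.2 <= x.1)%R then f (reflect_add u x)
      else 0))//.
    - apply: ge0_le_integral => //; first by move=> x _; exact: ifb_ge0.
        exact: measurable_ifb.
      (* Contact after the event forces u + x.2 = max 0 (u + x.1) >= u + x.1, hence contact of the
         regenerated path, whose value does not exceed its supremum. *)
      move=> x _; case: ifPn => // x21; rewrite /f /reflect_add/=.
      case: eqP => // ux; case: eqP => // -[]; apply/eqP.
      by rewrite eq_le x21 -(lerD2l u) ux le_max lexx orbT.
    - exact: measurable_ifb.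
    - by move=> x; exact: ifb_ge0.
    - by move=> x _ ->.
  rewrite (@eq_expo_integral_pos _ _ _ (cst 0))//; first exact: integral0.
    apply: measurableT_comp mf _; apply: measurable_fun_pair => //.
  by move=> t t0; rewrite /f/= lt_eqF// pmulr_llt0.
have [B B0 zB] : exists2 B, (0 <= B)%R & forall q, z q <= B%:E.
  by apply: finite_bound => // q; rewrite zE; exact: fin_num_measure.
have [beta /andP[beta0 beta1] massB] := contraction_rate.
have H n q : z q <= (beta ^+ n * B)%:E.
  elim: n q => [|n IH] q; first by rewrite expr0 mul1r.
  apply: (le_trans (step q)).
  apply: (@le_trans _ _ (\sum_i K q i setT * (beta ^+ n * B)%:E)).
    by apply: lee_sum => i _; rewrite lee_wpmul2l.
  have Bn : 0 <= (beta ^+ n * B)%:E by rewrite lee_fin mulr_ge0// exprn_ge0.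
  rewrite -ge0_sume_distrl; last by move=> i _; exact: measure_ge0.
  by rewrite exprS -mulrA [leRHS]EFinM lee_wpmul2r.
apply/eqP; rewrite eq_le measure_ge0 andbT -zE; apply/lee_addgt0Pr => e e0.
rewrite add0e; have [n lt] := geometric_small beta0 beta1 B e0.
by apply: (le_trans (H n k)); rewrite lee_fin.
Qed.

End ladder.

(** * Integrals of bounded functions *)

Section bounded_measurable.
Context d (T : measurableType d) (R : realType).
Implicit Types (g h : T -> R) (mu : {finite_measure set T -> \bar R}).

Definition bm g := measurable_fun setT g /\ exists B : R, forall x, `|g x| <= B.

Lemma bm_cst (r : R) : bm (fun=> r).
Proof. by split => //; exists `|r|. Qed.

Lemma bmD g h : bm g -> bm h -> bm (fun x => g x + h x).
Proof.
move=> [mg [B gB]] [mh [C hC]]; split; first exact: measurable_funD.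
by exists (B + C) => x; rewrite (le_trans (ler_normD _ _))// lerD.
Qed.

Lemma bmM g h : bm g -> bm h -> bm (fun x => g x * h x).
Proof.
move=> [mg [B gB]] [mh [C hC]]; split; first exact: measurable_funM.
by exists (B * C) => x; rewrite normrM ler_pM.
Qed.

Lemma bmN g : bm g -> bm (fun x => - g x).
Proof.
move=> [mg [B gB]]; split; first exact: measurable_funN.
by exists B => x; rewrite normrN.
Qed.

Lemma bmB g h : bm g -> bm h -> bm (fun x => g x - h x).
Proof. by move=> ? ?; apply: bmD => //; exact: bmN. Qed.

Lemma bm_ifb (b : T -> bool) g h : measurable_fun setT b -> bm g -> bm h ->
  bm (fun x => if b x then g x else h x).
Proof.
move=> mb [mg [B gB]] [mh [C hC]]; split; first exact: measurable_fun_ifT.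
exists (Num.max B C) => x; rewrite le_max.
by case: ifP => _; rewrite ?gB ?hC ?orbT.
Qed.

Lemma bm_integrable mu D g : measurable D -> bm g -> mu.-integrable D (EFin \o g).
Proof.
move=> mD [mg [B gB]]; apply: measurable_bounded_integrable => //.
- by rewrite -ge0_fin_numE// fin_num_measure.
- exact: measurable_funTS.
- exists B; split; first exact: num_real.
  move=> M BM x _ /=; exact: le_trans (gB x) (ltW BM).
Qed.

(** Reduces statements on bounded functions to functions with values in [0, 1], to which the
    extended-real versions apply. The function is scaled into [-1, 1] and then moved to [0, 1]. *)
Lemma bm_affine g : bm g -> exists h (a b : R),
  [/\ measurable_fun setT h, forall x, 0 <= h x <= 1 & g = fun x => a * h x + b].
Proof.
move=> [mg [B gB]].
pose C := `|B| + 1; have C0 : 0 < C by rewrite ltr_wpDl.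
exists (fun x => (C^-1 * g x + 1) / 2), (2 * C), (- C); split.
- apply: measurable_funM => //; apply: measurable_funD => //.
  exact: measurable_funM.
- move=> x; have : `|C^-1 * g x| <= 1.
    rewrite normrM gtr0_norm ?invr_gt0// mulrC ler_pdivrMr// mul1r.
    by rewrite (le_trans (gB x))// (le_trans (ler_norm B))// lerDl.
  by rewrite ler_norml; lra.
- by apply/funext => x; field; rewrite gt_eqF.
Qed.

Lemma Rint_affine mu h (a b : R) : bm h ->
  \int[mu]_x (a * h x + b) = a * \int[mu]_x h x + b * fine (mu setT).
Proof.
move=> bh; rewrite RintegralD//; last 2 first.
- exact/bm_integrable/bmM/bh/bm_cst.
- exact/bm_integrable/bm_cst.
rewrite RintegralZl//; last exact: bm_integrable.
by rewrite Rintegral_cst.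
Qed.

Lemma bm01 h : measurable_fun setT h -> (forall x, 0 <= h x <= 1) -> bm h.
Proof.
by move=> mh h01; split => //; exists 1 => x; have /andP[? ?] := h01 x; rewrite ger0_norm.
Qed.

Lemma EFin_Rintegral mu g : bm g -> (\int[mu]_x g x)%:E = (\int[mu]_x (g x)%:E)%E.
Proof.
by move=> bg; rewrite /Rintegral fineK//; apply: integrable_fin_num => //;
  exact: bm_integrable.
Qed.

Lemma norm_Rintegral_le mu g (B : R) : bm g -> (forall x, `|g x| <= B) ->
  `|\int[mu]_x g x| <= B * fine (mu setT).
Proof.
move=> bg gB; apply: le_trans (le_normr_Rintegral _ _) _ => //;
  first exact: bm_integrable.
rewrite -Rintegral_cst//; apply: le_Rintegral => //.
- apply: bm_integrable => //; split; last by exists B => x; rewrite normr_id.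
  by apply: measurableT_comp => //; case: bg.
- exact/bm_integrable/bm_cst.
Qed.

End bounded_measurable.

Lemma bm_comp d1 d2 (T1 : measurableType d1) (T2 : measurableType d2) (R : realType)
    (g : T2 -> R) (f : T1 -> T2) : measurable_fun setT f -> bm g -> bm (fun x => g (f x)).
Proof.
move=> mf [mg [B gB]]; split; first exact: measurableT_comp mg mf.
by exists B.
Qed.

Section bounded_product.
Context d1 d2 (T1 : measurableType d1) (T2 : measurableType d2) (R : realType).
Variables (m1 : {finite_measure set T1 -> \bar R}) (m2 : {finite_measure set T2 -> \bar
  R}).

Lemma bm_Rintegral (g : T1 * T2 -> R) : bm g -> bm (fun x => \int[m2]_y g (x, y)).
Proof.
move=> bg; have [h [a [b [mh h01 gE]]]] := bm_affine bg.
have bhx x : bm (fun y => h (x, y)) by apply: bm_comp (bm01 mh h01).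
have -> : (fun x => \int[m2]_y g (x, y)) =
    fun x => a * (\int[m2]_y h (x, y)) + b * fine (m2 setT).
  by apply/funext => x; rewrite -Rint_affine// gE.
apply: bmD; last exact: bm_cst.
apply: bmM; first exact: bm_cst.
split.
  apply/measurable_EFinP.
  rewrite (_ : _ \o _ = fun x => \int[m2]_y (h (x, y))%:E)%E; last first.
    by apply/funext => x /=; rewrite EFin_Rintegral.
  apply: (measurable_integral m2 (f := fun z => (h z)%:E)); first exact/measurable_EFinP.
  by move=> z; rewrite lee_fin; case/andP: (h01 z).
exists (1 * fine (m2 setT)) => x; apply: norm_Rintegral_le => // y.
by have /andP[? ?] := h01 (x, y); rewrite ger0_norm.
Qed.

Lemma Rintegral_prodm (g : T1 * T2 -> R) : bm g ->
  \int[prodm m1 m2]_z g z = \int[m1]_x \int[m2]_y g (x, y).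
Proof.
move=> bg; have [h [a [b [mh h01 gE]]]] := bm_affine bg.
have bh := bm01 mh h01.
have bhx x : bm (fun y => h (x, y)) by apply: bm_comp bh.
rewrite gE Rint_affine//.
under [RHS]eq_Rintegral => x _.
  rewrite Rint_affine//.
  over.
rewrite Rint_affine; last exact: bm_Rintegral.
congr (_ * _ + _).
  congr fine; rewrite ge0_integral_prodm; last 2 first.
  - exact/measurable_EFinP.
  - by move=> z; rewrite lee_fin; case/andP: (h01 z).
  by apply: eq_integral => x _; rewrite EFin_Rintegral.
rewrite -mulrA -fineM ?fin_num_measure// muleC; congr (_ * fine _).
by rewrite -setXTT; exact: prodmE.
Qed.

End bounded_product.

Lemma Rintegral_img d1 d2 (T1 : measurableType d1) (T2 : measurableType d2) (R : realType)
    (mu : {measure set T1 -> \bar R}) (f : T1 -> T2) (mf : measurable_fun setT f)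
      (g : T2 -> R) :
  measurable_fun setT g -> \int[img mu mf]_y g y = \int[mu]_x g (f x).
Proof.
move=> mg; congr fine; rewrite integralE [RHS]integralE.
have mgE : measurable_fun setT (fun x => (g x)%:E) by exact/measurable_EFinP.
rewrite (ge0_integral_img mu mf (measurable_funepos mgE) (funepos_ge0 _)).
rewrite (ge0_integral_img mu mf (measurable_funeneg mgE) (funeneg_ge0 _)).
by congr (_ - _)%E; apply: eq_integral => x _; rewrite ?funeposE ?funenegE.
Qed.

Section real_ladder.
Context {R : realType} {m : nat}.
Variable M : 'I_m -> 'I_m -> {finite_measure set (R * R)%type -> \bar R}.
Variables (c : 'I_m -> {posnum R}) (U : 'I_m -> 'I_m -> R).
Hypothesis ladderM : forall k r (f : R * R -> \bar R), measurable_fun setT f ->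
  (forall x, 0 <= f x)%E -> (forall x, f x <= 1)%E ->
  (\int[M k r]_x (if (0 < x.1)%R then f x else 0) =
   \sum_j (U k j)%:E * \int[expo (c j)]_u \int[M j r]_x f (u + x.1, u + x.2)%R)%E.

Lemma bm_translate (g : R * R -> R) : bm g ->
  bm (fun z : R * (R * R) => g (z.1 + z.2.1, z.1 + z.2.2)).
Proof. by move=> bg; exact: bm_comp measurable_translate bg. Qed.

Lemma bm_translate_section (g : R * R -> R) u : bm g ->
  bm (fun x : R * R => g (u + x.1, u + x.2)).
Proof. by move=> bg; exact: bm_comp (measurable_pair1 u) (bm_translate bg). Qed.

Lemma measurable_fst_gt0 : measurable_fun setT (fun x : R * R => 0 < x.1).
Proof. exact: measurable_fun_ltr. Qed.

Lemma bm_fst_gt0 (g : R * R -> R) : bm g -> bm (fun x : R * R => if 0 < x.1 then g x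
  else 0).
Proof.
by move=> bg; apply: bm_ifb => //; [exact: measurable_fst_gt0|exact: bm_cst].
Qed.

(** Both sides are linear in the function, and the identity holds for values in [0, 1] and for the
    constant 1; [bm_affine] gives the rest. *)
Lemma real_ladder k r (g : R * R -> R) : bm g ->
  \int[M k r]_x (if 0 < x.1 then g x else 0) =
  \sum_j U k j * \int[expo (c j)]_u \int[M j r]_x g (u + x.1, u + x.2).
Proof.
have H (h : R * R -> R) : measurable_fun setT h -> (forall x, 0 <= h x <= 1) ->
  \int[M k r]_x (if 0 < x.1 then h x else 0) =
  \sum_j U k j * \int[expo (c j)]_u \int[M j r]_x h (u + x.1, u + x.2).
  move=> mh h01; have bh := bm01 mh h01.
  apply: EFin_inj; rewrite EFin_Rintegral; last first.
    exact: bm_fst_gt0.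
  rewrite -sumEFin; transitivity (\int[M k r]_x (if (0 < x.1)%R then (h x)%:E else 0))%E.
    by apply: eq_integral => x _; case: ifP.
  rewrite (ladderM k r (f := EFin \o h)).
  - apply: eq_bigr => j _; rewrite EFinM; congr (_ * _)%E.
    rewrite EFin_Rintegral; last exact: bm_Rintegral (bm_translate bh).
    apply: eq_integral => u _; rewrite EFin_Rintegral//.
    exact: bm_translate_section.
  - exact/measurable_EFinP.
  - by move=> x; rewrite lee_fin; case/andP: (h01 x).
  - by move=> x; rewrite lee_fin; case/andP: (h01 x).
move=> bg; have [h [a [b [mh h01 ->]]]] := bm_affine bg; have bh := bm01 mh h01.
pose i1 (x : R * R) : R := if 0 < x.1 then 1 else 0.
have b1 : bm i1 by apply: (bm_fst_gt0 (g := fun=> 1)); exact: bm_cst.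
have bi : bm (fun x : R * R => if 0 < x.1 then h x else 0).
  exact: bm_fst_gt0.
transitivity (a * \int[M k r]_x (if 0 < x.1 then h x else 0) + b * \int[M k r]_x i1 x).
  rewrite -RintegralZl//; last exact: bm_integrable.
  rewrite -RintegralZl//; last exact: bm_integrable.
  rewrite -RintegralD//; last 2 first.
  - exact/bm_integrable/bmM/bi/bm_cst.
  - exact/bm_integrable/bmM/b1/bm_cst.
  by apply: eq_Rintegral => x _; rewrite /i1; case: ifP => _;
    rewrite ?mulr1 ?mulr0 ?addr0.
rewrite H// (H (fun=> 1))//; last by move=> x; rewrite ler01 lexx.
rewrite !mulr_sumr -big_split/=; apply: eq_bigr => j _.
under [X in _ = U k j * X]eq_Rintegral => u _.
  rewrite Rint_affine; last exact: bm_translate_section.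
  over.
rewrite Rint_affine; last exact: bm_Rintegral (bm_translate bh).
have e1 : fine (expo (c j) setT) = 1 by rewrite (@probability_setT _ _ _ (expo (c j))).
have -> : \int[expo (c j)]_u \int[M j r]_x 1 = fine (M j r setT).
  by rewrite !Rintegral_cst// e1 mulr1 mul1r.
rewrite [X in _ = _ * (_ + _ * X)](_ : _ = 1)//; ring.
Qed.

End real_ladder.

(** * Fourier transforms *)

Section exponential_transform.
Context {R : realType} (c : {posnum R}).
Local Notation leb := (@lebesgue_measure R).

Lemma expo_integral_itv (f : R -> \bar R) :
  measurable_fun setT f -> (forall x, 0 <= f x)%E ->
  (\int[expo c]_x f x =
   \int[leb]_(x in `[0%R, +oo[) ((c%:num * expR (- c%:num * x))%:E * f x))%E.
Proof.
move=> mf f0; rewrite (expo_integral c mf f0) [RHS]integral_mkcond.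
apply: eq_integral => x _; rewrite patchE /exponential_pdf patchE.
by case: ifPn => _; rewrite ?mule0// muleC.
Qed.

Variables (alpha phi : R).
Let den := c%:num ^+ 2 + alpha ^+ 2.
Let A := c%:num ^+ 2 / den.
Let B := c%:num * alpha / den.
Let F (x : R) : R := - (expR (- c%:num * x) * (1 + A * cos (alpha * x + phi) - B * sin
  (alpha * x + phi))).
Let f (x : R) : R := c%:num * expR (- c%:num * x) * (1 + cos (alpha * x + phi)).

Let den_gt0 : 0 < den.
Proof. by rewrite ltr_wpDr ?sqr_ge0// exprn_gt0. Qed.

Let dF (x : R) : is_derive x (1 : R) F (f x).
Proof.
rewrite /F; apply: is_derive_eq.
rewrite /f /A /B /GRing.scale/=; have := den_gt0; rewrite /den => d0.
field; exact: lt0r_neq0.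
Qed.

Let f_ge0 x : 0 <= f x.
Proof.
have := cos_geN1 (alpha * x + phi); rewrite /f => ?.
by apply: mulr_ge0; [rewrite mulr_ge0// expR_ge0|lra].
Qed.

Let cf : continuous f.
Proof.
move=> x; apply: differentiable_continuous; apply/derivable1_diffP.
rewrite /f; exact: ex_derive.
Qed.

Let F_infty : F x @[x --> +oo] --> (0 : R).
Proof.
pose K := 1 + `|A| + `|B|.
have cvgK (L : R) : L * expR (- c%:num * x) @[x --> +oo] --> (0 : R).
  rewrite -(mulr0 L); apply: cvgMr.
  rewrite (_ : (fun x => _) = (fun z => expR (- z)) \o (fun z => c%:num * z)); last first.
    by apply/funext => x /=; rewrite mulNr.
  by apply: (@cvg_comp _ _ _ _ _ _ (pinfty_nbhs R)); [exact: gt0_cvgMry|exact: cvgr_expR].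
apply: (@squeeze_cvgr _ _ _ _ (fun x => - K * expR (- c%:num * x))
  (fun x => K * expR (- c%:num * x))) => //.
apply: nearW => x; rewrite mulNr -ler_norml /F normrN normrM gtr0_norm ?expR_gt0//.
rewrite mulrC ler_pM2r ?expR_gt0//.
have cos1 (t : R) : `|cos t| <= 1 by rewrite ler_norml cos_geN1 cos_le1.
have sin1 (t : R) : `|sin t| <= 1 by rewrite ler_norml sin_geN1 sin_le1.
rewrite (le_trans (ler_normB _ _))// lerD//; last by rewrite normrM ler_piMr.
by rewrite (le_trans (ler_normD _ _))// normr1 lerD2l normrM ler_piMr.
Qed.

Lemma bm_cos : bm (fun u : R => cos (alpha * u + phi)).
Proof.
split; last by exists 1 => u; rewrite ler_norml cos_geN1 cos_le1.
apply: measurableT_comp; last exact: measurable_funD.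
by apply: continuous_measurable_fun; exact: continuous_cos.
Qed.

(** The constant 1 makes the integrand nonnegative, as the fundamental theorem on a half-line
    requires. [A] and [B] are the real and imaginary parts of c / (c - i alpha), and the phase
    serves to obtain cosine and sine together. *)
Lemma expo_1pcos : \int[expo c]_u (1 + cos (alpha * u + phi)) =
  1 + A * cos phi - B * sin phi.
Proof.
rewrite /Rintegral expo_integral_itv.
- under eq_integral => x _.
    rewrite -EFinM -[X in X%:E]/(f x).
    over.
  rewrite (@ge0_continuous_FTC2y _ f F 0 0).
  + by rewrite -EFinB [LHS]sub0r opprK !mulr0 expR0 add0r mul1r.
  + by move=> x _.
  + exact: continuous_subspaceT.
  + exact: F_infty.
  + by move=> x _; exact: ex_derive.
  + apply: cvg_at_right_filter; apply: differentiable_continuous; apply/derivable1_diffP.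
    exact: ex_derive.
  + by move=> x _; rewrite derive1E; exact: derive_val.
- by apply/measurable_EFinP; apply: measurable_funD => //; case: bm_cos.
- by move=> x; rewrite lee_fin; have := cos_geN1 (alpha * x + phi); lra.
Qed.

Lemma expo_cos_phase : \int[expo c]_u cos (alpha * u + phi) = A * cos phi - B * sin phi.
Proof.
have := expo_1pcos; rewrite RintegralD//; last 2 first.
- exact/bm_integrable/bm_cst.
- exact/bm_integrable/bm_cos.
rewrite Rintegral_cst// (_ : fine (expo c setT) = 1) ?mulr1; first by lra.
by rewrite (@probability_setT _ _ _ (expo c)).
Qed.

End exponential_transform.

Section exponential_cos_sin.
Context {R : realType} (c : {posnum R}) (alpha : R).

Lemma expo_cos : \int[expo c]_u cos (alpha * u) = c%:num ^+ 2 /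
  (c%:num ^+ 2 + alpha ^+ 2).
Proof.
have := expo_cos_phase c alpha 0; rewrite cos0 sin0 mulr0 subr0 mulr1 => <-.
by apply: eq_Rintegral => u _; rewrite addr0.
Qed.

Lemma sin_cos_phase (u : R) : sin u = cos (u + - (pi / 2)).
Proof. by rewrite cosB cos_pihalf sin_pihalf mulr0 mulr1 add0r. Qed.

Lemma expo_sin : \int[expo c]_u sin (alpha * u) = c%:num * alpha /
  (c%:num ^+ 2 + alpha ^+ 2).
Proof.
have := expo_cos_phase c alpha (- (pi / 2)).
rewrite cosN sinN cos_pihalf sin_pihalf mulr0 mulrN mulr1 sub0r opprK => <-.
by apply: eq_Rintegral => u _; exact: sin_cos_phase.
Qed.

End exponential_cos_sin.

Lemma bm_cosl {R : realType} (alpha : R) : bm (fun u : R => cos (alpha * u)).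
Proof.
by have := bm_cos alpha 0; congr bm; apply/funext => u; rewrite addr0.
Qed.

Lemma bm_sinl {R : realType} (alpha : R) : bm (fun u : R => sin (alpha * u)).
Proof.
by have := bm_cos alpha (- (pi / 2)); congr bm; apply/funext => u;
  rewrite [RHS]sin_cos_phase.
Qed.

Section Rintegral_fubini.
Context d1 d2 (T1 : measurableType d1) (T2 : measurableType d2) (R : realType).
Variables (m1 : {finite_measure set T1 -> \bar R}) (m2 : {finite_measure set T2 -> \bar
  R}).

Lemma Rintegral_swap (g : T1 * T2 -> R) : bm g ->
  \int[m1]_x \int[m2]_y g (x, y) = \int[m2]_y \int[m1]_x g (x, y).
Proof.
move=> bg; have [h [a [b [mh h01 gE]]]] := bm_affine bg.
have bh := bm01 mh h01.
have bhs : bm (fun z : T2 * T1 => h (z.2, z.1)).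
  apply: (bm_comp (f := fun z : T2 * T1 => (z.2, z.1)) _ bh).
  by apply: measurable_fun_pair.
have bhx x : bm (fun y : T2 => h (x, y)) by apply: bm_comp bh.
have bhy y : bm (fun x : T1 => h (x, y)) by apply: (bm_comp (f := fun x => (x, y)) _ bh).
rewrite gE; under eq_Rintegral => x _ do rewrite Rint_affine//.
under [RHS]eq_Rintegral => y _ do rewrite Rint_affine//.
rewrite Rint_affine; last exact: bm_Rintegral bh.
rewrite Rint_affine; last exact: bm_Rintegral bhs.
rewrite -!mulrA (mulrC (fine _)); congr (_ * _ + _).
apply: EFin_inj; rewrite EFin_Rintegral; last exact: bm_Rintegral bh.
rewrite EFin_Rintegral; last exact: bm_Rintegral bhs.
under eq_integral => x _ do rewrite EFin_Rintegral//.
under [RHS]eq_integral => y _ do rewrite EFin_Rintegral//.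
apply: (fubini_tonelli (fun z => (h z)%:E)); first exact/measurable_EFinP.
by move=> z; rewrite lee_fin; case/andP: (h01 z).
Qed.

End Rintegral_fubini.

Lemma nbhs_infty_gerS {R : realType} (r : R) : \forall n \near \oo, r <= n.+1%:R.
Proof.
near=> n; apply: (@le_trans _ _ n%:R); last by rewrite ler_nat.
by near: n; apply: nbhs_infty_ger.
Unshelve. all: by end_near. Qed.

(** * Uniqueness of the Fourier-Stieltjes transform *)

Section fourier_uniqueness.
Context {R : realType}.
Local Notation leb := (@lebesgue_measure R).

(* Averaging the transform over an exponential time yields the integral of the
   Poisson kernel. *)
Lemma smoothed_transform (mu : {finite_measure set R -> \bar R}) (c : {posnum R})
  (x : R) :
  \int[mu]_y (c%:num ^+ 2 / (c%:num ^+ 2 + (y - x) ^+ 2)) =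
  \int[expo c]_t (cos (x * t) * \int[mu]_y cos (t * y) + sin (x * t) * \int[mu]_y sin
    (t * y)).
Proof.
have bg : bm (fun z : R * R => cos ((z.1 - x) * z.2)).
  have mz : measurable_fun setT (fun z : R * R => (z.1 - x) * z.2).
    by apply: measurable_funM => //; apply: measurable_funB.
  have := bm_comp mz (bm_cosl 1).
  by congr bm; apply/funext => z; rewrite mul1r.
under eq_Rintegral => y _ do rewrite -(expo_cos c (y - x)).
rewrite (Rintegral_swap mu (expo c) bg)/=; apply: eq_Rintegral => t _.
rewrite -RintegralZl//; last by apply: bm_integrable => //; exact: bm_cosl.
rewrite -RintegralZl//; last by apply: bm_integrable => //; exact: bm_sinl.
rewrite -RintegralD//; last 2 first.
- by apply: bm_integrable => //; apply: bmM; [exact: bm_cst|exact: bm_cosl].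
- by apply: bm_integrable => //; apply: bmM; [exact: bm_cst|exact: bm_sinl].
apply: eq_Rintegral => y _; rewrite mulrBl cosB (mulrC y t).
by rewrite (mulrC (cos _)) (mulrC (sin _)).
Qed.

Let lorentz (l u : R) := l / (1 + u ^+ 2).

Let continuous_lorentz l : continuous (lorentz l).
Proof.
move=> u; apply: cvgM; first exact: cvg_cst.
have c2 : continuous (fun z : R => 1 + z ^+ 2).
  by move=> z; apply: differentiable_continuous; apply/derivable1_diffP; exact: ex_derive.
by apply: cvgV; [rewrite gt_eqF// ltr_pwDl// sqr_ge0|exact: c2].
Qed.

(** The Cauchy density centred at [y] with scale 1 / l, up to the factor pi. *)
Let kernel (l x y : R) := lorentz l (l * (x - y)).

Lemma integral_kernel (l : {posnum R}) (p y : R) :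
  (\int[leb]_(x in `[p, +oo[) (kernel l%:num x y)%:E =
   (pi / 2 - atan (l%:num * (p - y)))%:E)%E.
Proof.
pose F (x : R) : R := atan (l%:num * (x - y)).
have dF (x : R) : is_derive x (1 : R) F (kernel l%:num x y).
  rewrite /F; apply: is_derive_eq; rewrite /kernel /lorentz /GRing.scale/=.
  by rewrite subr0 mulr1 mulrC.
have den0 (x : R) : 0 < 1 + (l%:num * (x - y)) ^+ 2 by rewrite ltr_pwDl// sqr_ge0.
have caff : continuous (fun z : R => l%:num * (z - y)).
  by move=> z; apply: differentiable_continuous; apply/derivable1_diffP; exact: ex_derive.
rewrite (@ge0_continuous_FTC2y _ (kernel l%:num ^~ y) F p (pi / 2)).
- by [].
- by move=> x _; rewrite /kernel /lorentz divr_ge0// ltW.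
- apply: continuous_subspaceT => x.
  apply: (@continuous_comp _ _ _ (fun z : R => l%:num * (z - y)) (lorentz l%:num)).
    exact: caff.
  exact: continuous_lorentz.
- apply: (@cvg_comp _ _ _ (fun x : R => l%:num * (x - y)) (@atan R) _ (pinfty_nbhs R));
  last exact: cvgy_atan.
  apply/cvgryPge => A; near=> x; rewrite -ler_pdivrMl// lerBrDr.
  near: x; apply: nbhs_pinfty_ge; exact: num_real.
- by move=> x _; exact: ex_derive.
- apply: cvg_at_right_filter; apply: differentiable_continuous; apply/derivable1_diffP.
  exact: ex_derive.
- by move=> x _; rewrite derive1E; exact: derive_val.
Unshelve. all: by end_near. Qed.

Variables m1 m2 : {finite_measure set R -> \bar R}.
Hypothesis eq_cos : forall t, \int[m1]_y cos (t * y) = \int[m2]_y cos (t * y).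
Hypothesis eq_sin : forall t, \int[m1]_y sin (t * y) = \int[m2]_y sin (t * y).

Let measurable_kernel (l : R) : measurable_fun setT (fun z : R * R => kernel l z.2 z.1).
Proof.
apply: (measurableT_comp (continuous_measurable_fun (continuous_lorentz (l := l)))).
by apply: measurable_funM => //; apply: measurable_funB.
Qed.

(** The mass that the Cauchy law centred at [y] with scale 1 / l gives to the ray from [p]: a smooth
    substitute for the indicator of y > p. *)
Let ray_weight (l : {posnum R}) (p y : R) := (pi / 2 - atan (l%:num * (p - y))) / pi.

Let ray_weight01 l p y : 0 <= ray_weight l p y <= 1.
Proof.
have pi0 := @pi_gt0 R; rewrite /ray_weight.
have := atan_gtNpi2 (l%:num * (p - y)); have := atan_ltpi2 (l%:num * (p - y)) => lt gt.
by rewrite divr_ge0 ?(ltW pi0)//=; [rewrite ler_pdivrMr// mul1r; lra|lra].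
Qed.

Let bm_ray_weight l p : bm (ray_weight l p).
Proof.
apply: bm01; last by move=> y; exact: ray_weight01.
apply: measurable_funM => //; apply: measurable_funB => //.
apply: measurableT_comp.
  by apply: continuous_measurable_fun => x; exact: continuous_atan.
by apply: measurable_funM => //; apply: measurable_funB.
Qed.

(** By Tonelli the integral is that, over x >= p, of the smoothed measure at x. [smoothed_transform]
    with c = 1 / l expresses the latter through cosine and sine transforms, on which the two
    measures agree. *)
Let eq_ray_weight (l : {posnum R}) (p : R) :
  \int[m1]_y ray_weight l p y = \int[m2]_y ray_weight l p y.
Proof.
pose K (z : R * R) := (if (p <= z.2)%R then (kernel l%:num z.2 z.1)%:E else 0)%E.
have K0 z : (0 <= K z)%E.
  by apply: ifb_ge0 => _; rewrite lee_fin divr_ge0// ltW// ltr_pwDl// sqr_ge0.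
have mK : measurable_fun setT K.
  apply: measurable_ifb; first exact: measurable_fun_ler.
  by apply/measurable_EFinP; exact: measurable_kernel.
have H (mu : {finite_measure set R -> \bar R}) :
    (\int[mu]_y ray_weight l p y)%:E =
    (pi^-1%:E * \int[leb]_x \int[mu]_y K (y, x))%E.
  rewrite -(fubini_tonelli (m1 := mu) (m2 := leb) K mK K0) EFin_Rintegral//.
  rewrite -ge0_integralZl ?lee_fin ?invr_ge0 ?pi_ge0//; last 2 first.
  - by apply: (measurable_fun_fubini_tonelli_F (m2 := leb) K mK K0).
  - by move=> y _; exact: integral_ge0.
  apply: eq_integral => y _; rewrite /ray_weight mulrC EFinM -integral_kernel;
    congr (_ * _)%E.
  rewrite integral_mkcond; apply: eq_integral => x _; rewrite patchE /K/=.
  by rewrite mem_setE in_itv/= andbT.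
apply: EFin_inj; rewrite !H; congr (_ * _)%E; apply: eq_integral => x _.
rewrite /K/= !integral_ifb; case: ifP => // px.
have l0 : 0 < l%:num^-1 by rewrite invr_gt0.
pose c := PosNum l0.
have E y : kernel l%:num x y = l%:num * (c%:num ^+ 2 / (c%:num ^+ 2 + (y - x) ^+ 2)).
  have : 0 < 1 + (l%:num * (x - y)) ^+ 2 by rewrite ltr_pwDl// sqr_ge0.
  rewrite /kernel /lorentz /c/= => d0.
  have -> : l%:num^-1 ^+ 2 + (y - x) ^+ 2 = l%:num^-1 ^+ 2 *
    (1 + (l%:num * (x - y)) ^+ 2).
    by field.
  by rewrite invfM (mulrA (_ ^+ 2)) divff ?mul1r// expf_neq0// gt_eqF.
have bk : bm (fun y : R => c%:num ^+ 2 / (c%:num ^+ 2 + (y - x) ^+ 2)).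
  apply: bm01 => [|y].
    rewrite (_ : (fun y => _) = (fun y => l%:num^-1 * kernel l%:num x y)); last first.
      by apply/funext => y; rewrite E mulKf.
    apply: measurable_funM => //; exact: measurableT_comp (measurable_kernel _)
      (measurable_pair2 x).
  have d0 : 0 < c%:num ^+ 2 + (y - x) ^+ 2 by rewrite ltr_wpDr ?sqr_ge0.
  by rewrite divr_ge0 ?(ltW d0)//= ler_pdivrMr// mul1r lerDl sqr_ge0.
have {}H (mu : {finite_measure set R -> \bar R}) : (\int[mu]_y (kernel l%:num x y)%:E =
    (l%:num * \int[mu]_y (c%:num ^+ 2 / (c%:num ^+ 2 + (y - x) ^+ 2)))%:E)%E.
  rewrite -RintegralZl//; last exact: bm_integrable.
  rewrite EFin_Rintegral; last by apply: bmM => //; exact: bm_cst.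
  by apply: eq_integral => y _; rewrite E.
rewrite !H !smoothed_transform; congr (_ * _)%:E; apply: eq_Rintegral => t _.
by rewrite eq_cos eq_sin.
Qed.

Theorem fourier_unique A : measurable A -> m1 A = m2 A.
Proof.
apply: eq_measure_ray => [|b].
  by rewrite -ge0_fin_numE// fin_num_measure.
(* With l = (n + 1)^2 and p = b + 1 / (n + 1), the argument l (p - y) tends to -oo for y > b and to
   +oo for y <= b. At y = b it equals n + 1, so the limit is the indicator of the open ray even if
   [b] carries an atom. *)
pose l (n : nat) : {posnum R} := PosNum (exprn_gt0 2 (ltr0Sn R n)).
pose p (n : nat) : R := b + n.+1%:R^-1.
pose ray (y : R) : R := \1_(`]b, +oo[%classic) y.
have argE n (y : R) : (l n)%:num * (p n - y) = n.+1%:R * (1 - n.+1%:R * (y - b)).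
  have : n.+1%:R != 0 :> R by rewrite pnatr_eq0.
  by rewrite /l /p/=; set X := _%:R => X0; field.
have cvgw y : ray_weight (l n) (p n) y @[n --> \oo] --> ray y.
  have -> : ray y = (pi / 2 - (if b < y then - (pi / 2) else pi / 2)) / pi.
    rewrite /ray indicE mem_setE in_itv/= andbT; have /gt_eqF p0 := @pi_gt0 R.
    by case: ifP => _; [rewrite opprK -splitr divff ?p0|rewrite subrr mul0r].
  apply: cvgMl; apply: cvgB; first exact: cvg_cst.
  case: ifPn => by_.
    rewrite [X in X @ _](_ : _ = fun n => - atan (- ((l n)%:num * (p n - y))));
      last first.
      by apply/funext => n; rewrite atanN opprK.
    apply: cvgN; apply: (@cvg_comp _ _ _ (fun n => - ((l n)%:num * (p n - y)))
      (@atan R) _ (pinfty_nbhs R)); last exact: cvgy_atan.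
    apply/cvgryPge => B; near=> n; rewrite argE -mulrN opprB.
    have n0 : 0 <= n.+1%:R :> R by [].
    have yb : 0 < y - b by rewrite subr_gt0.
    have n2 : 1 <= n.+1%:R * (y - b) - 1.
      rewrite lerBrDr -ler_pdivrMr//; near: n.
      exact: nbhs_infty_gerS.
    apply: (@le_trans _ _ n.+1%:R); last by rewrite ler_peMr.
    near: n; exact: nbhs_infty_gerS.
  apply: (@cvg_comp _ _ _ (fun n => ((l n)%:num * (p n - y))) (@atan R) _
    (pinfty_nbhs R)); last exact: cvgy_atan.
  apply/cvgryPge => B; near=> n; rewrite argE.
  apply: (@le_trans _ _ n.+1%:R); first by near: n; exact: nbhs_infty_gerS.
  by rewrite ler_peMr// lerDl oppr_ge0 pmulr_rle0// subr_le0 leNgt.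
have H (mu : {finite_measure set R -> \bar R}) :
    (\int[mu]_y ray_weight (l n) (p n) y)%:E @[n --> \oo] --> mu `]b, +oo[%classic.
  rewrite -(setIT `]b, +oo[%classic) -integral_indic//.
  rewrite [X in X @ _](_ : _ = fun n => \int[mu]_y (ray_weight (l n) (p n) y)%:E)%E;
    last first.
    by apply/funext => n; rewrite EFin_Rintegral.
  have [] := @dominated_convergence _ _ _ mu setT measurableT
    (fun n y => (ray_weight (l n) (p n) y)%:E) (fun y => (ray y)%:E) (cst 1%E) => //.
  - by move=> n; apply/measurable_EFinP; case: (bm_ray_weight (l n) (p n)).
  - by apply/measurable_EFinP; exact: measurable_indic.
  - by apply: aeW => y _; apply/fine_cvgP; split; [exact: nearW|exact: cvgw].
  - by apply: (bm_integrable mu measurableT (g := cst 1%R)); exact: bm_cst.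
  - apply: aeW => y n _; rewrite lee_fin.
    by have /andP[? ?] := ray_weight01 (l n) (p n) y; rewrite ger0_norm.
have := H m1; have := H m2; under eq_fun do rewrite -eq_ray_weight.
by move=> h2 h1; exact: cvg_unique h1 h2.
Unshelve. all: by end_near. Qed.

End fourier_uniqueness.

Section mix_integral.
Context d (T : measurableType d) (R : realType).
Variables (a b : {nonneg R}) (m1 m2 : {finite_measure set T -> \bar R}).

Lemma bm_patch (g : T -> R) D : measurable D -> bm g -> bm (g \_ D).
Proof.
move=> mD [mg [B gB]]; split.
  by apply/(measurable_restrictT _ mD); exact: measurable_funTS.
exists B => x; rewrite patchE; case: ifP => // _.
by rewrite normr0 (le_trans _ (gB x)).
Qed.

Lemma Rintegral_mixT (g : T -> R) : bm g ->
  \int[mix a b m1 m2]_x g x = a%:num * \int[m1]_x g x + b%:num * \int[m2]_x g x.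
Proof.
move=> bg; have [h [r [q [mh h01 ->]]]] := bm_affine bg; have bh := bm01 mh h01.
have H : \int[mix a b m1 m2]_x h x = a%:num * \int[m1]_x h x + b%:num * \int[m2]_x h x.
  apply: EFin_inj; rewrite EFinD !EFinM !EFin_Rintegral// ge0_integral_mix//.
    exact/measurable_EFinP.
  by move=> z; rewrite lee_fin; case/andP: (h01 z).
have HT : fine (mix a b m1 m2 setT) = a%:num * fine (m1 setT) + b%:num * fine (m2 setT).
  by rewrite mixE fineD ?fin_numM ?fin_num_measure// !fineM ?fin_num_measure.
by rewrite !Rint_affine// H [X in _ + _ * X]HT; ring.
Qed.

Lemma Rintegral_mix (g : T -> R) D : measurable D -> bm g ->
  \int[mix a b m1 m2]_(x in D) g x =
  a%:num * \int[m1]_(x in D) g x + b%:num * \int[m2]_(x in D) g x.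
Proof.
by move=> mD bg; rewrite !(Rintegral_mkcond _ D) Rintegral_mixT//; exact: bm_patch.
Qed.

End mix_integral.

Section projection.
Context {R : realType}.

(** Differences of measures are turned into sums by moving the negative parts across, so that
    uniqueness applies to [f + g'] and [f' + g]. *)
Lemma fourier_diff_unique (f g f' g' : {finite_measure set R -> \bar R}) :
  (forall alpha, fourier f setT alpha - fourier g setT alpha =
                 fourier f' setT alpha - fourier g' setT alpha) ->
  forall D alpha, measurable D ->
    fourier f D alpha - fourier g D alpha = fourier f' D alpha - fourier g' D alpha.
Proof.
move=> E D alpha mD.
pose u : {nonneg R} := NngNum ler01.
pose m1 : {finite_measure set R -> \bar R} := mix u u f g'.
pose m2 : {finite_measure set R -> \bar R} := mix u u f' g.
have m12 A : measurable A -> m1 A = m2 A.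
  apply: fourier_unique => t; rewrite !Rintegral_mixT ?mul1r; try exact: bm_cosl;
    try exact: bm_sinl.
    by have [+ _] := E t; lra.
  by have [_ +] := E t; lra.
have I (h : R -> R) : bm h -> \int[f]_(x in D) h x - \int[g]_(x in D) h x =
    \int[f']_(x in D) h x - \int[g']_(x in D) h x.
  move=> bh.
  have : \int[m1]_(x in D) h x = \int[m2]_(x in D) h x.
    by congr fine; apply: eq_measure_integral => A mA _; exact: m12.
  by rewrite !Rintegral_mix//= !mul1r; lra.
have Ic := I _ (bm_cosl alpha); have Is := I _ (bm_sinl alpha).
by apply/eqP; rewrite eq_complex/= /fourier/=; apply/andP; split; apply/eqP.
Qed.

Lemma neg_partE m (F : R -> 'M[R[i]]_m) (f g : 'I_m -> 'I_m ->
  {finite_measure set R -> \bar R}) :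
  (forall alpha, F alpha = fourier_mx f g setT alpha) ->
  forall alpha, neg_part F alpha = fourier_mx f g `]-oo, 0[%classic alpha.
Proof.
move=> FE alpha.
rewrite /neg_part; case: xgetP => [Psi _ [f' [g' [FE' ->]]]|/(_ (fourier_mx f g `]-oo,
  0[))[]]; last first.
  by exists f, g.
apply/matrixP => k r; rewrite !mxE; apply: fourier_diff_unique => // beta.
have := FE beta; rewrite FE' => /matrixP/(_ k r); rewrite !mxE.
exact.
Qed.

End projection.

(** * The matrix exponential *)

Section matrix_exponential.
Context {R : realType} {m : nat}.
Implicit Types (A B P : 'M[R]_m).

(** Coefficients of an entry of P exp (x B). The left factor makes the family stable under
    differentiation, which replaces [P] by [P *m B]. *)
Definition expmx_coef P B i j n : R := n`!%:R^-1 * (P *m B ^+ n) i j.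

Lemma norm_mulmx_exp P B i j n :
  `|(P *m B ^+ n) i j| <= (\sum_k `|P i k|) * (\sum_k \sum_l `|B k l|) ^+ n.
Proof.
have M0 : 0 <= \sum_k `|P i k| by apply: sumr_ge0.
elim: n j => [|n IH] j.
  by rewrite !expr0 mulr1 mulmx1 (bigD1 j)//= lerDl sumr_ge0.
rewrite exprSr mulmxA mxE (le_trans (ler_norm_sum _ _ _))// exprSr mulrA.
rewrite [in leRHS]mulr_sumr; apply: ler_sum => k _.
rewrite normrM ler_pM//.
by rewrite (bigD1 j)//= lerDl sumr_ge0.
Qed.

Lemma is_cvg_expmx_coef P B i j (x : R) : cvgn (pseries (expmx_coef P B i j) x).
Proof.
apply: normed_cvg.
set M := \sum_k `|P i k|; set N := \sum_k \sum_l `|B k l|.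
have M0 : 0 <= M by apply: sumr_ge0.
have N0 : 0 <= N by apply: sumr_ge0 => k _; exact: sumr_ge0.
apply: (@series_le_cvg _ _ (M *: exp_coeff (N * `|x|))).
- by move=> n /=.
- by move=> n; rewrite mulr_ge0// divr_ge0// exprn_ge0// mulr_ge0.
- move=> n; rewrite /expmx_coef /= !normrM normrX.
  rewrite ger0_norm ?invr_ge0//.
  have := norm_mulmx_exp P B i j n; rewrite -/M -/N => le.
  have f0 : 0 <= (n`!%:R^-1 : R) by rewrite invr_ge0.
  rewrite [leRHS](_ : _ = n`!%:R^-1 * (M * N ^+ n) * `|x| ^+ n); last first.
    rewrite -[LHS]/(M * ((N * `|x|) ^+ n / n`!%:R)) exprMn; ring.
  by rewrite ler_wpM2r ?exprn_ge0// ler_wpM2l.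
- exact/is_cvg_seriesZ/is_cvg_series_exp_coeff.
Qed.

Definition expmx_fun P B i j (x : R) : R := limn (pseries (expmx_coef P B i j) x).

Lemma is_derive_expmx_fun P B i j (x : R) :
  is_derive x (1 : R) (expmx_fun P B i j) (expmx_fun (P *m B) B i j x).
Proof.
have diffE Q : pseries_diffs (expmx_coef Q B i j) = expmx_coef (Q *m B) B i j.
  apply/funext => n; rewrite /pseries_diffs /expmx_coef factS natrM invfM.
  by rewrite -!mulrA mulVKf ?pnatr_eq0// exprS mulmxA.
have := @pseries_snd_diffs R (expmx_coef P B i j) (`|x| + 1) x.
rewrite !diffE => H; apply: H; try exact: is_cvg_expmx_coef.
by rewrite [ltRHS]ger0_norm ?addr_ge0// ltrDl.
Qed.

Lemma expmx_funE P B i j x : expmx_fun P B i j x = \sum_k P i k * expmx_fun 1%:M B k j x.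
Proof.
rewrite /expmx_fun; apply/cvg_lim => //.
rewrite (_ : pseries _ _ = fun n => \sum_k P i k * pseries (expmx_coef 1%:M B k j) x n).
  apply: cvg_big => [|k _]; first exact: add_continuous.
  apply: cvgMr; exact: is_cvg_expmx_coef.
apply/funext => n; rewrite /pseries /series/=.
under [RHS]eq_bigr do rewrite mulr_sumr; rewrite exchange_big/=; apply: eq_bigr => l _.
rewrite /expmx_coef mxE mulr_sumr mulr_suml; apply: eq_bigr => k _.
by rewrite mul1mx; ring.
Qed.

Lemma exprmxZ (x : R) B n : (x *: B) ^+ n = x ^+ n *: B ^+ n.
Proof.
elim: n => [|n IH]; first by rewrite !expr0 scale1r.
transitivity ((x *: B) *m (x ^+ n *: B ^+ n)); first by rewrite exprS IH.
by rewrite -scalemxAl -scalemxAr scalerA !exprS.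
Qed.

Lemma expmx_scale B i j x : expmx (x *: B) i j = expmx_fun 1%:M B i j x.
Proof.
rewrite mxE; congr (limn (series _)); apply/funext => n.
by rewrite /expmx_coef /= mul1mx exprmxZ !mxE; ring.
Qed.

Lemma expmx_fun_mul P B i j x : expmx_fun P B i j x = (P *m expmx (x *: B)) i j.
Proof. by rewrite expmx_funE mxE; apply: eq_bigr => k _; rewrite expmx_scale. Qed.

Lemma is_derive_mul_expmx P B i j (x : R) :
  is_derive x (1 : R) (fun y => (P *m expmx (y *: B)) i j) ((P *m B *m expmx (x *: B))
    i j).
Proof.
rewrite (_ : (fun y => _) = expmx_fun P B i j); last by apply/funext => y;
  rewrite expmx_fun_mul.
by rewrite -expmx_fun_mul; exact: is_derive_expmx_fun.
Qed.

Lemma expmx0 : expmx (0 : 'M[R]_m) = 1%:M.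
Proof.
apply/matrixP => i j; rewrite mxE; apply/cvg_lim => //.
rewrite -(cvg_shiftS (series _)); apply: cvg_near_cst; apply: nearW => n.
rewrite /series/= big_nat_recl//= big1 ?addr0.
  by rewrite fact0 invr1 scale1r expr0.
by move=> k _; rewrite expr0n/= scaler0 mxE.
Qed.

Lemma expmx_diag (v : 'I_m -> R) : expmx (diag_mx (\row_k v k)) = diag_mx
  (\row_k expR (v k)).
Proof.
have pow n : diag_mx (\row_k v k) ^+ n = diag_mx (\row_k v k ^+ n).
  elim: n => [|n IH]; first by apply/matrixP => i j; rewrite !mxE expr0.
  transitivity (diag_mx (\row_k v k) *m diag_mx (\row_k v k ^+ n));
    first by rewrite exprS IH.
  by rewrite mulmx_diag; congr diag_mx; apply/rowP => k; rewrite !mxE exprS.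
apply/matrixP => i j; rewrite [RHS]mxE mxE [in RHS]mxE.
under eq_fun do rewrite pow mxE [in X in _ * X]mxE [in X in _ * X]mxE.
have [_|ij] := eqVneq i j.
  rewrite mulr1n /expR; congr (limn (series _)); apply/funext => n.
  by rewrite mulr1n mulrC.
rewrite mulr0n; apply/cvg_lim => //; apply: cvg_near_cst; apply: nearW => n.
by rewrite /series/= big1// => k _; rewrite mulr0n mulr0.
Qed.

End matrix_exponential.

(** * The first event of an almost upper semi-continuous process *)

Section first_event_kernel.
Local Open Scope ereal_scope.
Context {R : realType} {m : nat} (D : map_data R m).
Context d (T : measurableType d) (W : driver T R m) (o : 'I_m).
Variables (s : R) (P : 'I_m -> probability T R) (theta : {mfun T >-> R}).
Hypothesis chainD : irreducible_chain D.
Hypothesis uscD : almost_upper_semicontinuous D.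
Hypothesis drift_lt0 : forall k, (drift D k < 0)%R.
Hypothesis drivenD : driven D W s P theta.
Variables (nuP lamP cP : 'I_m -> {posnum R}) (sP : {posnum R}).
Hypothesis nuPE : forall k, (nuP k)%:num = nu D k.
Hypothesis lamPE : forall k, (lamP k)%:num = lam D k.
Hypothesis cPE : forall k, (cP k)%:num = crate D k.
Hypothesis sPE : sP%:num = s.
Variable rho : 'I_m -> {posnum R}.
Hypothesis rhoE : forall k, (rho k)%:num = (sP%:num + ((nuP k)%:num + (lamP k)%:num))%R.

Local Notation M := (mu (W := W) o drift_lt0 drivenD).

Lemma jump_weight_ge0 k q : (0 <= (k == q)%:R * ((lamP k)%:num / (rho k)%:num))%R.
Proof. by rewrite mulr_ge0. Qed.

Lemma trans_weight_ge0 k q : (0 <= (nuP k)%:num / (rho k)%:num * trans D k q)%R.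
Proof. by case: chainD => _ p0 _ _; rewrite mulr_ge0. Qed.

(** All first events other than killing; the jump part carries the Kronecker symbol because it does
    not change the state. *)
Definition first_kernel k q : {finite_measure set R -> \bar R} :=
  mix (NngNum (jump_weight_ge0 k q)) (NngNum (trans_weight_ge0 k q))
    (kapJ D rho k) (kapT D rho k q).

Lemma step_first_kernel k r (f : R * R -> \bar R) : measurable_fun setT f ->
  (forall x, 0 <= f x) ->
  \int[M k r]_x f x =
  (sP%:num / (rho k)%:num * (k == r)%:R)%:E * \int[expo (rho k)]_t f
    (0, drift D k * t)%R +
  \sum_q \int[first_kernel k q]_u \int[M q r]_x f (reflect_add u x).
Proof.
move=> mf f0; rewrite (one_step o chainD drift_lt0 drivenD nuPE lamPE sPE rhoE k r mf f0).
congr (_ + _).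
have mI q : measurable_fun setT (fun u => \int[M q r]_x f (reflect_add u x)).
  apply: (measurable_integral (M q r) (measurableT_comp mf measurable_reflect_add)).
  by move=> z; exact: f0.
have I0 q u : 0 <= \int[M q r]_x f (reflect_add u x) by exact: integral_ge0.
under [RHS]eq_bigr => q _ do rewrite (ge0_integral_mix _ _ _ _ (mI q) (I0 q)).
rewrite big_split/=; congr (_ + _).
rewrite (bigD1 k)//= eqxx mul1r big1 ?adde0//.
by move=> q qk; rewrite eq_sym (negbTE qk) mul0r mul0e.
Qed.

Lemma kapJT k : kapJ D rho k setT = 1.
Proof.
rewrite /kapJ/= /img /pushforward preimage_setT -setXTT prodmE//.
by rewrite [X in X * _](_ : _ = 1) ?mul1e; exact: probability_setT.
Qed.

Lemma kapTT k q : kapT D rho k q setT = 1.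
Proof.
rewrite /kapT/= /img /pushforward preimage_setT -setXTT prodmE//.
by rewrite [X in X * _](_ : _ = 1) ?mul1e; exact: probability_setT.
Qed.

Lemma first_kernelT k q : first_kernel k q setT =
  ((k == q)%:R * ((lamP k)%:num / (rho k)%:num) + (nuP k)%:num / (rho k)%:num * trans D
    k q)%:E.
Proof. by rewrite /first_kernel/= mixE kapJT kapTT !mule1. Qed.

Lemma first_kernel_mass k :
  \sum_q first_kernel k q setT = (1 - sP%:num / (rho k)%:num)%:E.
Proof.
under eq_bigr do rewrite first_kernelT.
rewrite sumEFin big_split/= -mulr_sumr; case: chainD => _ _ -> _.
rewrite (bigD1 k)//= eqxx mul1r big1; last first.
  by move=> q qk; rewrite eq_sym (negbTE qk) mul0r.
congr (_%:E).
have -> : ((lamP k)%:num = (rho k)%:num - sP%:num - (nuP k)%:num)%R by rewrite rhoE; ring.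
by field.
Qed.

Definition pos_rate k : R := lam D k * fine (jump_law D k `]0%R, +oo[%classic).

Lemma pos_rate_ge0 k : (0 <= pos_rate k)%R.
Proof. by rewrite mulr_ge0 -?lamPE// fine_ge0. Qed.

Lemma K0_positive k q (B : set R) : measurable B -> B `<=` `]0%R, +oo[%classic ->
  K0 D k q B = ((k == q)%:R * pos_rate k)%:E * expo (cP q) B.
Proof.
move=> mB B0; case: uscD => _ _ _ ->//.
rewrite (_ : (_ *m _) k q = (k == q)%:R * pos_rate k * (cP q)%:num)%R; last first.
  rewrite /Lmx /Fbar0 /Cmx !mulmx_diag !mxE cPE.
  by case: eqVneq => [->|_]; rewrite ?mulr1n ?mulr0n ?mul1r ?mul0r.
have -> : expo (cP q) B = \int[lebesgue_measure]_(z in B) ((cP q)%:num * expR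
  (- crate D q * z))%:E.
  apply: eq_integral => z; rewrite inE => /B0; rewrite /= in_itv/= andbT => z0.
  by rewrite /exponential_pdf patchE mem_set ?cPE//= in_itv/= ltW.
rewrite -ge0_integralZl//.
- by apply: eq_integral => z _; rewrite -EFinM mulrA.
- apply/measurable_funTS/measurable_EFinP; apply: measurable_funM => //.
  by apply: measurableT_comp => //.
- by rewrite lee_fin mulr_ge0// pos_rate_ge0.
Qed.

Lemma measurable_law_section k (Q : probability R R) A : measurable A ->
  measurable_fun setT (fun t : R => Q [set z | A (drift D k * t + z)%R]).
Proof.
move=> mA.
have mP := measurable_disp (drift D k) measurableT mA; rewrite setTI in mP.
have := measurable_fun_xsection Q mP.
by apply: eq_measurable_fun => t _; congr (Q _); apply/seteqP; split => z /=;
  rewrite /xsection/= inE.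
Qed.

Lemma measurable_K0_section k q A : measurable A ->
  measurable_fun setT (fun t : R => K0 D k q [set z | A (drift D k * t + z)%R]).
Proof.
move=> mA; apply: emeasurable_funD.
  by apply: measurable_funeM; exact: measurable_law_section.
case: (k == q); last exact: measurable_cst.
by apply: measurable_funeM; exact: measurable_law_section.
Qed.

(** The hypothesis on positive jumps concerns jumps and transitions together, through [K0]; the
    kernel is rewritten so that it can be applied. *)
Lemma first_kernelE k q A : measurable A -> first_kernel k q A =
  ((rho k)%:num^-1)%:E * \int[expo (rho k)]_t K0 D k q [set z | A (drift D k * t + z)%R].
Proof.
move=> mA.
have mS (t : R) : measurable [set z : R | A (drift D k * t + z)%R].
  have mf : measurable_fun setT (fun z : R => drift D k * t + z)%R by exact:
    measurable_funD.
  by have := mf measurableT _ mA; rewrite setTI.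
have mI (Q : probability R R) := measurable_law_section k Q mA.
have secE (Q : probability R R) :
    img (prodm (expo (rho k)) Q) (measurable_disp (drift D k)) A =
    \int[expo (rho k)]_t Q [set z | A (drift D k * t + z)%R].
  rewrite /img /pushforward prodm_xsection; apply: eq_integral => t _; congr (Q _).
  by apply/seteqP; split => z /=; rewrite /xsection/= inE.
have p0 : (0 <= nu D k * trans D k q)%R.
  by case: chainD => _ p0 _ _; rewrite mulr_ge0// -nuPE.
have l0 : (0 <= (k == q)%:R * lam D k)%R by rewrite mulr_ge0// -lamPE.
pose IJ := \int[expo (rho k)]_t jump_law D k [set z | A (drift D k * t + z)%R].
pose IT := \int[expo (rho k)]_t chi_law D k q [set z | A (drift D k * t + z)%R].
have IJ0 : 0 <= IJ by exact: integral_ge0.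
have IT0 : 0 <= IT by exact: integral_ge0.
have -> : \int[expo (rho k)]_t K0 D k q [set z | A (drift D k * t + z)%R] =
    (nu D k * trans D k q)%:E * IT + ((k == q)%:R * lam D k)%:E * IJ.
  rewrite -!ge0_integralZl// -ge0_integralD//; last 4 first.
  - by move=> t _; rewrite mule_ge0.
  - by apply: measurable_funeM; exact: mI.
  - by move=> t _; rewrite mule_ge0.
  - by apply: measurable_funeM; exact: mI.
  apply: eq_integral => t _; rewrite /K0; congr (_ + _).
  by case: eqP => _; rewrite ?mul1r ?mul0r ?mul0e.
transitivity (((k == q)%:R * ((lamP k)%:num / (rho k)%:num))%:E * IJ +
    ((nuP k)%:num / (rho k)%:num * trans D k q)%:E * IT).
  by rewrite [LHS]mixE; congr (_ * _ + _ * _); exact: secE.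
clearbody IJ IT; rewrite [RHS]ge0_muleDr ?mule_ge0// [RHS]addeC 2![in RHS]muleA -!EFinM
  -nuPE -lamPE.
by congr (_%:E * _ + _%:E * _); field.
Qed.

(** At the time t of the event the drift has lowered the height to v = y + a t <= 0. Memorylessness
    of the positive part of [K0] gives the weight exp (c v) and an exponential overshoot; averaging
    over t is again a tilt. *)
Lemma first_kernel_overshoot k q (y : R) B : (y <= 0)%R -> measurable B ->
  first_kernel k q [set u | (0 < y + u)%R /\ B (y + u)%R] =
  ((k == q)%:R * (pos_rate k * expR ((cP k)%:num * y) /
     ((rho k)%:num - (cP k)%:num * drift D k)))%:E * expo (cP k) B.
Proof.
move=> y0 mB.
have my : measurable_fun setT (fun u : R => y + u)%R by exact: measurable_funD.
have mA : measurable [set u | (0 < y + u)%R /\ B (y + u)%R].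
  have := my measurableT _ (measurableI _ _ (measurable_itv `]0%R, +oo[) mB).
  by rewrite setTI; congr measurable; apply/seteqP; split => u /=; rewrite in_itv/= andbT.
rewrite first_kernelE//.
pose e t := (expR ((cP k)%:num * (y + drift D k * t)))%:E : \bar R.
have me : measurable_fun setT e.
  apply/measurable_EFinP; apply: measurableT_comp => //.
  by apply: measurable_funM => //; apply: measurable_funD.
have e0 t : 0 <= e t by rewrite lee_fin expR_ge0.
have K0E (t : R) : (0 <= t)%R ->
    K0 D k q [set z | (0 < y + (drift D k * t + z))%R /\ B (y + (drift D k * t + z))%R] =
    ((k == q)%:R * pos_rate k)%:E * (e t * expo (cP k) B).
  move=> t0; set v := (y + drift D k * t)%R.
  have v0 : (v <= 0)%R by rewrite /v -oppr_ge0 opprD addr_ge0 ?oppr_ge0// nmulr_rle0.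
  have mv : measurable_fun setT (fun u : R => v + u)%R by exact: measurable_funD.
  rewrite K0_positive.
  - case: (eqVneq k q) => [<-|_]; last by rewrite !mul0r !mul0e.
    congr (_ * _); have v0' : (0 <= - v)%R by rewrite oppr_ge0.
    transitivity (expo (cP k) [set u | (- v < u)%R /\ B (u - - v)%R]).
      congr (expo _ _); apply/seteqP; split => z /=.
        have -> : (y + (drift D k * t + z) = z - - v)%R by rewrite /v; ring.
        by move=> [zv Bz]; split => //; lra.
      have -> : (y + (drift D k * t + z) = z - - v)%R by rewrite /v; ring.
      by move=> [zv Bz]; split => //; lra.
    apply: eq_trans (expo_memoryless (cP k) v0' mB) _; congr (_%:E * _).
    by rewrite mulNr mulrN opprK.
  - have := mv measurableT _ (measurableI _ _ (measurable_itv `]0%R, +oo[) mB).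
    rewrite setTI; congr measurable; apply/seteqP; split => u /=.
      by rewrite in_itv/= andbT addrA.
    by rewrite in_itv/= andbT addrA.
  - by move=> z /= [vz _]; rewrite in_itv/= andbT; rewrite addrA -/v in vz; lra.
have -> : \int[expo (rho k)]_t K0 D k q [set z | (0 < y + (drift D k * t + z))%R /\
      B (y + (drift D k * t + z))%R] =
    \int[expo (rho k)]_t (((k == q)%:R * pos_rate k)%:E * (e t * expo (cP k) B)).
  apply: eq_expo_integral.
  - exact: measurable_K0_section mA.
  - by apply: measurable_funeM; apply: emeasurable_funM.
  - move=> t; rewrite /K0; apply: adde_ge0.
      by rewrite mule_ge0// lee_fin mulr_ge0//; [rewrite -nuPE|case: chainD].
    by case: eqP => // _; rewrite mule_ge0// lee_fin -lamPE.
  - by move=> t; apply: mule_ge0; [rewrite lee_fin mulr_ge0// pos_rate_ge0|exact: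
    mule_ge0].
  - exact: K0E.
have rg : (0 < (rho k)%:num - (cP k)%:num * drift D k)%R.
  by rewrite subr_gt0 (lt_trans (_ : _ < 0)%R)// pmulr_rlt0.
have rE : (PosNum rg)%:num%R = ((rho k)%:num + - ((cP k)%:num * drift D k))%R by [].
have eI : \int[expo (rho k)]_t e t =
    (expR ((cP k)%:num * y) * ((rho k)%:num / ((rho k)%:num - (cP k)%:num * drift D
      k)))%:E.
  transitivity ((expR ((cP k)%:num * y))%:E *
      \int[expo (rho k)]_t (expR (- - ((cP k)%:num * drift D k) * t))%:E).
    rewrite -ge0_integralZl ?lee_fin ?expR_ge0//.
    - by apply: eq_integral => t _; rewrite /e -EFinM -expRD opprK; congr (expR _)%:E;
      ring.
    - by apply/measurable_EFinP; apply: measurableT_comp.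
  by rewrite (expo_tilt rE (@measurableT _ R)) [X in _ * (_ * X)](_ : _ = 1) ?mule1//;
    exact: probability_setT.
rewrite ge0_integralZl//; last 3 first.
- by apply: emeasurable_funM.
- by move=> t _; rewrite mule_ge0.
- by rewrite lee_fin mulr_ge0// pos_rate_ge0.
rewrite ge0_integralZr// eI !muleA -!EFinM; congr (_%:E * _).
by move: (rg); set x := (_ - _)%R => x0; field; rewrite (gt_eqF x0) gt_eqF.
Qed.

Lemma law_map_sup_ge0 w : (0 <= (law_map D W o theta w).1)%R.
Proof.
rewrite (law_mapE o drivenD)/= (xi_sup_th_code D W o theta w);
  apply: (xi_sup_ge0 drift_lt0).
  exact: good_code drivenD w.
by have [gw _ _] := drivenD; have [w1 _ _ _ _] := gw w; exact: ltW.
Qed.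

Lemma law_map_le_sup w : ((law_map D W o theta w).2 <= (law_map D W o theta w).1)%R.
Proof.
rewrite (law_mapE o drivenD)/= (xi_sup_th_code D W o theta w)
  (xi_th_code D W o theta w); apply: (xi_le_sup drift_lt0).
  exact: good_code drivenD w.
by have [gw _ _] := drivenD; have [w1 _ _ _ _] := gw w; rewrite lexx andbT; exact: ltW.
Qed.

Lemma sup_ge0_law k r : M k r [set x | (x.1 < 0)%R] = 0.
Proof.
rewrite muE; last first.
  by rewrite -[X in measurable X]setTI; apply: (measurable_fun_ltr (f := fst)).
rewrite (_ : _ `&` _ = set0) ?measure0//; apply/seteqP; split => // w [/=].
by rewrite ltNge law_map_sup_ge0.
Qed.

Lemma le_sup_law k r : M k r [set x | (x.1 < x.2)%R] = 0.
Proof.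
rewrite muE; last first.
  by rewrite -[X in measurable X]setTI; apply: (measurable_fun_ltr (f := fst) (g := snd)).
rewrite (_ : _ `&` _ = set0) ?measure0//; apply/seteqP; split => // w [/=].
by rewrite ltNge law_map_le_sup.
Qed.

End first_event_kernel.

(** * Matrix consequences of the ladder identity *)

Lemma Rintegral_expo_cst {R : realType} (c : {posnum R}) (r : R) : \int[expo c]_u r = r.
Proof.
rewrite Rintegral_cst// -[RHS]mulr1; congr (_ * _).
by transitivity (fine (1%E : \bar R)) => //; congr fine; exact: probability_setT.
Qed.

Lemma eq_Rexpo_integral {R : realType} (c : {posnum R}) (f g : R -> R) :
  measurable_fun setT f -> measurable_fun setT g -> (forall u, 0 < u -> f u = g u) ->
  \int[expo c]_u f u = \int[expo c]_u g u.
Proof.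
move=> mf mg fg; congr fine; apply: ae_eq_integral => //; try exact/measurable_EFinP.
have mP : measurable [set u : R | 0 < u].
  by rewrite -[X in measurable X]setTI; apply: (measurable_fun_ltr (f := cst 0)).
exists (~` [set u | 0 < u]); split; first exact: measurableC.
  apply: eq_trans (probability_setC (expo c) mP) _.
  by rewrite [X in (_ - X)%E](_ : _ = 1%E) ?subee//; exact: expo_pos.
by move=> u /= /not_implyP[_ nfg] u0; apply: nfg; rewrite fg.
Qed.

Lemma Complex_sum (R : rcfType) I (r : seq I) (P : pred I) (a b : I -> R) :
  Complex (\sum_(i <- r | P i) a i) (\sum_(i <- r | P i) b i) =
  \sum_(i <- r | P i) Complex (a i) (b i).
Proof. by elim/big_rec3: _ => // i x y z _ <-. Qed.

Section exponential_convolution.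
Context {R : realType} d (T : measurableType d).
Variables (c : {posnum R}) (mu : {finite_measure set T -> \bar R}) (alpha : R)
  (b : T -> R).
Hypothesis mb : measurable_fun setT b.
Let Ac := c%:num ^+ 2 / (c%:num ^+ 2 + alpha ^+ 2).
Let As := c%:num * alpha / (c%:num ^+ 2 + alpha ^+ 2).

Let bm_cosb : bm (fun x => cos (alpha * b x)).
Proof. exact: bm_comp mb (bm_cosl alpha). Qed.

Let bm_sinb : bm (fun x => sin (alpha * b x)).
Proof. exact: bm_comp mb (bm_sinl alpha). Qed.

Let int_expo_cos r : \int[expo c]_u (cos (alpha * u) * r) = Ac * r.
Proof.
by rewrite RintegralZr ?expo_cos//; apply: bm_integrable => //; exact: bm_cosl.
Qed.

Let int_expo_sin r : \int[expo c]_u (sin (alpha * u) * r) = As * r.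
Proof.
by rewrite RintegralZr ?expo_sin//; apply: bm_integrable => //; exact: bm_sinl.
Qed.

Lemma expo_conv_cos : \int[expo c]_u \int[mu]_x cos (alpha * (u + b x)) =
  Ac * \int[mu]_x cos (alpha * b x) - As * \int[mu]_x sin (alpha * b x).
Proof.
rewrite -int_expo_cos -int_expo_sin -RintegralB//; last 2 first.
- by apply: bm_integrable => //; apply: bmM; [exact: bm_cosl|exact: bm_cst].
- by apply: bm_integrable => //; apply: bmM; [exact: bm_sinl|exact: bm_cst].
apply: eq_Rintegral => u _; rewrite -RintegralZl ?bm_integrable//.
rewrite -RintegralZl ?bm_integrable// -RintegralB//; last 2 first.
- by apply: bm_integrable => //; apply: bmM => //; exact: bm_cst.
- by apply: bm_integrable => //; apply: bmM => //; exact: bm_cst.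
by apply: eq_Rintegral => x _; rewrite mulrDr cosD.
Qed.

Lemma expo_conv_sin : \int[expo c]_u \int[mu]_x sin (alpha * (u + b x)) =
  As * \int[mu]_x cos (alpha * b x) + Ac * \int[mu]_x sin (alpha * b x).
Proof.
rewrite -int_expo_cos -int_expo_sin -RintegralD//; last 2 first.
- by apply: bm_integrable => //; apply: bmM; [exact: bm_sinl|exact: bm_cst].
- by apply: bm_integrable => //; apply: bmM; [exact: bm_cosl|exact: bm_cst].
apply: eq_Rintegral => u _; rewrite -RintegralZl ?bm_integrable//.
rewrite -RintegralZl ?bm_integrable// -RintegralD//; last 2 first.
- by apply: bm_integrable => //; apply: bmM => //; exact: bm_cst.
- by apply: bm_integrable => //; apply: bmM => //; exact: bm_cst.
by apply: eq_Rintegral => x _; rewrite mulrDr sinD.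
Qed.

End exponential_convolution.

Section wiener_hopf.
Context {R : realType} {m : nat}.
Variable M : 'I_m -> 'I_m -> {finite_measure set (R * R)%type -> \bar R}.
Variables (c : 'I_m -> {posnum R}) (U : 'I_m -> 'I_m -> R).
Hypothesis ladderM : forall k r (f : R * R -> \bar R), measurable_fun setT f ->
  (forall x, 0 <= f x)%E -> (forall x, f x <= 1)%E ->
  (\int[M k r]_x (if (0 < x.1)%R then f x else 0) =
   \sum_j (U k j)%:E * \int[expo (c j)]_u \int[M j r]_x f (u + x.1, u + x.2)%R)%E.
Hypothesis sup_ge0 : forall k r, M k r [set x | x.1 < 0] = 0.
Hypothesis le_sup : forall k r, M k r [set x | x.1 < x.2] = 0.
Hypothesis contact0 : forall k r, M k r [set x | x.2 = x.1] = 0.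

(** Contact being null, functions need only agree where the value is strictly below the supremum. *)
Lemma eq_RintegralM k r (f g : R * R -> R) :
  measurable_fun setT f -> measurable_fun setT g ->
  (forall x : R * R, 0 <= x.1 -> x.2 < x.1 -> f x = g x) ->
  \int[M k r]_x f x = \int[M k r]_x g x.
Proof.
move=> mf mg fg; congr fine; apply: ae_eq_integral => //; try exact/measurable_EFinP.
have m1 : measurable [set x : R * R | x.1 < 0].
  by rewrite -[X in measurable X]setTI; apply: (measurable_fun_ltr (f := fst)).
have m2 : measurable [set x : R * R | x.1 < x.2].
  by rewrite -[X in measurable X]setTI; apply: (measurable_fun_ltr (f := fst) (g := snd)).
have m3 : measurable [set x : R * R | x.2 = x.1].
  have := @measurable_fun_eqr _ _ R setT snd fst measurable_snd measurable_fst
    measurableT [set true] I.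
  by rewrite setTI; congr measurable; apply/seteqP; split => x /= /eqP.
exists ([set x | x.1 < 0] `|` ([set x | x.1 < x.2] `|` [set x | x.2 = x.1])); split.
- by apply: measurableU => //; exact: measurableU.
- apply: null_set_setU => //; [exact: measurableU|exact: sup_ge0|].
  by apply: null_set_setU => //; [exact: le_sup|exact: contact0].
- move=> x /= /not_implyP[_ nfg]; apply: contrapT => /not_orP[/negP n1
  /not_orP[/negP n2 n3]].
  apply: nfg; rewrite fg// ?leNgt// lt_neqAle leNgt n2 andbT.
  exact/eqP.
Qed.

Lemma bm_fst_le0 (g : R * R -> R) : bm g -> bm (fun x : R * R => if x.1 <= 0 then g x
  else 0).
Proof.
by move=> bg; apply: bm_ifb => //; [exact: measurable_fst_le0|exact: bm_cst].
Qed.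

Theorem ladder_split k r (g : R * R -> R) : bm g ->
  \int[M k r]_x g x = \int[M k r]_x (if x.1 <= 0 then g x else 0) +
    \sum_j U k j * \int[expo (c j)]_u \int[M j r]_x g (u + x.1, u + x.2).
Proof.
move=> bg; rewrite -(real_ladder ladderM k r bg) -RintegralD//; last 2 first.
- by apply: bm_integrable => //; exact: bm_fst_le0.
- by apply: bm_integrable => //; exact: bm_fst_gt0.
by apply: eq_Rintegral => x _; case: (leP x.1 0) => _; rewrite ?addr0 ?add0r.
Qed.

(** The difference value minus supremum is unchanged by a common translation, so the exponential
    averages drop out. *)
Lemma ladder_split_diff k r (f : R -> R) : bm f ->
  \int[M k r]_x f (x.2 - x.1) = \int[M k r]_x (if x.1 <= 0 then f x.2 else 0) +
    \sum_j U k j * \int[M j r]_x f (x.2 - x.1).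
Proof.
move=> bf.
have mD : measurable_fun setT (fun x : R * R => x.2 - x.1) by exact: measurable_funB.
have bg : bm (fun x : R * R => f (x.2 - x.1)) by exact: bm_comp mD bf.
rewrite (ladder_split k r bg); congr (_ + _).
  apply: eq_RintegralM.
  - by case: (bm_fst_le0 bg).
  - by have [] := bm_fst_le0 (bm_comp measurable_snd bf).
  - move=> x x1 _; case: ifPn => // x1'; suff -> : x.1 = 0 by rewrite subr0.
    by apply/eqP; rewrite eq_le x1 x1'.
apply: eq_bigr => j _; congr (_ * _).
transitivity (\int[expo (c j)]_u \int[M j r]_x f (x.2 - x.1)).
  apply: eq_Rintegral => u _; apply: eq_Rintegral => x _ /=; congr f; ring.
exact: Rintegral_expo_cst.
Qed.

(** Both sides reduce to an integral over the paths with supremum 0. There value minus supremum is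
    the value itself and is almost surely negative, where [f] and [phi] agree. *)
Lemma ladder_split_value k r (f phi : R -> R) : bm f -> bm phi ->
  (forall t, t < 0 -> phi t = f t) ->
  \int[M k r]_x f (x.2 - x.1) - \sum_j U k j * \int[M j r]_x f (x.2 - x.1) =
  \int[M k r]_x phi x.2 - \sum_j U k j * \int[expo (c j)]_u \int[M j r]_x phi (u + x.2).
Proof.
move=> bf bphi pf; rewrite (ladder_split_diff k r bf).
rewrite (ladder_split k r (bm_comp measurable_snd bphi)).
rewrite !addrK; apply: eq_RintegralM.
- by case: (bm_fst_le0 (bm_comp measurable_snd bf)).
- by case: (bm_fst_le0 (bm_comp measurable_snd bphi)).
- by move=> x x1 x2; case: ifPn => // x1'; rewrite pf// (lt_le_trans x2).
Qed.

Lemma ladder_split_sup k r (f : R -> R) : bm f ->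
  \int[M k r]_x f x.1 = f 0 * \int[M k r]_x (if x.1 <= 0 then 1 else 0) +
    \sum_j U k j * \int[expo (c j)]_u \int[M j r]_x f (u + x.1).
Proof.
move=> bf; rewrite (ladder_split k r (bm_comp measurable_fst bf)); congr (_ + _).
have b1 : bm (fun x : R * R => if x.1 <= 0 then 1 else 0 : R).
  by apply: (bm_fst_le0 (g := cst 1)); exact: bm_cst.
rewrite -RintegralZl ?bm_integrable//; apply: eq_RintegralM.
- by case: (bm_fst_le0 (bm_comp measurable_fst bf)).
- by case: (bmM (bm_cst _ (f 0)) b1).
- move=> x x1 _; case: ifPn => x1'; rewrite ?mulr1 ?mulr0//; congr f.
  by apply/eqP; rewrite eq_le x1 x1'.
Qed.

Definition Umx : 'M[R]_m := \matrix_(k, j) U k j.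

Definition law_mx (f : 'I_m -> R * R -> R) : 'M[R]_m := \matrix_(k, r) \int[M k r]_x f
  r x.

Definition mass_mx := law_mx (fun _ _ => 1).

Definition atom_mx := law_mx (fun _ x => if x.1 <= 0 then 1 else 0).

Lemma atom_mxE : atom_mx = (1%:M - Umx) *m mass_mx.
Proof.
apply/esym/eqP; rewrite mulmxBl mul1mx subr_eq; apply/eqP/matrixP => k r.
rewrite !mxE (ladder_split_sup k r (bm_cst _ 1)) mul1r; congr (_ + _).
apply: eq_bigr => j _; rewrite !mxE; congr (_ * _).
by rewrite Rintegral_expo_cst.
Qed.

Definition cf_mx (b : R * R -> R) (alpha : R) : 'M[R[i]]_m :=
  \matrix_(k, r) Complex (\int[M k r]_x cos (alpha * b x)) (\int[M k r]_x sin
    (alpha * b x)).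

Definition rate_mx (alpha : R) : 'M[R[i]]_m := diag_mx (\row_k Complex (c k)%:num
  (- alpha)).

Lemma rate_neq0 alpha k : Complex (c k)%:num (- alpha) != 0 :> R[i].
Proof. by rewrite eq_complex/= negb_and gt_eqF. Qed.

Definition inv_rate_mx (alpha : R) : 'M[R[i]]_m :=
  diag_mx (\row_k (Complex (c k)%:num (- alpha))^-1).

Lemma mul_rate_mx alpha : rate_mx alpha *m inv_rate_mx alpha = 1%:M.
Proof.
apply/matrixP => i j; rewrite /rate_mx /inv_rate_mx mulmx_diag !mxE.
by case: eqVneq => // _; rewrite mulfV// rate_neq0.
Qed.

Lemma rate_mx_unit alpha : rate_mx alpha \in unitmx.
Proof. by have [] := mulmx1_unit (mul_rate_mx alpha). Qed.

Lemma invmx_rate alpha : invmx (rate_mx alpha) = inv_rate_mx alpha.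
Proof.
by rewrite -[LHS]mulmx1 -(mul_rate_mx alpha) mulKmx// rate_mx_unit.
Qed.

Definition Crate : 'M[R]_m := diag_mx (\row_k (c k)%:num).

Lemma rate_mxE alpha : mxC Crate - iI alpha = rate_mx alpha.
Proof.
apply/matrixP => i j; rewrite !mxE; case: eqVneq => [->|_];
  rewrite ?mulr1n ?mulr0n ?subr0//.
by apply/eqP; rewrite eq_complex/= subr0 sub0r !eqxx.
Qed.

(** Multiplication by c / (c - i alpha), the transform of the exponential law, written in real
    coordinates. *)
Lemma inv_rate_scale alpha k (x y : R) :
  Complex ((c k)%:num ^+ 2 / ((c k)%:num ^+ 2 + alpha ^+ 2) * x -
           (c k)%:num * alpha / ((c k)%:num ^+ 2 + alpha ^+ 2) * y)
          ((c k)%:num * alpha / ((c k)%:num ^+ 2 + alpha ^+ 2) * x +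
           (c k)%:num ^+ 2 / ((c k)%:num ^+ 2 + alpha ^+ 2) * y) =
  real_complex R (c k)%:num * ((Complex (c k)%:num (- alpha))^-1 * Complex x y).
Proof.
have d0 : (c k)%:num ^+ 2 + alpha ^+ 2 != 0 by rewrite gt_eqF// ltr_wpDr ?sqr_ge0//
  exprn_gt0.
apply: (mulfI (rate_neq0 alpha k)); rewrite mulrCA mulVKf ?rate_neq0//.
apply/eqP; rewrite eq_complex/=; by apply/andP; split; apply/eqP; field.
Qed.

Lemma mulmx_ladder alpha (X : 'M[R[i]]_m) k r :
  (mxC (Umx *m Crate) *m inv_rate_mx alpha *m X) k r =
  \sum_j real_complex R (U k j) * (real_complex R (c j)%:num *
    ((Complex (c j)%:num (- alpha))^-1 * X j r)).
Proof.
rewrite mxE; apply: eq_bigr => j _; rewrite /inv_rate_mx mul_mx_diag /Crate mul_mx_diag.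
by rewrite !mxE rmorphM/= !mulrA.
Qed.

Lemma real_complexM (a x y : R) : Complex (a * x) (a * y) = real_complex R a * Complex
  x y.
Proof. by apply/eqP; rewrite eq_complex/= !mul0r subr0 addr0 !eqxx. Qed.

Lemma sup_cf_eq alpha :
  cf_mx fst alpha = mxC atom_mx + mxC (Umx *m Crate) *m inv_rate_mx alpha *m cf_mx fst
    alpha.
Proof.
apply/matrixP => k r; rewrite [RHS]mxE mulmx_ladder mxE.
rewrite (ladder_split_sup k r (bm_cosl alpha)) (ladder_split_sup k r (bm_sinl alpha)).
rewrite mulr0 cos0 sin0 mul1r mul0r.
transitivity (Complex (\int[M k r]_x (if x.1 <= 0 then 1 else 0)) 0 +
  Complex (\sum_j U k j * \int[expo (c j)]_u \int[M j r]_x cos (alpha * (u + x.1)))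
          (\sum_j U k j * \int[expo (c j)]_u \int[M j r]_x sin (alpha * (u + x.1)))).
  by [].
rewrite !mxE; congr (_ + _); rewrite Complex_sum; apply: eq_bigr => j _.
rewrite expo_conv_cos// expo_conv_sin// real_complexM; congr (_ * _).
by rewrite inv_rate_scale mxE.
Qed.

Definition bar (x : R * R) : R := x.2 - x.1.

Definition value_law k r : {finite_measure set R -> \bar R} := img (M k r) measurable_snd.

Lemma measurable_add_snd : measurable_fun setT (fun z : R * (R * R) => z.1 + z.2.2).
Proof. by apply: measurable_funD => //; exact: measurableT_comp. Qed.

Definition conv_law k r : {finite_measure set R -> \bar R} :=
  img (prodm (expo (c k)) (M k r)) measurable_add_snd.

Let zero : {nonneg R} := NngNum (lexx 0).

(** The zero measure, used as the negative part that [fourier_mx] asks for. *)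
Definition null_law k r : {finite_measure set R -> \bar R} :=
  mix zero zero (value_law k r) (value_law k r).

Lemma inv_rate_ge0 k : 0 <= (c k)%:num^-1. Proof. by rewrite invr_ge0. Qed.

(** Its transform is 1 / (c - i alpha) times that of the value: the convolution with the exponential
    law brings c / (c - i alpha), hence the division by c. *)
Definition scaled_conv_law k r : {finite_measure set R -> \bar R} :=
  mix (NngNum (inv_rate_ge0 k)) zero (conv_law k r) (conv_law k r).

Lemma Rintegral_null_law k r D (g : R -> R) : measurable D -> bm g ->
  \int[null_law k r]_(x in D) g x = 0.
Proof. by move=> mD bg; rewrite Rintegral_mix// !mul0r addr0. Qed.

Lemma Rintegral_value_law k r D (g : R -> R) : measurable D -> bm g ->
  \int[value_law k r]_(x in D) g x = \int[M k r]_x (g \_ D) x.2.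
Proof.
move=> mD bg; rewrite Rintegral_mkcond Rintegral_img//.
by case: (bm_patch mD bg).
Qed.

Lemma Rintegral_scaled_conv_law k r D (g : R -> R) : measurable D -> bm g ->
  \int[scaled_conv_law k r]_(x in D) g x =
  (c k)%:num^-1 * \int[expo (c k)]_u \int[M k r]_x (g \_ D) (u + x.2).
Proof.
move=> mD bg; rewrite Rintegral_mix//= mul0r addr0; congr (_ * _).
have bgD := bm_patch mD bg.
rewrite Rintegral_mkcond Rintegral_img; last by case: bgD.
by rewrite Rintegral_prodm//; exact: bm_comp measurable_add_snd bgD.
Qed.

Lemma patch_setT (g : R -> R) : g \_ setT = g.
Proof. by apply/funext => x; rewrite patchE mem_setT. Qed.

Lemma value_cfE alpha : cf_mx snd alpha = fourier_mx value_law null_law setT alpha.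
Proof.
apply/matrixP => k r; rewrite !mxE /fourier.
rewrite !Rintegral_null_law ?Rintegral_value_law ?patch_setT//; try exact: bm_cosl;
  try exact: bm_sinl.
by rewrite subr0.
Qed.

Lemma conv_cfE alpha : inv_rate_mx alpha *m cf_mx snd alpha =
  fourier_mx scaled_conv_law null_law setT alpha.
Proof.
apply/matrixP => k r; rewrite /inv_rate_mx mul_diag_mx !mxE /fourier.
rewrite !Rintegral_null_law ?Rintegral_scaled_conv_law ?patch_setT//;
  try exact: bm_cosl; try exact: bm_sinl.
rewrite expo_conv_cos// expo_conv_sin// real_complexM inv_rate_scale mulrA.
rewrite -rmorphM/= mulVf// rmorph1 mul1r.
by rewrite subr0.
Qed.

Lemma neg_part_value : neg_part (cf_mx snd) = fourier_mx value_law null_law `]-oo,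
  0[%classic.
Proof. by apply/funext => alpha; apply: neg_partE => b; exact: value_cfE. Qed.

Lemma neg_part_conv : neg_part (fun b => invmx (mxC Crate - iI b) *m cf_mx snd b) =
  fourier_mx scaled_conv_law null_law `]-oo, 0[%classic.
Proof.
apply/funext => alpha; apply: neg_partE => b.
by rewrite rate_mxE invmx_rate conv_cfE.
Qed.

Lemma bar_cf_eq alpha :
  cf_mx bar alpha - mxC Umx *m cf_mx bar alpha =
  neg_part (cf_mx snd) alpha - mxC (Umx *m Crate) *m
    neg_part (fun b => invmx (mxC Crate - iI b) *m cf_mx snd b) alpha.
Proof.
rewrite neg_part_value neg_part_conv; apply/matrixP => k r.
pose fc (t : R) := cos (alpha * t); pose fs (t : R) := sin (alpha * t).
have bc : bm fc by exact: bm_cosl.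
have bs : bm fs by exact: bm_sinl.
have mD : measurable (`]-oo, 0[%classic : set R) by [].
have patchN (f : R -> R) t : t < 0 -> (f \_ `]-oo, 0[) t = f t.
  by move=> t0; rewrite patchE mem_set//= in_itv.
have Ec := ladder_split_value k r bc (bm_patch mD bc) (patchN fc).
have Es := ladder_split_value k r bs (bm_patch mD bs) (patchN fs).
transitivity (Complex
    (\int[M k r]_x fc (x.2 - x.1) - \sum_j U k j * \int[M j r]_x fc (x.2 - x.1))
    (\int[M k r]_x fs (x.2 - x.1) - \sum_j U k j * \int[M j r]_x fs (x.2 - x.1))).
  transitivity (Complex (\int[M k r]_x fc (x.2 - x.1)) (\int[M k r]_x fs (x.2 - x.1)) -
    Complex (\sum_j U k j * \int[M j r]_x fc (x.2 - x.1)) (\sum_j U k j * \int[M j r]_x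
      fs (x.2 - x.1))).
    rewrite !mxE Complex_sum; congr (_ - _); apply: eq_bigr => j _.
    by rewrite real_complexM !mxE.
  by [].
rewrite Ec Es.
transitivity (Complex (\int[M k r]_x (fc \_ `]-oo, 0[) x.2) (\int[M k r]_x
  (fs \_ `]-oo, 0[) x.2) -
    Complex (\sum_j U k j * \int[expo (c j)]_u \int[M j r]_x (fc \_ `]-oo, 0[) (u + x.2))
            (\sum_j U k j * \int[expo (c j)]_u \int[M j r]_x (fs \_ `]-oo, 0[)
              (u + x.2))).
  by [].
rewrite [RHS]mxE [X in _ = _ + X]mxE; congr (_ - _).
  rewrite !mxE /fourier !Rintegral_null_law// !Rintegral_value_law// subr0.
  by [].
rewrite Complex_sum mxE; apply: eq_bigr => j _.
rewrite /Crate mul_mx_diag !mxE /fourier !Rintegral_null_law//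
  !Rintegral_scaled_conv_law// subr0.
by rewrite !real_complexM rmorphM/= mulrA -(mulrA (real_complex R (U k j))) -rmorphM/=
  divff// mulr1.
Qed.

Lemma bar_dist_eq (x : R) : x < 0 ->
  law_mx (fun _ z => \1_(`]-oo, x[%classic : set R) (z.2 - z.1)) -
    Umx *m law_mx (fun _ z => \1_(`]-oo, x[%classic : set R) (z.2 - z.1)) =
  law_mx (fun _ z => \1_(`]-oo, x[%classic : set R) z.2) -
    Umx *m \matrix_(j, r) \int[expo (c j)]_u \int[M j r]_z \1_(`]-oo,
      x[%classic : set R) (u + z.2).
Proof.
move=> x0; apply/matrixP => k r.
have b1 : bm (\1_(`]-oo, x[%classic : set R) : R -> R).
  by apply: bm01 => [|t]; [exact: measurable_indic|rewrite indicE lern1 leq_b1 ler0n].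
have := ladder_split_value k r b1 b1 (fun _ _ => erefl).
rewrite !mxE => E; transitivity (\int[M k r]_z \1_(`]-oo, x[%classic : set R)
  (z.2 - z.1) -
  \sum_j U k j * \int[M j r]_z \1_(`]-oo, x[%classic : set R) (z.2 - z.1)).
  by congr (_ - _); apply: eq_bigr => j _; rewrite !mxE.
by rewrite E; congr (_ - _); apply: eq_bigr => j _; rewrite !mxE.
Qed.

Lemma exp_bar_eq :
  law_mx (fun r z => expR ((c r)%:num * (z.2 - z.1))) -
    Umx *m law_mx (fun r z => expR ((c r)%:num * (z.2 - z.1))) =
  law_mx (fun r z => if z.1 <= 0 then expR ((c r)%:num * z.2) else 0).
Proof.
apply/matrixP => k r.
(* The minimum makes the exponential bounded and changes nothing, value minus supremum being at most
   0. *)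
pose f (t : R) := expR ((c r)%:num * Num.min t 0).
have bf : bm f.
  apply: bm01 => [|t].
    by apply: measurableT_comp => //; apply: measurable_funM => //;
      exact: measurable_minr.
  by rewrite expR_ge0 -expR0 ler_expR pmulr_rle0// ge_min lexx orbT.
have mD : measurable_fun setT (fun x : R * R => x.2 - x.1) by exact: measurable_funB.
have mE : measurable_fun setT (fun x : R * R => expR ((c r)%:num * (x.2 - x.1))).
  by apply: measurableT_comp => //; exact: measurable_funM.
have fE j : \int[M j r]_z expR ((c r)%:num * (z.2 - z.1)) = \int[M j r]_z f (z.2 - z.1).
  apply: eq_RintegralM => //; first by case: (bm_comp mD bf).
  by move=> z _ z12; rewrite /f min_l// subr_le0 ltW.
have := ladder_split_diff k r bf => E.
rewrite !mxE fE (_ : \sum_j _ = \sum_j U k j * \int[M j r]_z f (z.2 - z.1)); last first.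
  by apply: eq_bigr => j _; rewrite !mxE fE.
rewrite E addrK; apply: eq_RintegralM.
- by case: (bm_fst_le0 (bm_comp measurable_snd bf)).
- apply: measurable_fun_ifT => //; first exact: measurable_fst_le0.
  by apply: measurableT_comp => //; exact: measurable_funM.
- by move=> z z1 z12; case: ifPn => // z1'; rewrite /f min_l// (le_trans (ltW z12)).
Qed.

Definition tail k r (t : R) : R := \int[M k r]_z (if t < z.1 then 1 else 0).

Let bm_gt : bm (fun z : R * (R * R) => if z.1 < z.2.1 then 1 else 0 : R).
Proof.
apply: bm_ifb; [|exact: bm_cst|exact: bm_cst].
by apply: measurable_fun_ltr => //; exact: measurableT_comp.
Qed.

Lemma bm_tail k r : bm (tail k r).
Proof. exact: (bm_Rintegral (M k r) bm_gt). Qed.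

Lemma bm_gt_ray (t : R) : bm (fun v : R => if t < v then 1 else 0 : R).
Proof. by apply: bm_ifb; [exact: measurable_fun_ltr|exact: bm_cst|exact: bm_cst]. Qed.

Lemma bm_renewal (c0 y B : R) (f : R -> R) : measurable_fun setT f ->
  (forall t, 0 <= t <= y -> `|f t| <= B) ->
  bm (fun u : R => if 0 < u <= y then f (y - u) else if y < u then c0 else 0).
Proof.
move=> mf fB; split.
  apply: measurable_fun_ifT.
  - by apply: measurable_and; [exact: measurable_fun_ltr|exact: measurable_fun_ler].
  - by apply: (measurableT_comp mf); exact: measurable_funB.
  - by apply: measurable_fun_ifT => //; exact: measurable_fun_ltr.
exists (Num.max B `|c0|) => u; rewrite le_max; case: ifPn => [/andP[u0 uy]|_].
  by rewrite fB//; apply/andP; split; lra.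
by case: ifP => _; rewrite ?lexx ?orbT// normr0 normr_ge0 orbT.
Qed.

(** An overshoot u <= y leaves y - u to be exceeded from the new state; an overshoot u > y already
    exceeds y, and the full mass is counted. *)
Lemma tail_eq k r (y : R) : 0 <= y ->
  tail k r y = \sum_j U k j * \int[expo (c j)]_u
    (if 0 < u <= y then tail j r (y - u) else if y < u then mass_mx j r else 0).
Proof.
move=> y0; rewrite /tail (ladder_split_sup k r (bm_gt_ray y)).
rewrite ltNge y0 mul0r add0r; apply: eq_bigr => j _; congr (_ * _).
have [_ [B tB]] := bm_tail j r.
apply: eq_Rexpo_integral.
- have b2 : bm (fun z : R * (R * R) => if y < z.1 + z.2.1 then 1 else 0 : R).
    apply: bm_ifb; [|exact: bm_cst|exact: bm_cst].
    by apply: measurable_fun_ltr => //; apply: measurable_funD => //;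
      exact: measurableT_comp.
  by case: (bm_Rintegral (M j r) b2).
- by have [] := @bm_renewal (mass_mx j r) y B (tail j r) (bm_tail j r).1
  (fun t _ => tB t).
move=> u u0; rewrite u0/=; case: ifPn => uy.
  by apply: eq_Rintegral => z _; rewrite ltrBlDl.
rewrite -ltNge in uy; rewrite uy mxE; apply: eq_RintegralM => //.
- have m1 : measurable_fun setT (fun z : R * R => u + z.1) by exact: measurable_funD.
  by case: (bm_comp m1 (bm_gt_ray y)).
- by move=> z z1 _; rewrite ltr_wpDr.
Qed.

Hypothesis U_ge0 : forall k j, 0 <= U k j.
Variable beta : R.
Hypotheses (beta0 : 0 <= beta) (beta1 : beta < 1).
Hypothesis U_beta : forall k, \sum_j U k j <= beta.

(** The equation at [y] reads the unknown on [0, y) only, and the terms with u > y are common to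
    both solutions. Hence the difference on [0, Y] shrinks by beta at each iteration, and bounds on
    bounded intervals suffice. *)
Lemma tail_unique (H : 'I_m -> 'I_m -> R -> R) :
  (forall k r, measurable_fun setT (H k r)) ->
  (forall y, exists B, forall k r t, 0 <= t <= y -> `|H k r t| <= B) ->
  (forall k r y, 0 <= y -> H k r y = \sum_j U k j * \int[expo (c j)]_u
    (if 0 < u <= y then H j r (y - u) else if y < u then mass_mx j r else 0)) ->
  forall k r y, 0 <= y -> tail k r y = H k r y.
Proof.
move=> mH Hbound HE k0 r0 Y Y0.
have [B1 HB] := Hbound Y.
have [B tB] : exists B, forall k r t, `|tail k r t| <= B.
  have /choice[f fB] : forall p : 'I_m * 'I_m, exists B, forall t, `|tail p.1 p.2 t| <= B.
    by move=> p; case: (bm_tail p.1 p.2).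
  exists (\sum_p `|f p|) => k r t.
  rewrite (le_trans (fB (k, r) t))// (le_trans (ler_norm _))// (bigD1 (k, r))//= lerDl.
  exact: sumr_ge0.
have diff n : forall k r y, 0 <= y <= Y -> `|tail k r y - H k r y| <= beta ^+ n *
  (B + B1).
  elim: n => [|n IH] k r y /andP[y0 yY].
    by rewrite expr0 mul1r (le_trans (ler_normB _ _))// lerD// HB// y0.
  have D0 : 0 <= beta ^+ n * (B + B1) by apply: le_trans (IH k r y _); rewrite // y0.
  have HBy j t : 0 <= t <= y -> `|H j r t| <= B1.
    by move=> /andP[t0 ty]; rewrite HB// t0 (le_trans ty).
  rewrite tail_eq// HE// -sumrB (le_trans (ler_norm_sum _ _ _))//.
  apply: (@le_trans _ _ (\sum_j U k j * (beta ^+ n * (B + B1)))).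
    apply: ler_sum => j _; rewrite -mulrBr normrM ger0_norm// ler_wpM2l//.
    have b1 := @bm_renewal (mass_mx j r) y B (tail j r) (bm_tail j r).1
      (fun t _ => tB j r t).
    have b2 := @bm_renewal (mass_mx j r) y B1 (H j r) (mH j r) (HBy j).
    rewrite -RintegralB ?bm_integrable//.
    rewrite -[leRHS]mulr1 -[X in _ * X](_ : fine (expo (c j) setT) = 1); last first.
      by transitivity (fine (1%E : \bar R)) => //; congr fine; exact: probability_setT.
    apply: norm_Rintegral_le; first exact: bmB.
    move=> u; case: ifPn => [/andP[u0 uy]|_]; last by rewrite subrr normr0.
    by apply: IH; apply/andP; split; lra.
  by rewrite -mulr_suml exprS -mulrA ler_wpM2r.
apply/eqP; rewrite -subr_eq0 -normr_le0; apply/ler_addgt0Pr => e e0.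
have [n lt] := geometric_small beta0 beta1 (B + B1) e0.
by rewrite add0r (le_trans (diff n _ _ _ _))// Y0 lexx.
Qed.

End wiener_hopf.

(** * From a linear differential equation to the renewal equation *)

Section renewal_ode.
Context {R : realType} (c : {posnum R}) (L H : R -> R).
Hypothesis dL : forall x, is_derive x (1 : R) L (c%:num * (H x - L x)).
Hypothesis cH : continuous H.
Local Notation leb := (@lebesgue_measure R).

Lemma continuous_bounded (y : R) : 0 <= y -> exists B, forall t, 0 <= t <= y -> `|H t|
  <= B.
Proof.
move=> y0.
have cn : {within `[0, y], continuous (fun t => `|H t|)}.
  apply: continuous_subspaceT => t; apply: (@continuous_comp _ _ _ H (fun v => `|v|));
    first exact: cH.
  exact: norm_continuous.
have [t0 _ max] := EVT_max y0 cn.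
by exists `|H t0| => t ty; apply: max; rewrite in_itv.
Qed.

Let mH : measurable_fun setT H.
Proof. exact: continuous_measurable_fun. Qed.

(** Variation of constants: L' = c (H - L) means that L (y) is exp (- c y) L (0) plus the integral
    of c exp (- c u) H (y - u) over [0, y]. The second term is the part u <= y of the average, the
    first one the part u > y. *)
Lemma expo_renewal (y : R) : 0 <= y ->
  \int[expo c]_u (if 0 < u <= y then H (y - u) else if y < u then L 0 else 0) = L y.
Proof.
rewrite le_eqVlt => /orP[/eqP<-|y0].
  have [B HB] := continuous_bounded (lexx 0).
  rewrite -[RHS](Rintegral_expo_cst c); apply: eq_Rexpo_integral => //.
    by case: (bm_renewal (L 0) mH HB).
  by move=> u u0; rewrite u0 leNgt u0.
have [B HB] := continuous_bounded (ltW y0).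
(* Adding the bound [B] of |H| makes the integrand nonnegative; it is removed at the end.
   Correspondingly [F], a primitive of [f], contains L + B. *)
pose phi (u : R) := (if 0 < u <= y then H (y - u) + B else 0 : R).
pose F (u : R) := - (expR (- c%:num * u) * (L (y - u) + B)).
pose f (u : R) := c%:num * expR (- c%:num * u) * (H (y - u) + B).
have dF (u : R) : is_derive u (1 : R) F (f u).
  have dLy : is_derive u (1 : R) (fun v => L (y - v)) (- (c%:num *
    (H (y - u) - L (y - u)))).
    have dy : is_derive u (1 : R) (fun v => y - v) (- 1).
      by apply: is_derive_eq; ring.
    have := @is_derive1_comp R L (fun v => y - v) u _ _ (dL (y - u)) dy.
    by rewrite mulrN1.
  by rewrite /F /f; apply: is_derive_eq; rewrite /GRing.scale/=; ring.
have cF : continuous F.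
  by move=> u; apply: differentiable_continuous; apply/derivable1_diffP; exact: ex_derive.
have csub : continuous (fun u : R => y - u).
  by move=> u; apply: differentiable_continuous; apply/derivable1_diffP; exact: ex_derive.
have cexp : continuous (fun u : R => c%:num * expR (- c%:num * u)).
  by move=> u; apply: differentiable_continuous; apply/derivable1_diffP; exact: ex_derive.
have cf : continuous f.
  move=> u; apply: cvgM.
    exact: cexp.
  by apply: cvgD; [apply: (@continuous_comp _ _ _ (fun u => y - u) H);
    [exact: csub|exact: cH]|exact: cvg_cst].
have B0 : 0 <= B by apply: le_trans (HB 0 _); rewrite // lexx ltW.
have phi0 u : 0 <= phi u.
  rewrite /phi; case: ifPn => // /andP[u0 uy].
  have uy' : 0 <= y - u <= y by apply/andP; split; lra.
  by have := HB _ uy'; rewrite ler_norml => /andP[? _]; lra.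
have mphi : measurable_fun setT phi.
  apply: measurable_fun_ifT => //.
  - by apply: measurable_and; [exact: measurable_fun_ltr|exact: measurable_fun_ler].
  - apply: measurable_funD => //; apply: (measurableT_comp mH); exact: measurable_funB.
have bphi : bm phi.
  split => //; exists (B + B) => u; rewrite /phi; case: ifPn => [/andP[u0 uy]|_].
    rewrite (le_trans (ler_normD _ _))// lerD ?HB//; first by apply/andP; split; lra.
    by rewrite ger0_norm.
  by rewrite normr0 addr_ge0.
have intphi : \int[expo c]_u phi u = L y + B - expR (- c%:num * y) * (L 0 + B).
  rewrite /Rintegral expo_integral_itv; last 2 first.
  - exact/measurable_EFinP.
  - by move=> u; rewrite lee_fin.
  transitivity (fine (\int[leb]_(u in `[0%R, y]) (f u)%:E)%E).
    congr fine; rewrite -[RHS]integral_itv_obnd_cbnd; last first.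
      apply/measurable_funTS/measurable_EFinP; exact: continuous_measurable_fun.
    rewrite integral_mkcond [RHS]integral_mkcond; apply: eq_integral => u _.
    rewrite !patchE !mem_setE !in_itv/= andbT /phi.
    case: (ltP 0 u) => u0; last by case: ifP => _; rewrite ?mule0.
    by rewrite (ltW u0); case: ifP => _; rewrite ?mule0// -EFinM.
  rewrite (@continuous_FTC2 _ f F 0 y y0); last 3 first.
  - exact: continuous_subspaceT.
  - split.
    + by move=> u _; exact: ex_derive.
    + by apply: cvg_at_right_filter; exact: cF.
    + by apply: cvg_at_left_filter; exact: cF.
  - by move=> u _; rewrite derive1E; exact: derive_val.
  by rewrite /F/= mulr0 expR0 subr0 subrr mul1r; lra.
have bray := bm_gt_ray y.
have intray : \int[expo c]_u (if y < u then 1 else 0) = expR (- c%:num * y).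
  apply: EFin_inj; rewrite EFin_Rintegral// -expo_ray ?ltW//.
  rewrite -(setIT `]y, +oo[%classic) -integral_indic//; apply: eq_integral => u _.
  by rewrite indicE mem_setE in_itv/= andbT; case: ifP.
transitivity (\int[expo c]_u (phi u + (- B + (B + L 0) * (if y < u then 1 else 0)))).
  apply: eq_Rexpo_integral.
  - by case: (bm_renewal (L 0) mH HB).
  - by case: (bmD bphi (bmD (bm_cst _ (- B)) (bmM (bm_cst _ (B + L 0)) bray))).
  - by move=> u u0; rewrite /phi u0/= leNgt; case: (ltP y u) => _ /=; lra.
have bs : bm (fun u : R => - B + (B + L 0) * (if y < u then 1 else 0)).
  by apply: bmD; [exact: bm_cst|apply: bmM => //; exact: bm_cst].
rewrite RintegralD ?bm_integrable// RintegralD ?bm_integrable//; last 2 first.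
- exact: bm_cst.
- by apply: bmM => //; exact: bm_cst.
rewrite RintegralZl ?bm_integrable// intphi intray Rintegral_expo_cst; lra.
Qed.

End renewal_ode.

(** * The factorization *)

Section assembly.
Context (R : realType) (m : nat) (D : map_data R m)
    (d : measure_display) (T : measurableType d) (W : driver T R m)
    (P : 'I_m -> probability T R) (theta : {mfun T >-> R}) (s : R)
    (o : 'I_m) (s_gt0 : 0 < s) (chainD : irreducible_chain D)
    (uscD : almost_upper_semicontinuous D) (drivenD : driven D W s P theta).

Lemma usc_drift k : drift D k < 0. Proof. by case: uscD. Qed.

Lemma usc_lam k : 0 < lam D k. Proof. by case: uscD. Qed.

Lemma usc_rate k : 0 < crate D k. Proof. by case: uscD. Qed.

Lemma chain_nu k : 0 < nu D k. Proof. by case: chainD. Qed.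

Lemma total_rate k : 0 < s + (nu D k + lam D k).
Proof. by rewrite addr_gt0// addr_gt0 ?chain_nu ?usc_lam. Qed.

Let sP : {posnum R} := PosNum s_gt0.
Let nuP k : {posnum R} := PosNum (chain_nu k).
Let lamP k : {posnum R} := PosNum (usc_lam k).
Let cP k : {posnum R} := PosNum (usc_rate k).
Let rho k : {posnum R} := PosNum (total_rate k).

Let nuPE k : (nuP k)%:num = nu D k. Proof. by []. Qed.
Let lamPE k : (lamP k)%:num = lam D k. Proof. by []. Qed.
Let cPE k : (cP k)%:num = crate D k. Proof. by []. Qed.
Let sPE : sP%:num = s. Proof. by []. Qed.
Let rhoE k : (rho k)%:num = (sP%:num + ((nuP k)%:num + (lamP k)%:num))%R. Proof. by [].
  Qed.

Let M := mu (W := W) o usc_drift drivenD.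
Let K := first_kernel chainD nuP lamP rho.
Let U k j : R := pos_rate D j / s * fine (atom0 M cP k j 0).

Let stepM := step_first_kernel o chainD usc_drift drivenD nuPE lamPE sPE rhoE.
Let massK := first_kernel_mass chainD rhoE.
Let overK k q (y : R) B := @first_kernel_overshoot R m D chainD uscD usc_drift nuP lamP
  cP nuPE lamPE cPE rho k q y B.
Let sup0 := sup_ge0_law o usc_drift drivenD.
Let lesup := le_sup_law o usc_drift drivenD.
Let contact := null_contact usc_drift stepM massK sup0 lesup.
Let w_ge0 := pos_rate_ge0 lamPE.

Let ladderM k r (f : R * R -> \bar R) : measurable_fun setT f ->
  (forall x, 0 <= f x)%E -> (forall x, f x <= 1)%E ->
  (\int[M k r]_x (if (0 < x.1)%R then f x else 0) =
   \sum_j (U k j)%:E * \int[expo (cP j)]_u \int[M j r]_x f (u + x.1, u + x.2)%R)%E.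
Proof.
move=> mf f0 f1.
rewrite (ladder usc_drift w_ge0 stepM massK overK sup0 lesup k r mf f0 f1).
apply: eq_bigr => j _; congr (_ * _)%E.
have fin : atom0 M cP k j 0 \is a fin_num.
  have le := atom0_le cP sup0 lesup k j 0.
  have lty : (M k j setT < +oo)%E by rewrite -ge0_fin_numE// fin_num_measure.
  by rewrite ge0_fin_numE ?atom0_ge0//; exact: le_lt_trans le lty.
by rewrite /U [RHS]EFinM fineK.
Qed.

Let U_ge0 k j : 0 <= U k j.
Proof. by rewrite mulr_ge0// ?divr_ge0 ?(ltW s_gt0)// fine_ge0// atom0_ge0. Qed.

(** The one-step equation with the constant function 1, multiplied by the total rate, is the
    resolvent equation of the chain; the jump terms cancel as they keep the state. *)
Lemma chain_resolvent : (s%:M - Qmx D) *m mass_mx M = s *: 1%:M.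
Proof.
have mE k r : mass_mx M k r = s / (rho k)%:num * (k == r)%:R +
    \sum_q ((k == q)%:R * (lam D k / (rho k)%:num) + nu D k / (rho k)%:num * trans D k
      q) * mass_mx M q r.
  have m1 : measurable_fun setT (cst 1%E : R * R -> \bar R) by exact: measurable_cst.
  apply: EFin_inj; rewrite {1}mxE EFin_Rintegral; last exact: bm_cst.
  rewrite (stepM k r m1)//= integral_cst// mul1e.
  rewrite [X in (_ * X + _)%E](_ : _ = 1%E); last exact: probability_setT.
  rewrite mule1 EFinD -sumEFin; congr (_ + _)%E; apply: eq_bigr => q _.
  transitivity (\int[first_kernel chainD nuP lamP rho k q]_u (mass_mx M q r)%:E)%E.
    by apply: eq_integral => u _; rewrite mxE EFin_Rintegral//; exact: bm_cst.
  by rewrite integral_cst// muleC EFinM; congr (_ * _)%E; exact: first_kernelT.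
apply/matrixP => k r.
have := mE k r; have rho0 : (rho k)%:num != 0 by [].
under eq_bigr do rewrite mulrDl; rewrite big_split/=.
rewrite (bigD1 k)//= big1 ?addr0; last by move=> q qk; rewrite eq_sym (negbTE qk) !mul0r.
rewrite eqxx mul1r.
under eq_bigr do rewrite -mulrA; rewrite -mulr_sumr => E.
set S := \sum_q _ in E.
have QX : (Qmx D *m mass_mx M) k r = nu D k * (S - mass_mx M k r).
  by rewrite /Qmx -mulmxA mulmxBl mul1mx /Nmx mul_diag_mx [LHS]mxE [in LHS]mxE mxE
    [X in _ + X]mxE mxE.
transitivity (s * mass_mx M k r - (Qmx D *m mass_mx M) k r).
  by rewrite mulmxBl mul_scalar_mx [LHS]mxE [X in _ + X]mxE [X in X + _]mxE.
rewrite QX [RHS]mxE [in RHS]mxE.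
have E' : (s + (nu D k + lam D k)) * mass_mx M k r =
    s * (k == r)%:R + (lam D k * mass_mx M k r + nu D k * S).
  rewrite {1}E; set x := mass_mx M k r; move: rho0 => /=; set z := (s + _) => z0; field.
  exact: z0.
lra.
Qed.

Lemma resolvent_unit : s%:M - Qmx D \in unitmx.
Proof.
have H : (s%:M - Qmx D) *m (s^-1 *: mass_mx M) = 1%:M.
  by rewrite -scalemxAr chain_resolvent scalerA mulVf ?scale1r ?gt_eqF.
by have [] := mulmx1_unit H.
Qed.

Lemma P_sE : P_s D s = mass_mx M.
Proof.
by rewrite /P_s -[RHS](mulKmx resolvent_unit) chain_resolvent -scalemxAr mulmx1.
Qed.

Lemma mu_Rintegral k r (g : R * R -> R) : measurable_fun setT g ->
  \int[P k]_(w in end_in W theta r) g (xi_sup_th D W theta w, xi_th D W theta w) =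
  \int[M k r]_x g x.
Proof.
move=> mg; congr fine; rewrite [LHS]integralE [RHS]integralE.
have mgE : measurable_fun setT (fun x => (g x)%:E) by exact/measurable_EFinP.
rewrite (mu_integral o usc_drift drivenD k r (measurable_funepos mgE) (funepos_ge0 _)).
rewrite (mu_integral o usc_drift drivenD k r (measurable_funeneg mgE) (funeneg_ge0 _)).
by congr (_ - _)%E; apply: eq_integral => w _; rewrite ?funeposE ?funenegE.
Qed.

Lemma Pmx_law (Q : set (R * R)) : measurable Q ->
  Pmx W P theta [set w | Q (xi_sup_th D W theta w, xi_th D W theta w)] = law_mx M
    (fun _ => \1_Q).
Proof.
move=> mQ; apply/matrixP => k r; rewrite !mxE /Rintegral integral_indic// setIT.
transitivity (fine (P k (law_map D W o theta @^-1` Q `&` end_in W theta r))); last first.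
  by congr fine; exact/esym/(muE o usc_drift drivenD k r mQ).
congr (fine (P k (_ `&` _))).
by apply/seteqP; split => w; rewrite /= (law_mapE o drivenD).
Qed.

Let sup_th_ge0 w : 0 <= xi_sup_th D W theta w.
Proof. by have := law_map_sup_ge0 o usc_drift drivenD w;
  rewrite (law_mapE o drivenD). Qed.

Lemma p_plusE : p_plus D W P theta = atom_mx M.
Proof.
have mQ : measurable [set x : R * R | x.1 <= 0].
  by rewrite -[X in measurable X]setTI; apply: (measurable_fun_ler (f := fst)).
transitivity (law_mx M (fun _ => \1_[set x : R * R | x.1 <= 0])).
  rewrite -(Pmx_law mQ); congr (Pmx W P theta _); apply/seteqP; split => w /=;
    first by move->.
  by move=> w0; apply/eqP; rewrite eq_le w0 sup_th_ge0.
apply/matrixP => k r; rewrite !mxE; apply: eq_Rintegral => x _.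
rewrite indicE; case: ifPn => x1; first by rewrite mem_set.
by rewrite memNset//; apply/negP.
Qed.

Let Um := Umx U.

Lemma atom_factor : p_plus D W P theta = (1%:M - Um) *m P_s D s.
Proof. by rewrite p_plusE P_sE (atom_mxE ladderM sup0 lesup contact). Qed.

Lemma q_plusE : q_plus D W P theta s = Um *m P_s D s.
Proof. by rewrite /q_plus atom_factor mulmxBl mul1mx opprB addrC subrK. Qed.

Lemma Ecf_law (b : R * R -> R) : measurable_fun setT b ->
  Ecf W P theta (fun w => b (xi_sup_th D W theta w, xi_th D W theta w)) = cf_mx M b.
Proof.
move=> mb; apply/funext => alpha; apply/matrixP => k r; rewrite !mxE.
have [mc _] : bm (fun x => cos (alpha * b x)) := bm_comp mb (bm_cosl alpha).
have [ms _] : bm (fun x => sin (alpha * b x)) := bm_comp mb (bm_sinl alpha).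
by rewrite (mu_Rintegral k r mc) (mu_Rintegral k r ms).
Qed.

Lemma Phi_plusE : Phi_plus D W P theta = cf_mx M fst.
Proof. exact: Ecf_law measurable_fst. Qed.

Lemma PhiE : Phi D W P theta = cf_mx M snd.
Proof. exact: Ecf_law measurable_snd. Qed.

Let mbar : measurable_fun setT (@bar R).
Proof. exact: measurable_funB. Qed.

Lemma Phi_minusE : Phi_minus D W P theta = cf_mx M (@bar R).
Proof. exact: Ecf_law mbar. Qed.

Lemma E_exp_bar_CE : E_exp_bar_C D W P theta =
  law_mx M (fun r z => expR ((cP r)%:num * (z.2 - z.1))).
Proof.
apply/matrixP => k r; rewrite !mxE.
rewrite (mu_Rintegral k r (g := fun x => expR (crate D r * (x.2 - x.1))))//.
by apply: measurableT_comp => //; apply: measurable_funM => //; exact: mbar.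
Qed.

(** Write G for the right-hand side of [exp_bar_eq], so that (I - U) E = G. By its definition s U =
    G Lambda F, whence s (I - U) + G Lambda F = s I. *)
Lemma ladder_inverse :
  (1%:M - Um) *m (s%:M + E_exp_bar_C D W P theta *m Lmx D *m Fbar0 D) = s%:M.
Proof.
have gE : (1%:M - Um) *m E_exp_bar_C D W P theta =
    law_mx M (fun r z => if z.1 <= 0 then expR ((cP r)%:num * z.2) else 0).
  by rewrite mulmxBl mul1mx E_exp_bar_CE (exp_bar_eq ladderM sup0 lesup contact).
rewrite mulmxDr !mulmxA gE mulmxBl mul1mx -addrA.
rewrite [X in _ + X](_ : _ = 0) ?addr0//; apply/eqP; rewrite addrC subr_eq0; apply/eqP.
rewrite -mulmxA /Lmx /Fbar0 mulmx_diag mul_mx_diag mul_mx_scalar.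
apply/matrixP => k j; rewrite !mxE /U.
have -> : fine (atom0 M cP k j 0) =
    \int[M k j]_x (if x.1 <= 0 then expR ((cP j)%:num * x.2) else 0).
  by congr fine; apply: eq_integral => x _; rewrite !add0r; case: ifP.
rewrite -/(pos_rate D j); set x := Rintegral _ _ _; field; exact: lt0r_neq0.
Qed.

Let Ep := s%:M + E_exp_bar_C D W P theta *m Lmx D *m Fbar0 D.

(** All the inverses come from [ladder_inverse], a one-sided inverse of a square matrix being
    two-sided, and from the resolvent. *)
Lemma factor_units : [/\ (1%:M - Um) \in unitmx, Ep \in unitmx, P_s D s \in unitmx,
  p_plus D W P theta \in unitmx & 1%:M - Um = s *: invmx Ep].
Proof.
have H : (1%:M - Um) *m (s^-1 *: Ep) = 1%:M.
  by rewrite -scalemxAr ladder_inverse scale_scalar_mx mulVf ?gt_eqF.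
have [U1 E1] := mulmx1_unit H.
have Eu : Ep \in unitmx by move: E1; rewrite unitmxZ// unitfE invr_eq0 gt_eqF.
have Pu : P_s D s \in unitmx.
  rewrite /P_s unitmxZ ?unitmx_inv ?resolvent_unit// unitfE gt_eqF//.
split => //; first by rewrite atom_factor unitmx_mul U1 Pu.
by rewrite -[LHS](mulmxK Eu) ladder_inverse mul_scalar_mx.
Qed.

Lemma p_plus_formula : p_plus D W P theta = s *: invmx Ep *m P_s D s.
Proof. by have [_ _ _ _ <-] := factor_units; exact: atom_factor. Qed.

Lemma p_plus_ratio : p_plus D W P theta *m invmx (P_s D s) = 1%:M - Um.
Proof. by have [_ _ Pu _ _] := factor_units; rewrite atom_factor mulmxK. Qed.

Lemma P_s_p_plus : P_s D s *m invmx (p_plus D W P theta) = invmx (1%:M - Um).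
Proof.
have [Uu _ Pu pu _] := factor_units.
rewrite -[RHS](mulmxK pu); congr (_ *m _).
by rewrite atom_factor mulKmx.
Qed.

Lemma q_plus_p_plus : q_plus D W P theta s *m invmx (p_plus D W P theta) =
  invmx (1%:M - Um) *m Um.
Proof.
have [Uu _ _ _ _] := factor_units.
rewrite q_plusE -mulmxA P_s_p_plus; apply: (can_inj (mulKmx Uu)).
rewrite mulKVmx// mulmxA.
(* [Um] commutes with I - U, hence with its inverse. *)
have -> : (1%:M - Um) *m Um = Um *m (1%:M - Um) by rewrite mulmxBl mulmxBr mul1mx mulmx1.
by rewrite mulmxK.
Qed.

Let mxCM (A B : 'M[R]_m) : mxC (A *m B) = mxC A *m mxC B.
Proof. exact: map_mxM. Qed.

Let mxCB (A B : 'M[R]_m) : mxC (A - B) = mxC A - mxC B.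
Proof. exact: map_mxB. Qed.

Let mxC1 : mxC (1%:M : 'M[R]_m) = 1%:M.
Proof. exact: map_mx1. Qed.

Let Ccomplex alpha : mxC (Cmx D) - iI alpha = rate_mx cP alpha.
Proof. exact: rate_mxE cP alpha. Qed.

(** With B = C - i alpha - U C, the ladder equation reads B (C - i alpha)^-1 Phi_+ = p_+. As p_+ is
    invertible, this identity also proves that B is. *)
Lemma Phi_plus_formula alpha :
  mxC (p_plus D W P theta *m invmx (P_s D s) *m Cmx D) - iI alpha \in unitmx /\
  Phi_plus D W P theta alpha = (mxC (Cmx D) - iI alpha)
    *m invmx (mxC (p_plus D W P theta *m invmx (P_s D s) *m Cmx D) - iI alpha)
    *m mxC (p_plus D W P theta).
Proof.
have [_ _ _ pu _] := factor_units.
rewrite p_plus_ratio Phi_plusE; set F := cf_mx M fst alpha.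
set B := _ - iI alpha.
have BE : B = rate_mx cP alpha - mxC (Um *m Cmx D).
  by rewrite /B mulmxBl mul1mx mxCB -Ccomplex addrAC.
have BF : B *m (inv_rate_mx cP alpha *m F) = mxC (p_plus D W P theta).
  rewrite BE mulmxBl !mulmxA mul_rate_mx mul1mx {1}/F (sup_cf_eq ladderM sup0 lesup
    contact) -/F.
  by rewrite addrK p_plusE.
have pCu : mxC (p_plus D W P theta) \in unitmx by rewrite /mxC map_unitmx.
have Bu : B \in unitmx.
  have : B *m (inv_rate_mx cP alpha *m F *m invmx (mxC (p_plus D W P theta))) = 1%:M.
    by rewrite mulmxA BF mulmxV.
  by case/mulmx1_unit.
split => //; rewrite -mulmxA -BF mulKmx// mulmxA Ccomplex mul_rate_mx mul1mx //.
Qed.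

Lemma Phi_minus_formula alpha :
  Phi_minus D W P theta alpha =
  mxC (P_s D s *m invmx (p_plus D W P theta)) *m neg_part (Phi D W P theta) alpha
  - mxC (q_plus D W P theta s *m invmx (p_plus D W P theta) *m Cmx D)
    *m neg_part (fun b => invmx (mxC (Cmx D) - iI b) *m Phi D W P theta b) alpha.
Proof.
have [Uu _ _ _ _] := factor_units.
rewrite P_s_p_plus q_plus_p_plus PhiE Phi_minusE -mulmxA [mxC (_ *m (_ *m _))]mxCM
  -mulmxA -mulmxBr.
rewrite -[X in _ = _ *m X](bar_cf_eq ladderM sup0 lesup contact alpha).
set F := cf_mx M _ _; have -> : F - mxC Um *m F = mxC (1%:M - Um) *m F.
  by rewrite mxCB mxC1 mulmxBl mul1mx.
by rewrite mulmxA -mxCM mulVmx// mxC1 mul1mx.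
Qed.

Let ray_indic (x : R) : measurable_fun setT (\1_(`]-oo, x[%classic : set R) : R -> R).
Proof. exact: measurable_indic. Qed.

Lemma Pdist_law x : Pdist D W P theta x = law_mx M (fun _ z => \1_(`]-oo,
  x[%classic : set R) z.2).
Proof.
have mQ : measurable [set z : R * R | z.2 < x].
  by rewrite -[X in measurable X]setTI; apply: (measurable_fun_ltr (f := snd)).
rewrite /Pdist (Pmx_law mQ); apply/matrixP => k r; rewrite !mxE.
by apply: eq_Rintegral => z _; rewrite !indicE; congr (_ %:R);
  apply/idP/idP => /set_mem zx; apply/mem_set; move: zx; rewrite /= in_itv.
Qed.

Lemma P_minus_law x : P_minus D W P theta x =
  law_mx M (fun _ z => \1_(`]-oo, x[%classic : set R) (z.2 - z.1)).
Proof.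
have mQ : measurable [set z : R * R | z.2 - z.1 < x].
  rewrite -[X in measurable X]setTI; apply: (measurable_fun_ltr (f := @bar R)) => //;
    exact: mbar.
rewrite /P_minus (Pmx_law mQ); apply/matrixP => k r; rewrite !mxE.
by apply: eq_Rintegral => z _; rewrite !indicE; congr (_ %:R);
  apply/idP/idP => /set_mem zx; apply/mem_set; move: zx; rewrite /= in_itv.
Qed.

Lemma expmx_rate (y : R) : expmx (- (y *: Cmx D)) = diag_mx (\row_k expR
  (- (crate D k) * y)).
Proof.
rewrite -expmx_diag; congr expmx; apply/matrixP => i j; rewrite !mxE.
by case: eqVneq => _; rewrite ?mulr1n ?mulr0n ?mulr0 ?oppr0// mulNr mulrC.
Qed.

Lemma rate_convolution x : Cmx D *m (\matrix_(k, r) \int[lebesgue_measure]_(y in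
  `[0, +oo[)
     (expmx (- (y *: Cmx D)) *m Pdist D W P theta (x - y)) k r) =
  \matrix_(j, r) \int[expo (cP j)]_u \int[M j r]_z \1_(`]-oo, x[%classic : set R)
    (u + z.2).
Proof.
apply/matrixP => j r.
have CX (X : 'M[R]_m) : (Cmx D *m X) j r = crate D j * X j r by rewrite /Cmx
  mul_diag_mx !mxE.
rewrite CX [X in _ * X]mxE [RHS]mxE.
have mg : measurable_fun setT (fun z : R * (R * R) => z.1 + z.2.2).
  by apply: measurable_funD => //; exact: measurableT_comp.
have b1 : bm (\1_(`]-oo, x[%classic : set R) : R -> R).
  by apply: bm01 => [|t]; [exact: ray_indic|rewrite indicE lern1 leq_b1 ler0n].
pose f (u : R) : R := \int[M j r]_z \1_(`]-oo, x[%classic : set R) (u + z.2).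
have bf : bm f by exact: (bm_Rintegral (M j r) (bm_comp mg b1)).
have f0 u : 0 <= f u by apply: Rintegral_ge0 => z _; rewrite indicE ler0n.
have mf : measurable_fun setT (EFin \o f) by apply/measurable_EFinP; case: bf.
have me : measurable_fun setT (fun u : R => (crate D j * expR (- crate D j * u))%:E *
  (f u)%:E)%E.
  apply: emeasurable_funM => //; apply/measurable_EFinP; apply: measurable_funM => //.
  exact: measurableT_comp.
rewrite {1}/Rintegral.
have -> : (\int[lebesgue_measure]_(y in `[0%R, +oo[)
      ((expmx (- (y *: Cmx D)) *m Pdist D W P theta (x - y)) j r)%:E)%E =
    ((crate D j)^-1 * \int[expo (cP j)]_u f u)%:E.
  rewrite EFinM EFin_Rintegral// expo_integral_itv//.
  rewrite -ge0_integralZl//; last 3 first.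
  - exact: measurable_funTS me.
  - by move=> u _; rewrite mule_ge0// lee_fin// mulr_ge0 ?expR_ge0// ltW// usc_rate.
  - by rewrite lee_fin invr_ge0 ltW// usc_rate.
  apply: eq_integral => y _; rewrite expmx_rate mul_diag_mx [X in X%:E = _]mxE
    [X in (X * _)%:E = _]mxE.
  rewrite Pdist_law mxE /= -!EFinM; congr (_%:E); rewrite !mulrA mulVf ?mul1r ?gt_eqF
    ?usc_rate//.
  congr (_ * _); apply: eq_Rintegral => z _.
  by rewrite !indicE !mem_setE !in_itv/= ltrBrDl.
by rewrite /= mulrA mulfV ?mul1r// gt_eqF// usc_rate.
Qed.

Lemma P_minus_formula x : x < 0 ->
  P_minus D W P theta x =
  P_s D s *m invmx (p_plus D W P theta) *m Pdist D W P theta x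
  - q_plus D W P theta s *m invmx (p_plus D W P theta) *m Cmx D
    *m \matrix_(k, r) \int[lebesgue_measure]_(y in `[0, +oo[)
       (expmx (- (y *: Cmx D)) *m Pdist D W P theta (x - y)) k r.
Proof.
move=> x0; have [Uu _ _ _ _] := factor_units.
rewrite P_s_p_plus q_plus_p_plus -2!mulmxA -mulmxBr rate_convolution Pdist_law
  P_minus_law.
rewrite -[X in _ = _ *m X](bar_dist_eq ladderM sup0 lesup contact x0).
set F := law_mx M _; have -> : F - Um *m F = (1%:M - Um) *m F.
  by rewrite mulmxBl mul1mx.
by rewrite mulKmx.
Qed.

Lemma Pbar_law x k r : Pbar_plus D W P theta x k r = tail M k r x.
Proof.
have mQ : measurable [set z : R * R | x < z.1].
  by rewrite -[X in measurable X]setTI; apply: (measurable_fun_ltr (g := fst)).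
rewrite /Pbar_plus (Pmx_law mQ) mxE; apply: eq_Rintegral => z _.
by rewrite indicE; case: ifPn => xz; [rewrite mem_set|rewrite memNset//; apply/negP].
Qed.

Lemma P_s_rows k : \sum_r P_s D s k r = 1.
Proof.
pose one : 'cV[R]_m := \col_i 1.
have Q1 : (s%:M - Qmx D) *m one = s *: one.
  rewrite mulmxBl mul_scalar_mx /Qmx -mulmxA mulmxBl mul1mx.
  rewrite (_ : trans D *m one - one = 0) ?mulmx0 ?subr0//; apply/eqP; rewrite subr_eq0;
    apply/eqP.
  apply/matrixP => i j; rewrite !mxE; case: chainD => _ _ /(_ i) <- _.
  by apply: eq_bigr => l _; rewrite mxE mulr1.
have : (P_s D s *m one) k 0 = one k 0.
  by rewrite /P_s -scalemxAl scalemxAr -Q1 mulKmx// resolvent_unit.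
have -> : one k 0 = 1 by rewrite mxE.
by rewrite mxE => <-; apply: eq_bigr => r _; rewrite [X in _ * X]mxE mulr1.
Qed.

(** As P_s is stochastic and p_+ = (I - U) P_s, the k-th row sum of p_+ is 1 minus that of U. It is
    at least the probability s / rho of being killed before any event. *)
Lemma U_rows : exists2 beta, 0 <= beta < 1 & forall k, \sum_j U k j <= beta.
Proof.
have [beta b01 Kb] := contraction_rate massK; exists beta => // k.
apply: (@le_trans _ _ (1 - s / (rho k)%:num)); last by rewrite -lee_fin -massK; exact: Kb.
have pE : \sum_r p_plus D W P theta k r = 1 - \sum_j U k j.
  rewrite atom_factor mulmxBl mul1mx.
  transitivity (\sum_r (P_s D s k r - (Um *m P_s D s) k r)).
    by apply: eq_bigr => r _; rewrite [LHS]mxE [X in _ + X]mxE.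
  rewrite sumrB P_s_rows; congr (_ - _).
  under eq_bigr do rewrite mxE; rewrite exchange_big/=; apply: eq_bigr => j _.
  by rewrite -mulr_sumr P_s_rows mulr1 mxE.
have p0 r : 0 <= p_plus D W P theta k r by rewrite mxE fine_ge0.
have pk : s / (rho k)%:num <= p_plus D W P theta k k.
  rewrite p_plusE mxE -lee_fin EFin_Rintegral; last first.
    by apply: (bm_fst_le0 (g := fun=> 1)); exact: bm_cst.
  apply: le_trans (atom_ge stepM k) _.
  rewrite -(setIT [set x | _]) -integral_indic//; last first.
    by rewrite -[X in measurable X]setTI; apply: (measurable_fun_ler (f := fst)).
  rewrite le_eqVlt; apply/orP; left; apply/eqP; apply: eq_integral => x _.
  by rewrite indicE; case: ifPn => x1; [rewrite mem_set|rewrite memNset//; apply/negP].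
have : p_plus D W P theta k k <= 1 - \sum_j U k j.
  by rewrite -pE (bigD1 k)//= lerDl sumr_ge0.
by move: pk => /le_trans/[apply]; lra.
Qed.

(** For L (y) = P_s exp (y B) with B = - P_s^-1 C p_+, the factorization of p_+ gives P_s B = C (U -
    I) P_s, that is L' = C (U L - L). By [expo_renewal], U L solves the renewal equation, and U P_s
    = q_+. *)
Lemma Pbar_plus_formula x : 0 < x ->
  Pbar_plus D W P theta x = q_plus D W P theta s *m
    expmx (- (x *: (invmx (P_s D s) *m Cmx D *m p_plus D W P theta))).
Proof.
move=> x0; have [Uu _ Pu _ _] := factor_units.
have [beta /andP[beta0 beta1] Ub] := U_rows.
pose B := - (invmx (P_s D s) *m Cmx D *m p_plus D W P theta).
pose L (y : R) := P_s D s *m expmx (y *: B).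
have PB : P_s D s *m B = Cmx D *m (Um - 1%:M) *m P_s D s.
  rewrite /B mulmxN !mulmxA mulmxV// mul1mx atom_factor mulmxA -mulNmx -mulmxN opprB.
  by [].
have dL j r (y : R) : is_derive y (1 : R) (fun y => L y j r)
    ((cP j)%:num * ((Um *m L y) j r - L y j r)).
  have := is_derive_mul_expmx (P_s D s) B j r y.
  rewrite PB -!mulmxA -/(L y) /Cmx mul_diag_mx mulmxBl mul1mx.
  by rewrite [X in is_derive _ _ _ X]mxE [X in X * _]mxE [X in _ * X]mxE [X in _ + X]mxE.
have cH j r : continuous (fun y => (Um *m L y) j r).
  move=> y; apply: differentiable_continuous; apply/derivable1_diffP.
  rewrite (_ : (fun y => _) = fun y => (Um *m P_s D s *m expmx (y *: B)) j r); last first.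
    by apply/funext => z; rewrite /L mulmxA.
  by case: (is_derive_mul_expmx (Um *m P_s D s) B j r y).
have L0 : L 0 = mass_mx M by rewrite /L scale0r expmx0 mulmx1 P_sE.
have HE k r y : 0 <= y -> (Um *m L y) k r = \sum_j U k j * \int[expo (cP j)]_u
    (if 0 < u <= y then (Um *m L (y - u)) j r else if y < u then mass_mx M j r else 0).
  move=> y0; rewrite mxE; apply: eq_bigr => j _; rewrite mxE; congr (_ * _).
  by rewrite -(expo_renewal (dL j r) (cH j r) y0) L0.
have Hbound (y : R) : exists B, forall k r t, 0 <= t <= y -> `|(Um *m L t) k r| <= B.
  have [y0|y0] := leP 0 y; last first.
    by exists 0 => k r t /andP[t0 ty]; have := le_lt_trans (le_trans t0 ty) y0;
      rewrite ltxx.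
  have /choice[f fB] : forall p : 'I_m * 'I_m, exists B, forall t, 0 <= t <= y ->
    `|(Um *m L t) p.1 p.2| <= B.
    by move=> p; exact: (continuous_bounded (cH p.1 p.2) y0).
  exists (\sum_p `|f p|) => k r t ty.
  rewrite (le_trans (fB (k, r) t ty))// (le_trans (ler_norm _))// (bigD1 (k, r))//= lerDl.
  exact: sumr_ge0.
have mH k r : measurable_fun setT (fun y => (Um *m L y) k r).
  by apply: continuous_measurable_fun; exact: cH.
apply/matrixP => k r; rewrite Pbar_law.
rewrite (tail_unique ladderM sup0 lesup contact U_ge0 beta0 beta1 Ub mH Hbound HE k r
  (ltW x0)).
by rewrite /L mulmxA -q_plusE -scalerN.
Qed.

End assembly.

(* The inverses in the formulas are asserted to exist, since [invmx] is total. *)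
Theorem theorem2 (R : realType) (m : nat) (D : map_data R m)
    (d : measure_display) (T : measurableType d) (W : driver T R m)
    (P : 'I_m -> probability T R) (theta : {mfun T >-> R}) (s : R)
    (hs : 0 < s)
    (hchain : irreducible_chain D)
    (husc : almost_upper_semicontinuous D)
    (hdriven : driven D W s P theta)
    (hstanding : standing_assumptions D W P) :
  let C := Cmx D in
  let Ps := P_s D s in
  let p := p_plus D W P theta in
  let q := q_plus D W P theta s in
  let E := E_exp_bar_C D W P theta in
  let F := Phi D W P theta in
  [/\ [/\ s%:M - Qmx D \in unitmx, Ps \in unitmx, p \in unitmx,
          s%:M + E *m Lmx D *m Fbar0 D \in unitmx
        & forall alpha, mxC C - iI alpha \in unitmx /\
            mxC (p *m invmx Ps *m C) - iI alpha \in unitmx],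
      [/\ forall alpha,
            Phi_plus D W P theta alpha =
            (mxC C - iI alpha) *m invmx (mxC (p *m invmx Ps *m C) - iI alpha)
              *m mxC p,
          p = s *: invmx (s%:M + E *m Lmx D *m Fbar0 D) *m Ps
        & forall x, 0 < x ->
            Pbar_plus D W P theta x = q *m expmx (- (x *: (invmx Ps *m C *m p)))],
      forall alpha,
        Phi_minus D W P theta alpha =
        mxC (Ps *m invmx p) *m neg_part F alpha
        - mxC (q *m invmx p *m C)
            *m neg_part (fun b => invmx (mxC C - iI b) *m F b) alpha
    & forall x, x < 0 ->
        P_minus D W P theta x =
        Ps *m invmx p *m Pdist D W P theta x
        - q *m invmx p *m C
            *m \matrix_(k, r) \int[lebesgue_measure]_(y in `[0, +oo[)
                 (expmx (- (y *: C)) *m Pdist D W P theta (x - y)) k r].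
Proof.
move=> C Ps p q E F.
(* The sample space is pointed, so its chosen outcome provides a state, which serves as base point
   of the configurations. *)
have o : 'I_m := embedded W 0%N point.
have [Uu Eu Pu pu _] := factor_units o hs hchain husc hdriven.
have Cu alpha : mxC C - iI alpha \in unitmx.
  by rewrite (rate_mxE (fun k => PosNum (usc_rate husc k)) alpha) rate_mx_unit.
split.
- split => // [|alpha]; first exact: resolvent_unit o hs hchain husc hdriven.
  by split => //; case: (Phi_plus_formula o hs hchain husc hdriven alpha).
- split => [alpha||x x0].
  + by case: (Phi_plus_formula o hs hchain husc hdriven alpha).
  + exact: p_plus_formula o hs hchain husc hdriven.
  + exact: (Pbar_plus_formula o hs hchain husc hdriven x0).
- by move=> alpha; exact: Phi_minus_formula o hs hchain husc hdriven alpha.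
- by move=> x x0; exact: (P_minus_formula o hs hchain husc hdriven x0).
Qed.
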